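(* Let $r\geq 1$. A finitely generated $\Lambda$-module $M$ is ($\Lambda$-isomorphic to) the module $M(\ell)$ of a virtual $r$-link $\ell$ if and only if $M$ is a cokernel-free $\Lambda$-module of corank $r-1$ and $e(E^2M)\leq 1+\beta(M)$.
   Context: $\Lambda=\mathbb{Z}[\mathbb{Z}]=\mathbb{Z}[t,t^{-1}]$. A virtual $r$-link diagram is a diagram of $r$ immersed oriented loops in $S^2$ whose (transverse double) crossing points are of two kinds: real crossings (with over/under information) and virtual crossings. A virtual $r$-link $\ell$ is an equivalence class of virtual $r$-link diagrams under the (classical) Reidemeister moves involving real crossings and the virtual Reidemeister moves of Kauffman: the analogues of Reidemeister moves I, II, III with only virtual crossings, and the mixed move in which an arc having only virtual crossings (two of them) is moved across a real crossing. The group $\pi(\ell)$ is given by the Wirtinger presentation whose generators are the edges of a diagram of $\ell$ (edges run between consecutive crossings, real or virtual) and whose relations are: at a virtual crossing, the two edges of each of the two strands through it are equal; at a real crossing with over-strand consisting of edges $a,d$ and under-strand consisting of edges $b$ (to the left of the oriented over-strand) and $c$ (to the right), $a=d$ and $b=a^{-1}ca$. Let $\gamma:\pi(\ell)\to\mathbb{Z}$ be the epimorphism sending every Wirtinger generator to $1$. The module of $\ell$ is $M(\ell)=\ker\gamma/[\ker\gamma,\ker\gamma]$, a $\Lambda$-module where $t$ acts by conjugation by any element $x$ with $\gamma(x)=1$. A finitely generated $\Lambda$-module $M$ is cokernel-free of corank $n$ if $M/(t-1)M\cong\mathbb{Z}^n$ as abelian groups. $\beta(M)=\dim_{Q(\Lambda)}M\otimes_\Lambda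 Q(\Lambda)$, with $Q(\Lambda)$ the quotient field of $\Lambda$. $E^2M=\mathrm{Ext}^2_\Lambda(M,\Lambda)$. $e(N)$ is the minimal number of $\Lambda$-generators of $N$. *)

(* Defs.v *)
From HB Require Import structures.
From mathcomp Require Import all_boot all_order all_algebra.
From Stdlib Require Relations.
From mathcomp Require Import boolp classical_sets functions.
From mathcomp Require Import multinomials.freeg.

Set Implicit Arguments.
Unset Strict Implicit.
Unset Printing Implicit Defensive.

Import GRing.Theory.
Local Open Scope ring_scope.
Local Open Scope quotient_scope.

(* V / <G>, the quotient of V by the submodule generated by the set G. *)
Section SpanQuotient.
Variables (R : pzRingType) (V : lmodType R) (G : set V).

Definition span_pred : {pred V} := fun x => `[< exists n (a : 'I_n -> R) (g : 'I_n -> V),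
  (forall i, G (g i)) /\ x = \sum_i a i *: g i >].

Lemma span_subsemimod_closed : GRing.subsemimod_closed span_pred.
Proof.
split; [split|].
- by apply/asboolP; exists 0%N, (fun=> 0), (fun=> 0); split; [case|rewrite big_ord0].
- move=> x y /asboolP[n [a [g [Gg ->]]]] /asboolP[m [b [h [Gh ->]]]].
  pose c (i : 'I_(n + m)) := match fintype.split i with inl j => a j | inr j => b j end.
  pose k (i : 'I_(n + m)) := match fintype.split i with inl j => g j | inr j => h j end.
  apply/asboolP; exists (n + m)%N, c, k; split.
    by move=> i; rewrite /k; case: (fintype.split i).
  rewrite big_split_ord /= /c /k; congr (_ + _); apply: eq_bigr => i _.
    by rewrite (unsplitK (inl i)).
  by rewrite (unsplitK (inr i)).
- move=> a x /asboolP[n [b [g [Gg ->]]]]; apply/asboolP.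
  exists n, (fun i => a * b i), g; split=> //.
  by rewrite scaler_sumr; apply: eq_bigr => i _; rewrite scalerA.
Qed.

HB.instance Definition _ := GRing.isSubmodClosed.Build R V span_pred span_subsemimod_closed.

Definition quot_span := Quotient.quot span_pred.
HB.instance Definition _ := GRing.Zmodule.on quot_span.
HB.instance Definition _ := EqQuotient.on quot_span.

Definition quot_scale (a : R) (u : quot_span) : quot_span := \pi_quot_span (a *: repr u).

Lemma quot_spanE (x y : V) : (\pi_quot_span x = \pi_quot_span y) <-> x - y \in span_pred.
Proof.
by split=> [/eqP|h]; [|apply/eqP]; rewrite -[_ == _]Quotient.idealrBE.
Qed.

Lemma pi_quot_scale a (x : V) : quot_scale a (\pi_quot_span x) = \pi_quot_span (a *: x).
Proof.
apply/quot_spanE; rewrite -scalerBr; apply: rpredZ.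
by apply/quot_spanE; rewrite reprK.
Qed.

Lemma quot_piD (x y : V) : (\pi_quot_span x + \pi_quot_span y : quot_span) = \pi_quot_span (x + y).
Proof. by rewrite !piE. Qed.

Fact quot_scaleA a b u : quot_scale a (quot_scale b u) = quot_scale (a * b) u.
Proof. by elim/quotW: u => x; rewrite (pi_quot_scale b x) !pi_quot_scale scalerA. Qed.
Fact quot_scale1 : left_id 1 quot_scale.
Proof. by elim/quotW=> x; rewrite pi_quot_scale scale1r. Qed.
Fact quot_scaleDr : right_distributive quot_scale +%R.
Proof.
move=> a; elim/quotW=> x; elim/quotW=> y.
by rewrite quot_piD !pi_quot_scale quot_piD scalerDr.
Qed.
Fact quot_scaleDl u : {morph quot_scale^~ u : a b / a + b}.
Proof.
by elim/quotW: u => x a b /=; rewrite !pi_quot_scale quot_piD scalerDl.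
Qed.
HB.instance Definition _ := GRing.Zmodule_isLmodule.Build R quot_span
  quot_scaleA quot_scale1 quot_scaleDr quot_scaleDl.

End SpanQuotient.

Section Modules.
Variable (R : nzRingType).

Definition lmod_iso (M N : lmodType R) : Prop := exists f : {linear M -> N}, bijective f.
Definition generated_by (N : lmodType R) (n : nat) : Prop :=
  exists v : 'I_n -> N, forall x, exists a : 'I_n -> R, x = \sum_i a i *: v i.
Definition finitely_generated (N : lmodType R) : Prop := exists n, generated_by N n.

(* e(N) = n *)
Definition min_generators (N : lmodType R) (n : nat) : Prop :=
  generated_by N n /\ forall m, generated_by N m -> (n <= m)%N.
End Modules.

Section FreeResolution.
Variables (R : nzRingType).

(* The canonical free resolution of M: the term in degree n is the free module
   on the underlying set of the n-th syzygy, the 0-th syzygy being M and the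
   next one the kernel of the tautological map onto the previous one. *)
Section Cover.
Variable V : lmodType R.
Definition free_cover (x : {freeg V / R}) : V := fglift id x.

Fact free_cover_is_zmod_morphism : zmod_morphism free_cover.
Proof. exact: lift_is_additive. Qed.
HB.instance Definition _ :=
  GRing.isZmodMorphism.Build {freeg V / R} V free_cover free_cover_is_zmod_morphism.

Fact free_cover_is_scalable : scalable free_cover.
Proof.
move=> a x.
have -> : a *: free_cover x = \sum_(k <- dom x) a *: (coeff k x *: k).
  rewrite -[x in LHS]freeg_sumE raddf_sum scaler_sumr.
  by apply: eq_bigr => k _; rewrite /= /free_cover liftU.
rewrite [X in free_cover X]/GRing.scale /= /fgscale raddf_sum.
by apply: eq_bigr => k _; rewrite /= /free_cover liftU scalerA.
Qed.
HB.instance Definition _ :=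
  GRing.isScalable.Build R {freeg V / R} V *:%R free_cover free_cover_is_scalable.
End Cover.

Section Kernel.
Variables (U V : lmodType R) (f : {linear U -> V}).
Definition ker_pred : {pred U} := fun x => f x == 0.
Fact ker_subsemimod_closed : GRing.subsemimod_closed ker_pred.
Proof.
split; [split|] => [|x y /eqP fx /eqP fy|a x /eqP fx]; apply/eqP.
- exact: raddf0.
- by rewrite raddfD /= fx fy addr0.
- by rewrite linearZ_LR fx scaler0.
Qed.
HB.instance Definition _ := GRing.isSubmodClosed.Build R U ker_pred ker_subsemimod_closed.
Record ker_mod := KerMod { ker_val : U; _ : ker_val \in ker_pred }.
HB.instance Definition _ := [isSub for ker_val].
HB.instance Definition _ := [Choice of ker_mod by <:].
HB.instance Definition _ := [SubChoice_isSubLmodule of ker_mod by <:].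
End Kernel.

Fixpoint syzygy (M : lmodType R) (n : nat) : lmodType R :=
  if n is m.+1 then ker_mod (@free_cover (syzygy M m)) else M.
Definition free_res (M : lmodType R) n : lmodType R := {freeg (syzygy M n) / R}.
Definition free_res_d (M : lmodType R) n : {linear free_res M n.+1 -> free_res M n} :=
   (val : ker_mod (@free_cover (syzygy M n)) -> free_res M n) \o @free_cover (syzygy M n.+1).

Lemma free_cover_surj (V : lmodType R) (y : V) : free_cover << y >> = y.
Proof. by rewrite /free_cover liftU scale1r. Qed.

(* With V = M this is exactness at free_res M 0 of
     free_res M 1 -> free_res M 0 -> M -> 0. *)
Lemma ker_free_cover (V : lmodType R) (x : {freeg V / R}) :
  free_cover x = 0 <-> exists y : {freeg (ker_mod (@free_cover V)) / R}, val (free_cover y) = x.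
Proof.
split=> [x0|[y <-]]; last exact/eqP/(valP (free_cover y)).
have xP : x \in ker_pred (@free_cover V) by apply/eqP.
by exists << (Sub x xP : ker_mod _) >>; rewrite free_cover_surj.
Qed.

Lemma res_exact (M : lmodType R) n (x : free_res M n.+1) :
  free_res_d M n x = 0 <-> exists y, free_res_d M n.+1 y = x.
Proof.
split=> [x0|[y <-]]; first by apply/ker_free_cover/val_inj; exact: x0.
have y0 : free_cover (free_res_d M n.+1 y) = 0 by apply/ker_free_cover; exists y.
by rewrite [LHS]/(val (free_cover _)) y0.
Qed.

End FreeResolution.

(* Ext^n_R(M, N), the n-th cohomology of Hom_R(free_res M, N). *)
Section Ext.
Variables (R : comNzRingType) (M N : lmodType R).

Definition cocycle_pred n : {pred free_res M n -> N} :=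
  fun f => `[< linear f /\ forall x, f (free_res_d M n x) = 0 >].
Fact cocycle_subsemimod_closed n : GRing.subsemimod_closed (@cocycle_pred n).
Proof.
split; [split|] => [|f g /asboolP[lf f0] /asboolP[lg g0]|a f /asboolP[lf f0]];
  apply/asboolP; split.
- by move=> a x y /=; rewrite scaler0 addr0.
- by [].
- move=> a x y; change (f (a *: x + y) + g (a *: x + y) = a *: (f x + g x) + (f y + g y)).
  by rewrite lf lg scalerDr addrACA.
- by move=> x; change (f (free_res_d M n x) + g (free_res_d M n x) = 0); rewrite f0 g0 addr0.
- move=> b x y; change (a *: f (b *: x + y) = b *: (a *: f x) + a *: f y).
  by rewrite lf scalerDr !scalerA mulrC.
- by move=> x; change (a *: f (free_res_d M n x) = 0); rewrite f0 scaler0.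
Qed.
HB.instance Definition _ n := GRing.isSubmodClosed.Build R (free_res M n -> N)
  (@cocycle_pred n) (@cocycle_subsemimod_closed n).
Record cocycle n :=
  Cocycle { cocycle_val : free_res M n -> N; _ : cocycle_val \in @cocycle_pred n }.
HB.instance Definition _ n := [isSub for @cocycle_val n].
HB.instance Definition _ n := [Choice of cocycle n by <:].
HB.instance Definition _ n := [SubChoice_isSubLmodule of cocycle n by <:].

Definition coboundary n : set (cocycle n) :=
  match n with
  | 0 => classical_sets.set0
  | m.+1 => [set c | exists g : {linear free_res M m -> N}, val c = g \o free_res_d M m]
  end.

Definition Ext n : lmodType R := quot_span (@coboundary n).
End Ext.

(* The tensor product S (x)_R M along phi : R -> S; << a *g m >> is the symbol
   a (x) m, and additivity in a is built into the free S-module. *)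
Section BaseChange.
Variables (R : nzRingType) (S : nzRingType) (phi : {rmorphism R -> S}) (M : lmodType R).
Definition tensor_rel : set {freeg M / S} :=
  [set x | (exists m n, x = << m + n >> - << m >> - << n >>) \/
           (exists a m, x = << a *: m >> - << phi a *g m >>)].
Definition base_change : lmodType S := quot_span tensor_rel.
End BaseChange.

Definition has_dim (K : fieldType) (V : lmodType K) (n : nat) : Prop :=
  exists b : 'I_n -> V, forall v, exists! a : {ffun 'I_n -> K}, v = \sum_i a i *: b i.

(* Z[t, t^-1] as the subring of Q(t) = Frac Z[t] of the fractions p(t) / t^n. *)
Definition laurent_pred : {pred {fraction {poly int}}} := fun x =>
  `[< exists (p : {poly int}) (n : nat), x = tofrac p / tofrac 'X ^+ n >].

Lemma fracX_neq0 : tofrac 'X != 0 :> {fraction {poly int}}.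
Proof. by rewrite tofrac_eq0 polyX_eq0. Qed.

Lemma laurent_subring_closed : GRing.subring_closed laurent_pred.
Proof.
have X0 n : tofrac 'X ^+ n != 0 :> {fraction {poly int}} by rewrite expf_neq0 ?fracX_neq0.
split.
- by apply/asboolP; exists 1, 0%N; rewrite expr0 divr1 rmorph1.
- move=> _ _ /asboolP[p [n ->]] /asboolP[q [m ->]]; apply/asboolP.
  exists (p * 'X^m - q * 'X^n), (n + m)%N.
  rewrite rmorphB !rmorphM !rmorphXn /= exprD.
  by rewrite -[X in _ + X = _]mulNr addf_div ?X0 ?mulNr.
- move=> _ _ /asboolP[p [n ->]] /asboolP[q [m ->]]; apply/asboolP.
  by exists (p * q), (n + m)%N; rewrite mulf_div exprD rmorphM.
Qed.
HB.instance Definition _ :=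
  GRing.isSubringClosed.Build {fraction {poly int}} laurent_pred laurent_subring_closed.

Record Laurent :=
  MkLaurent { laurent_val : {fraction {poly int}}; _ : laurent_val \in laurent_pred }.
HB.instance Definition _ := [isSub for laurent_val].
HB.instance Definition _ := [Choice of Laurent by <:].
HB.instance Definition _ := [SubChoice_isSubComNzRing of Laurent by <:].

Definition laurent_unit : {pred Laurent} :=
  fun x => (val x != 0) && ((val x)^-1 \in laurent_pred).
Definition laurent_inv (x : Laurent) : Laurent :=
  if x \in laurent_unit then insubd x (val x)^-1 else x.
Fact laurent_mulVx : {in laurent_unit, left_inverse 1 laurent_inv *%R}.
Proof.
move=> x xU; rewrite /laurent_inv xU; case/andP: xU => x0 xV.
by apply: val_inj; rewrite /= insubdK // mulVf.
Qed.
Fact laurent_unitPl (x y : Laurent) : y * x = 1 -> laurent_unit x.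
Proof.
move/(congr1 val) => /= yx.
have x0 : val x != 0.
  apply/eqP => x0; move: yx; rewrite x0 mulr0 => /esym/eqP. by rewrite oner_eq0.
rewrite /laurent_unit x0 /=.
suff -> : (val x)^-1 = val y by exact: (valP y).
by apply: (mulIf x0); rewrite mulVf.
Qed.
Fact laurent_invr_out : {in [predC laurent_unit], laurent_inv =1 id}.
Proof. by move=> x; rewrite inE /laurent_inv => /negbTE ->. Qed.
HB.instance Definition _ := GRing.ComNzRing_hasMulInverse.Build Laurent
  laurent_mulVx laurent_unitPl laurent_invr_out.
Fact laurent_integral (x y : Laurent) : x * y = 0 -> (x == 0) || (y == 0).
Proof. by move/(congr1 val)/eqP => /=; rewrite mulf_eq0. Qed.
HB.instance Definition _ := GRing.ComUnitRing_isIntegral.Build Laurent laurent_integral.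

Fact laurentX_subproof : tofrac 'X \in laurent_pred.
Proof. by apply/asboolP; exists 'X, 0%N; rewrite expr0 divr1. Qed.
Definition laurent_t : Laurent := MkLaurent laurentX_subproof.

Lemma laurent_fracP (a : Laurent) :
  exists pn : {poly int} * nat, val a = tofrac pn.1 / tofrac 'X ^+ pn.2.
Proof. by have /asboolP[p [n ->]] := valP a; exists (p, n). Qed.
Definition laurent_num a := (sval (cid (laurent_fracP a))).1.
Definition laurent_den a := (sval (cid (laurent_fracP a))).2.
Lemma laurent_numdenE a : val a = tofrac (laurent_num a) / tofrac 'X ^+ laurent_den a.
Proof. exact: (svalP (cid (laurent_fracP a))). Qed.

Lemma laurent_t_unit : laurent_t \is a GRing.unit.
Proof.
rewrite unfold_in; apply/andP; split; first exact: fracX_neq0.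
by apply/asboolP; exists 1, 1%N; rewrite expr1 rmorph1 mul1r.
Qed.

(* The group <X | u = v for (u, v) in rel>; in a word the letter (x, true) is x
   and (x, false) is its inverse. *)
Section Presentation.
Variable X : choiceType.
Definition word := seq (X * bool).
Variable rel : word -> word -> Prop.

Inductive presented_eq : word -> word -> Prop :=
| PresRel u v : rel u v -> presented_eq u v
| PresCancel x b : presented_eq [:: (x, b); (x, ~~ b)] [::]
| PresRefl u : presented_eq u u
| PresSym u v : presented_eq u v -> presented_eq v u
| PresTrans u v w : presented_eq u v -> presented_eq v w -> presented_eq u w
| PresCat u u' v v' : presented_eq u u' -> presented_eq v v' -> presented_eq (u ++ v) (u' ++ v').

Definition presented_eqb (u v : word) : bool := `[< presented_eq u v >].
Lemma presented_equiv : equiv_class_of presented_eqb.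
Proof.
split=> [u|u v|v u w].
- exact/asboolP/PresRefl.
- by apply/asboolP/asboolP; apply: PresSym.
- by move=> /asboolP uv /asboolP vw; apply/asboolP; apply: PresTrans uv vw.
Qed.
Canonical presented_equiv_rel := EquivRelPack presented_equiv.
Canonical presented_encModRel := defaultEncModRel presented_eqb.

Definition presented := {eq_quot presented_eqb}.
HB.instance Definition _ : EqQuotient word presented_eqb presented := EqQuotient.on presented.
HB.instance Definition _ := Choice.on presented.

Definition cls (u : word) : presented := \pi_presented u.

Lemma clsP u v : cls u = cls v <-> presented_eq u v.
Proof. by split=> [/eqmodP/asboolP|h] //; apply/eqmodP/asboolP. Qed.

Lemma repr_cls u : presented_eq (repr (cls u)) u.
Proof. by apply/clsP; rewrite /cls reprK. Qed.

Definition word_inv (u : word) : word := rev [seq (x.1, ~~ x.2) | x <- u].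

Lemma word_invK : involutive word_inv.
Proof.
move=> u; rewrite /word_inv map_rev revK -map_comp map_id_in // => -[x b] _ /=.
by rewrite negbK.
Qed.

Lemma word_inv_cat u v : word_inv (u ++ v) = word_inv v ++ word_inv u.
Proof. by rewrite /word_inv map_cat rev_cat. Qed.

Lemma presented_mulV u : presented_eq (u ++ word_inv u) [::].
Proof.
elim: u => [|[x b] u IH]; first exact: PresRefl.
rewrite -cat1s word_inv_cat.
have -> : ([:: (x, b)] ++ u) ++ word_inv u ++ word_inv [:: (x, b)] =
          [:: (x, b)] ++ ((u ++ word_inv u) ++ [:: (x, ~~ b)]) by rewrite -!catA.
apply: PresTrans (PresCancel x b); apply: (PresCat (PresRefl _)).
by rewrite -[X in presented_eq _ X]cat0s; apply: (PresCat IH (PresRefl _)).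
Qed.

Lemma presented_inv u v : presented_eq u v -> presented_eq (word_inv u) (word_inv v).
Proof.
move=> uv; rewrite -[word_inv u]cats0.
apply: (@PresTrans _ (word_inv u ++ (v ++ word_inv v))).
  by apply: PresCat (PresRefl _) _; apply/PresSym/presented_mulV.
apply: (@PresTrans _ ((word_inv u ++ u) ++ word_inv v)).
  by rewrite -catA; apply: PresCat (PresRefl _) _; apply: PresCat (PresSym uv) (PresRefl _).
rewrite -[X in presented_eq _ X]cat0s; apply: PresCat (PresRefl _).
by have := presented_mulV (word_inv u); rewrite word_invK.
Qed.

Definition presented_mul (g h : presented) : presented := cls (repr g ++ repr h).
Definition presented_one : presented := cls [::].
Definition presented_invg (g : presented) : presented := cls (word_inv (repr g)).

Lemma cls_mul u v : presented_mul (cls u) (cls v) = cls (u ++ v).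
Proof. by apply/clsP/PresCat; exact: repr_cls. Qed.
Lemma cls_inv u : presented_invg (cls u) = cls (word_inv u).
Proof. by apply/clsP/presented_inv/repr_cls. Qed.

Lemma cls_ind (P : presented -> Prop) : (forall u, P (cls u)) -> forall g, P g.
Proof. by move=> h g; rewrite -[g]reprK; exact: h. Qed.

Fact presented_mulgA : associative presented_mul.
Proof.
by elim/cls_ind=> u; elim/cls_ind=> v; elim/cls_ind=> w; rewrite !cls_mul catA.
Qed.
Fact presented_mul1g : left_id presented_one presented_mul.
Proof. by elim/cls_ind=> u; rewrite /presented_one cls_mul. Qed.
Fact presented_mulg1 : right_id presented_one presented_mul.
Proof. by elim/cls_ind=> u; rewrite /presented_one cls_mul cats0. Qed.
Fact presented_mulgV : right_inverse presented_one presented_invg presented_mul.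
Proof. by elim/cls_ind=> u; rewrite cls_inv cls_mul; apply/clsP/presented_mulV. Qed.
Fact presented_mulVg : left_inverse presented_one presented_invg presented_mul.
Proof.
elim/cls_ind=> u; rewrite cls_inv cls_mul; apply/clsP.
by have := presented_mulV (word_inv u); rewrite word_invK.
Qed.
HB.instance Definition _ := isGroup.Build presented
  presented_mulgA presented_mul1g presented_mulg1 presented_mulVg presented_mulgV.
End Presentation.

Section Abelianization.
Local Open Scope group_scope.
Variable G : groupType.

(* The inverse of a commutator is a commutator, so [G, G] is the set of finite
   products of commutators. *)
Definition in_derived (g : G) : Prop :=
  exists s : seq (G * G), g = \prod_(c <- s) [~ c.1, c.2].

Lemma derived1 : in_derived 1. Proof. by exists [::]; rewrite big_nil. Qed.
Lemma derivedM g h : in_derived g -> in_derived h -> in_derived (g * h).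
Proof. by move=> [s ->] [s' ->]; exists (s ++ s'); rewrite big_cat. Qed.
Lemma derivedR g h : in_derived [~ g, h].
Proof. by exists [:: (g, h)]; rewrite big_seq1. Qed.
Lemma derivedV g : in_derived g -> in_derived g^-1.
Proof.
move=> [s ->]; elim: s => [|[a b] s IH]; first by rewrite big_nil invg1; exact: derived1.
by rewrite big_cons invgM; apply: derivedM IH _; rewrite /= invgR; exact: derivedR.
Qed.
Lemma derivedJ g h : in_derived g -> in_derived (g ^ h).
Proof.
by move=> gd; rewrite -[g ^ h](mulVKg g) -commgEl; apply: derivedM gd (derivedR _ _).
Qed.

Definition ab_eqb (g h : G) : bool := `[< in_derived (g^-1 * h) >].
Lemma ab_equiv : equiv_class_of ab_eqb.
Proof.
split=> [g|g h|h g k].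
- by apply/asboolP; rewrite mulVg; exact: derived1.
- by apply/asboolP/asboolP => /derivedV; rewrite invgM invgK.
- move=> /asboolP gh /asboolP hk; apply/asboolP.
  by have := derivedM gh hk; rewrite mulgA mulgK.
Qed.
Canonical ab_equiv_rel := EquivRelPack ab_equiv.
Canonical ab_encModRel := defaultEncModRel ab_eqb.
Definition abelianization := {eq_quot ab_eqb}.
HB.instance Definition _ : EqQuotient G ab_eqb abelianization := EqQuotient.on abelianization.
HB.instance Definition _ := Choice.on abelianization.

Definition ab_cls (g : G) : abelianization := \pi_abelianization g.
Lemma ab_clsP g h : ab_cls g = ab_cls h <-> in_derived (g^-1 * h).
Proof. by split=> [/eqmodP/asboolP|gh] //; apply/eqmodP/asboolP. Qed.
Lemma ab_ind (P : abelianization -> Prop) : (forall g, P (ab_cls g)) -> forall u, P u.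
Proof. by move=> h u; rewrite -[u]reprK; exact: h. Qed.

Lemma ab_cls_congr g g' h h' :
  ab_cls g = ab_cls g' -> ab_cls h = ab_cls h' -> ab_cls (g * h) = ab_cls (g' * h').
Proof.
move=> /ab_clsP gg /ab_clsP hh; apply/ab_clsP.
have := derivedM hh (derivedJ h' gg).
by rewrite conjgE invgM !mulgA mulgK.
Qed.

Definition ab_add (u v : abelianization) : abelianization := ab_cls (repr u * repr v).
Definition ab_opp (u : abelianization) : abelianization := ab_cls (repr u)^-1.
Definition ab_zero : abelianization := ab_cls 1.

Lemma ab_reprK u : ab_cls (repr u) = u. Proof. exact: reprK. Qed.
Lemma ab_cls_add g h : ab_add (ab_cls g) (ab_cls h) = ab_cls (g * h).
Proof. by apply: ab_cls_congr; rewrite ab_reprK. Qed.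

Fact ab_addA : associative ab_add.
Proof. by elim/ab_ind=> g; elim/ab_ind=> h; elim/ab_ind=> k; rewrite !ab_cls_add mulgA. Qed.
Fact ab_addC : commutative ab_add.
Proof.
elim/ab_ind=> g; elim/ab_ind=> h; rewrite !ab_cls_add; apply/ab_clsP.
by rewrite invgM -mulgA; exact: derivedR.
Qed.
Fact ab_add0 : left_id ab_zero ab_add.
Proof. by elim/ab_ind=> g; rewrite /ab_zero ab_cls_add mul1g. Qed.
Fact ab_addN : left_inverse ab_zero ab_opp ab_add.
Proof. by move=> u; have := ab_cls_add (repr u)^-1 (repr u); rewrite mulVg ab_reprK. Qed.
HB.instance Definition _ := GRing.isZmodule.Build abelianization ab_addA ab_addC ab_add0 ab_addN.
Lemma ab_clsM g h : ab_cls (g * h) = (ab_cls g + ab_cls h)%R.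
Proof. by rewrite -ab_cls_add. Qed.
End Abelianization.

(* An abelian group with an automorphism f, of inverse g, as a module over
   Z[t, t^-1] with t acting as f. *)
Section Twist.
Variables (A : zmodType) (f g : {additive A -> A}).
Hypotheses (fK : cancel f g) (gK : cancel g f).

Definition poly_act (p : {poly int}) (m : A) : A := \sum_(i < size p) iter i f m *~ p`_i.

Implicit Types (p q : {poly int}) (m : A).

Lemma poly_act_widen n p m : (size p <= n)%N ->
  poly_act p m = \sum_(i < n) iter i f m *~ p`_i.
Proof.
move=> le_pn; rewrite /poly_act (big_ord_widen n (fun i => iter i f m *~ p`_i) le_pn).
rewrite [RHS](bigID (fun i : 'I_n => (i < size p)%N)) /= [X in _ = _ + X]big1 ?addr0 //.
by move=> i; rewrite -leqNgt => /(nth_default 0) ->.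
Qed.

Lemma poly_actD p q m : poly_act (p + q) m = poly_act p m + poly_act q m.
Proof.
rewrite (poly_act_widen m (size_polyD p q)) (poly_act_widen m (leq_maxl (size p) (size q))).
rewrite (poly_act_widen m (leq_maxr (size p) (size q))) -big_split /=.
by apply: eq_bigr => i _; rewrite coefD mulrzDr.
Qed.

Lemma iter_additive (h : {additive A -> A}) i : zmod_morphism (iter i h).
Proof. by elim: i => [|i IH] x y //=; rewrite IH raddfB. Qed.

Lemma poly_act_additive p : zmod_morphism (poly_act p).
Proof.
move=> x y; rewrite /poly_act -sumrB; apply: eq_bigr => i _.
by rewrite iter_additive mulrzBl.
Qed.
HB.instance Definition _ p := GRing.isZmodMorphism.Build A A (poly_act p) (poly_act_additive p).

Lemma poly_actC c m : poly_act c%:P m = m *~ c.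
Proof. by rewrite (poly_act_widen m (size_polyC_leq1 c)) big_ord1 coefC. Qed.

Lemma poly_actMX p m : poly_act (p * 'X) m = poly_act p (f m).
Proof.
have le : (size (p * 'X)%R <= (size p).+1)%N.
  by apply: leq_trans (size_polyMleq _ _) _; rewrite size_polyX addn2.
rewrite (poly_act_widen m le) big_ord_recl coefMX /= mulr0z add0r.
by apply: eq_bigr => i _; rewrite coefMX /= -iterSr.
Qed.

Lemma poly_act_f p m : poly_act p (f m) = f (poly_act p m).
Proof.
rewrite /poly_act raddf_sum; apply: eq_bigr => i _.
by rewrite raddfMz /= -iterSr.
Qed.

Lemma poly_act_g p m : poly_act p (g m) = g (poly_act p m).
Proof. by rewrite -{2}[m]gK poly_act_f fK. Qed.

Lemma poly_actMXn p n m : poly_act (p * 'X^n) m = iter n f (poly_act p m).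
Proof.
elim: n m => [|n IH] m; first by rewrite expr0 mulr1.
by rewrite exprSr mulrA poly_actMX IH poly_act_f -iterSr.
Qed.

Lemma poly_actMC p c m : poly_act (p * c%:P) m = poly_act p (m *~ c).
Proof.
have le : (size (p * c%:P)%R <= size p)%N.
  by rewrite mulrC mul_polyC; exact: size_scale_leq.
rewrite raddfMz /= (poly_act_widen m le) /poly_act mulrz_suml.
by apply: eq_bigr => i _; rewrite coefMC mulrzA.
Qed.

Lemma poly_actM p q m : poly_act (p * q) m = poly_act p (poly_act q m).
Proof.
elim/poly_ind: q m => [|q c IH] m.
  by rewrite mulr0 -polyC0 !poly_actC !mulr0z raddf0.
rewrite mulrDr mulrA !poly_actD poly_actMX IH poly_actMX raddfD /=; congr (_ + _).
by rewrite poly_actMC poly_actC.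
Qed.

Lemma iter_fgK n : cancel (iter n f) (iter n g).
Proof. by elim: n => [|n IH] m //; rewrite [iter _ f _]iterS iterSr fK IH. Qed.
Lemma iter_gfK n : cancel (iter n g) (iter n f).
Proof. by elim: n => [|n IH] m //; rewrite [iter _ g _]iterS iterSr gK IH. Qed.
Lemma iter_g_poly_act n p m : iter n g (poly_act p m) = poly_act p (iter n g m).
Proof. by elim: n => //= n ->; rewrite poly_act_g. Qed.

Definition laurent_module of cancel f g & cancel g f : Type := A.
Local Notation B := (laurent_module fK gK).
HB.instance Definition _ := GRing.Zmodule.on B.

Definition laurent_scale (a : Laurent) (m : B) : B :=
  iter (laurent_den a) g (poly_act (laurent_num a) m).

Lemma laurent_scaleE a p n (m : B) : val a = tofrac p / tofrac 'X ^+ n ->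
  laurent_scale a m = iter n g (poly_act p m).
Proof.
rewrite laurent_numdenE => /eqP; rewrite eqr_div ?expf_neq0 ?fracX_neq0 //.
rewrite -!rmorphXn -!rmorphM /= tofrac_eq => /eqP e; rewrite /laurent_scale.
set d := laurent_den a in e *; set q := laurent_num a in e *.
apply: (can_inj (iter_fgK (d + n))).
rewrite {1}[(d + n)%N]addnC !iterD !iter_gfK -!poly_actMXn.
by rewrite e.
Qed.

Fact laurent_scaleA a b (m : B) : laurent_scale a (laurent_scale b m) = laurent_scale (a * b) m.
Proof.
rewrite (@laurent_scaleE (a * b) (laurent_num a * laurent_num b)
  (laurent_den a + laurent_den b)).
  by rewrite /laurent_scale -!iter_g_poly_act poly_actM iterD.
by rewrite /= !laurent_numdenE mulf_div rmorphM exprD.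
Qed.
Fact laurent_scale1 : left_id 1 laurent_scale.
Proof.
move=> m; rewrite (@laurent_scaleE 1 1 0) ?expr0 ?divr1 ?rmorph1 //=.
by rewrite -polyC1 poly_actC.
Qed.
Fact iter_additiveD (h : {additive A -> A}) n : {morph iter n h : x y / x + y}.
Proof. by elim: n => [|n IH] x y //; rewrite !iterS IH raddfD. Qed.
Fact laurent_scaleDr : right_distributive laurent_scale +%R.
Proof.
move=> a x y; rewrite /laurent_scale -iter_additiveD; congr (iter _ _ _).
exact: raddfD.
Qed.
Fact laurent_scaleDl m : {morph laurent_scale^~ m : a b / a + b}.
Proof.
move=> a b /=; set d := laurent_den a; set e := laurent_den b.
rewrite (@laurent_scaleE _ (laurent_num a * 'X^e + laurent_num b * 'X^d) (d + e)).
  rewrite poly_actD !poly_actMXn iter_additiveD {1}iterD iter_fgK.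
  by rewrite addnC iterD iter_fgK.
rewrite /= !laurent_numdenE -/d -/e addf_div ?expf_neq0 ?fracX_neq0 //.
by rewrite rmorphD !rmorphM !rmorphXn /= exprD.
Qed.
HB.instance Definition _ := GRing.Zmodule_isLmodule.Build Laurent B
  laurent_scaleA laurent_scale1 laurent_scaleDr laurent_scaleDl.

Lemma scale_t (m : B) : laurent_t *: m = f m :> A.
Proof.
rewrite [LHS](@laurent_scaleE laurent_t 'X 0) ?expr0 ?divr1 //=.
by rewrite -['X]mul1r poly_actMX -polyC1 poly_actC.
Qed.
End Twist.

(* Link diagrams on the oriented sphere, encoded as plane maps.

   An element of edge is an oriented edge, running from one crossing (real or
   virtual) of the diagram to the next. At the crossing where e ends:
   - next_edge e is the edge that continues the strand of e;
   - across e is the edge on which the other strand arrives, so that the four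
     edges there are e, next_edge e, across e and next_edge (across e);
   - from_left e tells whether that other strand crosses the strand of e from
     left to right, i.e. whether across e arrives from the left of e;
   - role e tells whether e is on the over- or under-strand of a real crossing,
     or the crossing is virtual.
   A loop that meets no crossing is a single edge e with next_edge e = e and
   across e = e; from_left e and role e are then meaningless.
   A diagram may be disconnected. The position of its connected components with
   respect to each other is not recorded: it is immaterial for virtual links, as
   a component can be moved across any arc by virtual and mixed moves. *)
Inductive strand_role := Over | Under | Virtual.

Definition opposite_role (s : strand_role) : strand_role :=
  match s with Over => Under | Under => Over | Virtual => Virtual end.

(* The darts (e, true) and (e, false) are e travelled forwards and backwards;
   left_turn d follows d and turns left at the crossing it leads to, so its
   orbits are the faces of the diagram. Planarity is Euler's formula
   V + F = E + 2 C, with C the number of connected components of the diagram.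
   The orbits of across are the crossings; a loop without crossing counts as a
   graph with one vertex, one edge and two faces. *)
Section Faces.
Variables (E : finType) (next_edge across : E -> E) (from_left : pred E).

Definition left_turn (d : E * bool) : E * bool :=
  let: (e, fwd) := d in
  let p := if fwd then e else finv next_edge e in
  let q := across p in
  if q == p then d
  else if fwd then (if from_left p then (q, false) else (next_edge q, true))
  else (if from_left p then (next_edge q, true) else (q, false)).

Definition adjacent_edges : rel E := [rel e e' | (e' == next_edge e) || (e' == across e)].

Definition planar_diagram : Prop :=
  (fcard across predT + fcard left_turn predT = #|E| + (n_comp adjacent_edges predT).*2)%N.
End Faces.

Record vdiagram (r : nat) := VDiagram {
  edge : finType;
  next_edge : edge -> edge;
  across : edge -> edge;
  from_left : pred edge;
  role : edge -> strand_role;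
  next_inj : injective next_edge;
  acrossK : involutive across;
  across_fixed : forall e, across e = e -> next_edge e = e;
  from_left_across : forall e, across e != e -> from_left (across e) = ~~ from_left e;
  role_across : forall e, across e != e -> role (across e) = opposite_role (role e);
  number_of_loops : fcard next_edge predT = r;
  on_sphere : planar_diagram next_edge across from_left
}.

Arguments edge {r} v.
Arguments next_edge {r v} e.
Arguments across {r v} e.
Arguments from_left {r v} e.
Arguments role {r v} e.

Section Moves.
Variables (r : nat) (D D' : vdiagram r).

(* D' is D with the crossings at which the edges in S end ignored (S has to be
   stable under across); f sends an edge of D to the edge of D' that contains it.
   For S empty f is an isomorphism of diagrams. *)
Definition erases (S : {set edge D}) : Prop := exists f : edge D -> edge D',
  [/\ forall e', exists e, f e = e',
      forall e1 e2, f e1 = f e2 <->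
        connect [rel x y | (x \in S) && (y == next_edge x) ||
                           (y \in S) && (x == next_edge y)] e1 e2,
      forall e, e \notin S -> next_edge (f e) = f (next_edge e) /\ across (f e) = f (across e),
      forall e, e \notin S -> across e != e ->
        from_left (f e) = from_left e /\ role (f e) = role e &
      forall e, (forall e', fconnect next_edge e e' -> e' \in S) ->
        next_edge (f e) = f e /\ across (f e) = f e].

(* The crossing removed is real or virtual. *)
Definition reidemeister1 : Prop := exists e : edge D,
  [/\ across e = next_edge e, across e != e & erases [set e; next_edge e]].

(* The two strands run from a to next_edge (next_edge a) and likewise for b, either
   in the same or in opposite directions; by the condition on from_left the edges
   next_edge a and next_edge b bound a bigon. The two crossings are both
   virtual, or both real with the same strand on top. *)
Definition reidemeister2 : Prop := exists a b : edge D,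
  [/\ uniq [:: a; next_edge a; b; next_edge b],
      across a = b /\ across (next_edge a) = next_edge b \/
      across a = next_edge b /\ across (next_edge a) = b,
      from_left (next_edge a) = ~~ from_left a,
      role (next_edge a) = role a &
      erases [set a; next_edge a; b; next_edge b]].

Definition turn (d : edge D * bool) := left_turn next_edge across from_left d.

Definition swap3 (a b c e : edge D) : edge D :=
  if e == a then next_edge a else if e == next_edge a then a else
  if e == b then next_edge b else if e == next_edge b then b else
  if e == c then next_edge c else if e == next_edge c then c else e.

(* The edges next_edge a, next_edge b, next_edge c bound a triangle. The move
   exchanges, on each of the three strands, the two crossings of the triangle,
   without changing how the strands cross each other. Either one strand has only
   virtual crossings in the triangle (purely virtual or mixed move), or all three
   crossings are real and one strand is above the other two. *)
Definition reidemeister3 : Prop := exists (a b c : edge D),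
  [/\ uniq [:: a; next_edge a; b; next_edge b; c; next_edge c],
      exists sa sb sc, [/\ turn (next_edge a, sa) = (next_edge b, sb),
                             turn (next_edge b, sb) = (next_edge c, sc)
                           & turn (next_edge c, sc) = (next_edge a, sa)],
      role a = Virtual /\ role (next_edge a) = Virtual \/
      [/\ role a = Over, role (next_edge a) = Over, role b <> Virtual &
          role (next_edge b) <> Virtual] &
      exists f : edge D -> edge D',
        [/\ bijective f,
            forall e, next_edge (f e) = f (next_edge e),
            forall e, across (f e) = f (swap3 a b c (across (swap3 a b c e))) &
            forall e, across e != e ->
             from_left (f (swap3 a b c e)) = from_left e /\ role (f (swap3 a b c e)) = role e]].

Definition reidemeister_move : Prop :=
  erases finset.set0 \/ reidemeister1 \/ reidemeister2 \/ reidemeister3.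
End Moves.

Definition vequiv r : vdiagram r -> vdiagram r -> Prop :=
  Relation_Operators.clos_refl_sym_trans _ (@reidemeister_move r).

Definition virtual_link r := {L : vdiagram r -> Prop | exists D, forall D', L D' <-> vequiv D D'}.

Section LinkModule.
Variables (r : nat) (D : vdiagram r).
Implicit Types (e a : edge D).

(* For an over-strand a, the edges of the under-strand to its left and right. *)
Definition left_under a : edge D := if from_left a then across a else next_edge (across a).
Definition right_under a : edge D := if from_left a then next_edge (across a) else across a.

Inductive wirtinger : word (edge D) -> word (edge D) -> Prop :=
| WirtVirtual e of across e != e & role e = Virtual :
    wirtinger [:: (e, true)] [:: (next_edge e, true)]
| WirtOver a of across a != a & role a = Over :
    wirtinger [:: (a, true)] [:: (next_edge a, true)]
| WirtUnder a of across a != a & role a = Over :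
    wirtinger [:: (left_under a, true)]
      [:: (a, false); (right_under a, true); (a, true)].

Definition link_group : groupType := presented wirtinger.
Definition wirtinger_gen e : link_group := cls wirtinger [:: (e, true)].

Definition exponent_sum (u : word (edge D)) : int := \sum_(x <- u) (if x.2 then 1 else -1).

Lemma exponent_sum_presented u v : presented_eq wirtinger u v -> exponent_sum u = exponent_sum v.
Proof.
rewrite /exponent_sum; elim=> {u v} //.
- by move=> u v [e _ _|a _ _|a _ _]; rewrite !big_cons !big_nil.
- by move=> x [] ; rewrite !big_cons !big_nil.
- by move=> u v w _ -> _ ->.
- by move=> u u' v v' _ IH _ IH'; rewrite !big_cat /= IH IH'.
Qed.

Definition gamma (g : link_group) : int := exponent_sum (repr g).

Lemma gamma_cls u : gamma (cls wirtinger u) = exponent_sum u.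
Proof. exact/exponent_sum_presented/repr_cls. Qed.
Lemma gamma_generator e : gamma (wirtinger_gen e) = 1.
Proof. by rewrite gamma_cls /exponent_sum big_seq1. Qed.
Lemma gamma1 : gamma 1%g = 0.
Proof. by rewrite [LHS]gamma_cls /exponent_sum big_nil. Qed.
Lemma gammaM g h : gamma (g * h)%g = gamma g + gamma h.
Proof. by rewrite [LHS]gamma_cls /exponent_sum big_cat. Qed.
Lemma gammaV g : gamma g^-1%g = - gamma g.
Proof. by apply/eqP; rewrite -addr_eq0 -gammaM mulVg gamma1. Qed.

Definition ker_gamma_pred : {pred link_group} := fun g => gamma g == 0.
Fact ker_gamma_closed : group_closed ker_gamma_pred.
Proof.
split=> [|g h /eqP g0 /eqP h0]; apply/eqP; first exact: gamma1.
by rewrite gammaM gammaV g0 h0 subr0.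
Qed.
Record ker_gamma := KerGamma { ker_gamma_val : link_group; _ : ker_gamma_val \in ker_gamma_pred }.
HB.instance Definition _ := [isSub for ker_gamma_val].
HB.instance Definition _ := [Choice of ker_gamma by <:].
HB.instance Definition _ := 
  SubChoice_isSubGroup.Build link_group ker_gamma_pred ker_gamma ker_gamma_closed.

Fact conj_ker_subproof (x : link_group) (k : ker_gamma) : (x * val k * x^-1)%g \in ker_gamma_pred.
Proof. by rewrite unfold_in !gammaM gammaV (eqP (valP k)) addr0 subrr. Qed.
Definition conj_ker x k : ker_gamma := KerGamma (conj_ker_subproof x k).

Definition ker_ab : zmodType := abelianization ker_gamma.
Definition ab_conj (x : link_group) (u : ker_ab) : ker_ab := ab_cls (conj_ker x (repr u)).

Fact conj_kerF x : {morph conj_ker x : k l / (k / l)%g}.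
Proof. by move=> k l; apply: val_inj; rewrite /= !invgM !invgK !mulgA mulgVK. Qed.
HB.instance Definition _ x :=
  isGroupMorphism.Build ker_gamma ker_gamma (conj_ker x) (conj_kerF x).

Lemma derived_conj_ker x k : in_derived k -> in_derived (conj_ker x k).
Proof.
move=> [s ->]; exists [seq (conj_ker x c.1, conj_ker x c.2) | c <- s].
by rewrite gmulf_prod big_map; apply: eq_bigr => c _; rewrite gmulfR.
Qed.

Lemma ab_conj_cls x k : ab_conj x (ab_cls k) = ab_cls (conj_ker x k).
Proof.
apply/ab_clsP; rewrite -gmulfV -gmulfM; apply: derived_conj_ker.
by apply/ab_clsP; rewrite ab_reprK.
Qed.

Fact ab_conj_is_zmod_morphism x : zmod_morphism (ab_conj x).
Proof.
have conjD : {morph ab_conj x : u v / u + v}.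
  elim/ab_ind=> k; elim/ab_ind=> l.
  by rewrite -ab_clsM !ab_conj_cls -ab_clsM gmulfM.
have conj0 : ab_conj x 0 = 0 by apply: (addrI (ab_conj x 0)); rewrite -conjD !addr0.
move=> u v; rewrite conjD; congr (_ + _).
by apply/eqP; rewrite -addr_eq0 -conjD addNr conj0.
Qed.
HB.instance Definition _ x :=
  GRing.isZmodMorphism.Build ker_ab ker_ab (ab_conj x) (ab_conj_is_zmod_morphism x).

Lemma ab_conjK x : cancel (ab_conj x) (ab_conj x^-1%g).
Proof.
elim/ab_ind=> k; rewrite !ab_conj_cls; congr ab_cls; apply: val_inj => /=.
by rewrite invgK !mulgA mulVg mul1g mulgVK.
Qed.
Lemma ab_conjVK x : cancel (ab_conj x^-1%g) (ab_conj x).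
Proof. by move=> u; rewrite -{1}[x]invgK ab_conjK. Qed.

Definition meridian : link_group := if [pick e : edge D] is Some e then wirtinger_gen e else 1%g.

Definition link_module : lmodType Laurent :=
  laurent_module (ab_conjK meridian) (ab_conjVK meridian).

(* The action of t does not depend on the meridian. *)
Lemma scale_t_link x (k : ker_gamma) : gamma x = 1 ->
  laurent_t *: (ab_cls k : link_module) = ab_cls (conj_ker x k).
Proof.
move=> gx; transitivity (ab_conj meridian (ab_cls k)); first exact: scale_t.
rewrite ab_conj_cls.
have gm : gamma meridian = 1.
  rewrite /meridian; case: pickP => [e _|noE]; first exact: gamma_generator.
  suff x1 : x = 1%g by rewrite x1 gamma1 in gx.
  rewrite -[x]reprK; congr (cls _ _).
  by case: (repr x) => // -[e b] u; have := noE e.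
have kP : (meridian^-1 * x)%g \in ker_gamma_pred.
  by rewrite unfold_in gammaM gammaV gm gx addNr.
pose l : ker_gamma := KerGamma kP.
have -> : conj_ker x k = conj_ker meridian (l * k * l^-1)%g.
  by apply: val_inj; rewrite /= !invgM invgK !mulgA mulgV mul1g mulgK.
rewrite -!ab_conj_cls; congr ab_conj.
by rewrite !ab_clsM addrC addrA -(ab_clsM l^-1%g l) mulVg [RHS]add0r.
Qed.
End LinkModule.

Definition cokernel_free (M : lmodType Laurent) (n : nat) : Prop :=
  finitely_generated M /\
  exists f : {additive quot_span [set x : M | exists m : M, x = (laurent_t - 1) *: m] ->
                       'rV[int]_n},
    bijective f.

(* M (x) Q(Lambda). *)
Definition generic_fiber (M : lmodType Laurent) : lmodType {fraction Laurent} :=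
  base_change (@tofrac Laurent) M.

Definition E2 (M : lmodType Laurent) : lmodType Laurent := Ext M Laurent^o 2.

(* M is isomorphic to M(l), computed from a diagram of the class l. *)
Definition is_link_module r (l : virtual_link r) (M : lmodType Laurent) : Prop :=
  exists2 D : vdiagram r, sval l D & lmod_iso M (link_module D).

(* Main.v *)
(* Write L for Z[t,1/t].

   Fox calculus turns the Wirtinger presentation of a diagram into a presentation of its
   module with one relation for each edge and one generator fewer; at t = 1 the relations
   identify every edge with the next one, whence the cokernel Z^(r-1). Since kernels of
   matrices over L are free, such a module has a resolution
   0 -> L^(1+beta) -> L^(q+1) -> L^q -> M -> 0, and E^2 M is a quotient of the dual of
   L^(1+beta).

   Conversely, from 0 -> L^s -> L^p -> L^q -> M -> 0 and e generators of E^2 M one gets a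
   split injection L^s -> L^p + L^e with free cokernel, and this cokernel maps onto the
   module of relations, so that M has q - beta + e <= q + 1 relations. Base changes over Z
   bring the relation matrix at t = 1 into the form y_(v+r) - y_v = 0 with indices mod
   q + 1, a multiple of r, and y_0 = 0; hence M is presented by relations
   y_(v+r) = y_v + (1-t) c_v. Passing a strand of value x under a strand of value y turns x
   into t x + (1-t) y, or 1/t x + (1-1/t) y at a crossing of the other sign, and sequences of
   such steps realise any x + (1-t) c. All these strands are found in a torus link diagram
   that is wide enough, once its other crossings are made virtual. *)
From HB Require Import structures.
Require Import Defs.
From mathcomp Require Import multinomials.freeg.
From mathcomp Require Import all_boot all_order all_algebra.
From mathcomp Require Import perm zify ring boolp classical_sets functions.

Set Implicit Arguments.
Unset Strict Implicit.
Unset Printing Implicit Defensive.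

Import Order.TTheory GRing.Theory Num.Theory.
Local Open Scope ring_scope.
Local Open Scope quotient_scope.

(** * Kernels of matrices over Z[t] *)

(** E^2 M is the cokernel of the transpose of the matrix V of L^s -> L^p, so e generators of it are
    columns Y for which the block row (V Y) has a right inverse. The cokernel of the resulting split
    injection is a priori only stably free; it is free because its dual is again the kernel of a
    matrix over L. Freeness of such kernels combines global dimension 2 with the freeness of
    projectives; over Z[t] it is obtained directly, by a descent on a determinant, and then carried
    over to L.

    In the realisation the obstacle is planarity: a relation calls for a strand to pass under
    prescribed other strands in a prescribed order. Virtual crossings do not change values, so one
    fixed planar shadow in which any two passes cross is enough, and only the decoration of its
    crossings depends on M. A strand that has to serve as over-strand with a definite value must not
    change on the way; this is why passes are split into those that go over and those that go under
    once.

    Killing y_0 is the choice of a base edge e0: the generator of an edge e is the class of e e0^-1,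
    which is trivial for e0 itself. *)

Lemma scalemx_cancel (R : idomainType) m n (c : R) : c != 0 -> injective ( *:%R c : 'M[R]_(m, n) -> _).
Proof.
move=> c0 A B /eqP; rewrite -subr_eq0 -scalerBr scalemx_eq0 (negbTE c0) subr_eq0.
by move/eqP.
Qed.

Lemma map_mx_injective (R S : Type) (f : R -> S) m n :
  injective f -> injective (@map_mx R S f m n).
Proof.
by move=> f_inj B C /matrixP e; apply/matrixP => i j; have := e i j; rewrite !mxE => /f_inj.
Qed.

Lemma rmorph_unitmx (R S : comUnitRingType) (f : {rmorphism R -> S}) n (U : 'M[R]_n) :
  U \in unitmx -> map_mx f U \in unitmx.
Proof.
move=> Uu; have /mulmx1_unit[] // : map_mx f U *m map_mx f (invmx U) = 1%:M.
by rewrite -map_mxM mulmxV // map_scalar_mx rmorph1.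
Qed.

Section Euclid.
Variables (F : fieldType) (S : comUnitRingType) (phi : {rmorphism S -> {poly F}}).
Hypothesis phi_surj : forall y, exists x, phi x = y.

Lemma transvection_unit n (i j : 'I_n) (c : S) : i != j ->
  1%:M + c *: delta_mx i j \in unitmx.
Proof.
move=> ij; suff /mulmx1_unit[] : (1%:M + c *: delta_mx i j) *m (1%:M - c *: delta_mx i j) = 1%:M by [].
rewrite mulmxDl mul1mx mulmxBr mulmx1 -!scalemxAl -!scalemxAr mul_delta_mx_0 1?eq_sym //.
by rewrite !scaler0 subr0 subrK.
Qed.

(** Euclid's algorithm on the entries, by column operations. Only transvections and transpositions
    occur: these lift along [phi] to invertible matrices over [S], which an arbitrary invertible
    matrix over F[x] need not do. *)
Lemma euclid_row n (v : 'rV[{poly F}]_n.+1) :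
  exists2 U : 'M[S]_n.+1, U \in unitmx & forall j, j != ord0 -> (v *m map_mx phi U) 0 j = 0.
Proof.
have [N le_N] := ubnP (\sum_j size (v 0%R j)).
elim: N => // N IH in v le_N *.
pose P (ij : 'I_n.+1 * 'I_n.+1) := [&& ij.1 != ij.2, v 0 ij.1 != 0, v 0 ij.2 != 0
    & (size (v 0%R ij.1) <= size (v 0%R ij.2))%N].
have [[i j] Pij|no] := pickP P.
  have /and4P[/= ij vi vj le_ij] := Pij.
  have [c phic] := phi_surj (- (v 0 j %/ v 0 i)).
  pose E : 'M[S]_n.+1 := 1%:M + c *: delta_mx i j.
  have vE k : (v *m map_mx phi E) 0 k = v 0 k + (- (v 0 j %/ v 0 i) * v 0 i) *+ (k == j).
    rewrite map_mxD map_mxZ map_scalar_mx rmorph1 map_delta_mx mulmxDr mulmx1 mxE; congr (_ + _).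
    rewrite -scalemxAr mxE phic -mulrnAr; congr (_ * _).
    rewrite mxE (bigD1 i) //= big1 ?addr0 => [|l li]; last by rewrite mxE (negbTE li) mulr0.
    by rewrite mxE eqxx mulr_natr.
  have [|U Uu vU] := IH (v *m map_mx phi E).
    move: le_N; rewrite ltnS; apply: leq_trans.
    rewrite (bigD1 j) //= [X in (_ < X)%N](bigD1 j) //= -addSn leq_add //.
      rewrite vE eqxx mulNr mulr1n.
      suff -> : v 0 j - v 0 j %/ v 0 i * v 0 i = v 0 j %% v 0 i.
        by apply: leq_trans le_ij; rewrite ltn_modp.
      by rewrite {1}(divp_eq (v 0 j) (v 0 i)) addrAC subrr add0r.
    by apply/leq_sum => k kj; rewrite vE (negbTE kj) addr0.
  exists (E *m U); first by rewrite unitmx_mul Uu transvection_unit.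
  by move=> k /vU; rewrite map_mxM mulmxA.
(* At most one nonzero entry is left; a transposition brings it to the front. *)
have [i vi|v0] := pickP (fun i => v 0 i != 0); last first.
  exists 1%:M; first exact: unitmx1.
  by move=> j _; rewrite map_scalar_mx rmorph1 mulmx1; apply/eqP; rewrite -[_ == _]negbK v0.
exists (tperm_mx i 0) => [|j j0]; first exact: unitmx_perm.
rewrite map_tperm_mx -xcolE mxE.
apply/eqP/negP => /negP vt.
set k := tperm i 0 j in vt.
have ik : i != k by rewrite -{1}[i](tpermR i 0) (inj_eq perm_inj) eq_sym.
have := no (i, k); have := no (k, i); rewrite /P /= eq_sym ik vi vt /=.
by case: leqP => // /ltnW ->.
Qed.

(** Once U turns v into a multiple of the first unit vector, the relation v A = 0 says that this
    multiple of the first row of U^-1 A vanishes, and F[x] has no zero divisors. *)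
Lemma euclid_dependent n q (A : 'M[{poly F}]_(1 + n, q)) (v : 'rV_(1 + n)) :
  v != 0 -> v *m A = 0 ->
  exists2 U : 'M[S]_(1 + n), U \in unitmx & usubmx (map_mx phi U *m A) = 0.
Proof.
move=> v0 vA; have [U Uu vU] := euclid_row v.
exists (invmx U); first by rewrite unitmx_inv.
have pUU : map_mx phi U *m map_mx phi (invmx U) = 1%:M.
  by rewrite -map_mxM mulmxV // map_scalar_mx rmorph1.
have [w wdef] : {w | w = v *m map_mx phi U} by eexists.
rewrite -wdef in vU.
have wE : w = w 0 0 *: delta_mx 0 0.
  apply/rowP => j; rewrite !mxE eqxx /=; case: (eqVneq j 0) => [->|/vU ->].
    by rewrite mulr1.
  by rewrite mulr0.
have w0 : w 0 0 != 0.
  apply: contra_neq v0 => w0; rewrite -[v]mulmx1 -pUU mulmxA -wdef wE w0 scale0r.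
  exact: mul0mx.
have : w *m (map_mx phi (invmx U) *m A) = 0 by rewrite wdef mulmxA -(mulmxA v) pUU mulmx1.
rewrite wE -scalemxAl -rowE; move: (_ *m A) => B /rowP e.
apply/matrixP => i j; have /eqP := e j; rewrite mxE [X in _ * X]mxE [X in _ == X]mxE.
rewrite mulf_eq0 (negbTE w0) /= => /eqP Bj; rewrite [LHS]mxE [RHS]mxE -Bj.
by congr (B _ _); apply/val_inj; rewrite /= ord1.
Qed.
End Euclid.

Lemma rat_poly_mx_den m n (A : 'M[{poly rat}]_(m, n)) :
  exists d : int, exists2 B : 'M[{poly int}]_(m, n), d != 0 &
    d%:~R *: A = map_mx (map_poly intr) B.
Proof.
pose den i j := let: existT q (exist2 a _ _) := rat_poly_scale (A i j) in a.
exists (\prod_i \prod_j den i j).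
have den0 i j : den i j != 0 by rewrite /den; case: rat_poly_scale => q [].
have denE i j : exists q, (den i j)%:~R *: A i j = map_poly intr q.
  rewrite /den; case: rat_poly_scale => q [a a0 ->]; exists q.
  by rewrite scalerA mulfV ?intr_eq0 // scale1r.
have ex i j : exists q, (\prod_i \prod_j den i j)%:~R * A i j == map_poly intr q.
  have [q qE] := denE i j.
  have [c ->] : exists c, \prod_i \prod_j den i j = c * den i j.
    rewrite (bigD1 i) //= (bigD1 j) //= -mulrA mulrC; eexists; reflexivity.
  exists (c%:~R * q); apply/eqP; have -> : map_poly intr (c%:~R * q) = c%:~R * map_poly intr q :> {poly rat}.
    by rewrite rmorphM rmorph_int.
  by rewrite -qE -mul_polyC polyCMz intrM mulrA.
exists (\matrix_(i, j) xchoose (ex i j)).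
  by apply/prodf_neq0 => i _; apply/prodf_neq0 => j _.
apply/matrixP => i j; rewrite !mxE /=.
exact/eqP/(xchooseP (ex i j)).
Qed.

(** Each dependency of the rows can be moved into the first row, which then vanishes and contributes
    a basis vector of the kernel. W reads off coordinates in the basis V; multiplying by it makes a
    square matrix out of V, whose determinant drives the later descent. *)
Lemma polyF_ker_split (F : fieldType) p q (A : 'M[{poly F}]_(p, q)) :
  exists n (V : 'M_(n, p)) (W : 'M_(p, n)), [/\ V *m A = 0, V *m W = 1%:M &
    forall k : 'rV_p, k *m A = 0 -> k = k *m W *m V].
Proof.
elim: p A => [|p IH] A.
  exists 0, 0, 0; split; rewrite ?thinmx0 ?flatmx0 //; last by move=> k _; rewrite !thinmx0.
have [[v v0 vA]|noker] := pselect (exists2 v : 'rV_(1 + p), v != 0 & v *m A = 0); last first.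
  exists 0, 0, 0; split; rewrite ?thinmx0 ?flatmx0 // => k kA.
  by rewrite !(mulmx0, mul0mx); apply/eqP/negP => /negP k0; apply: noker; exists k.
have [U Uu UA] := @euclid_dependent F {poly F} idfun (fun y => ex_intro _ y erefl) p q A v v0 vA.
rewrite map_mx_id // in UA.
have [n [V [W [VA VW kV]]]] := IH (dsubmx (U *m A)).
have UAE : U *m A = col_mx 0 (dsubmx (U *m A)) by rewrite -{1}UA vsubmxK.
exists (1 + n)%N, (block_mx 1%:M 0 0 V *m U), (invmx U *m block_mx 1%:M 0 0 W); split.
- by rewrite -mulmxA UAE mul_block_col !mul0mx mulmx0 VA !addr0 col_mx0.
- rewrite mulmxA mulmxK // mulmx_block !mulmx0 !mul0mx !addr0 !add0r mulmx1 VW.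
  by rewrite scalar_mx_block.
- move=> k kA; pose l := k *m invmx U.
  have kl : k = l *m U by rewrite mulmxKV.
  have : l *m (U *m A) = 0 by rewrite mulmxA -kl.
  rewrite UAE -[l]hsubmxK mul_row_col mulmx0 add0r => /kV e.
  rewrite -!mulmxA (mulmxA k) -/l mulmxA mulmxA -(mulmxA l) mulmx_block.
  rewrite !mulmx0 !mul0mx !addr0 !add0r mulmx1 {1}kl; congr (_ *m _).
  rewrite -{1 2}[l]hsubmxK mul_row_block !mulmx0 addr0 add0r mulmx1; congr row_mx.
  by rewrite mulmxA.
Qed.

Section IntPolyKernel.
Local Notation Z := {poly int}.
Implicit Types m : int.

Lemma int_poly_mx_divP (p : nat) r c (A : 'M[Z]_(r, c)) : prime p ->
  map_mx (map_poly (intr : int -> 'F_p)) A = 0 -> exists B, A = p%:R *: B.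
Proof.
move=> p_pr /matrixP A0.
have ex i j : exists q, A i j == p%:R * q.
  have /polyP Aij := A0 i j; exists (\poly_(k < size (A i j)) ((A i j)`_k %/ p)%Z).
  apply/eqP/polyP => k; rewrite -polyC_natr mul_polyC coefZ coef_poly.
  have := Aij k; rewrite !mxE coef_map coef0 /= => /eqP.
  rewrite -(dvdz_pcharf (pchar_Fp p_pr)) => dv.
  case: ltnP => [_|/(nth_default 0) ->]; last by rewrite mulr0.
  by rewrite mulrC natz divzK.
exists (\matrix_(i, j) xchoose (ex i j)); apply/matrixP => i j; rewrite !mxE.
exact/eqP/(xchooseP (ex i j)).
Qed.

Lemma int_to_Fp_poly_surj p (y : {poly 'F_p}) : exists x : Z, map_poly intr x = y.
Proof.
exists (\poly_(i < size y) (val y`_i)%:Z); apply/polyP => i.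
rewrite coef_map coef_poly /=; case: ltnP => [_|/(nth_default 0) ->]; last by rewrite rmorph0.
by rewrite -pmulrn natr_Zp.
Qed.

(** If a prime r divides m, then a V vanishes modulo r, so independence modulo r makes [a] divisible
    by r; cancel r and go on with m / r. *)
Lemma int_poly_saturated n p (V : 'M[Z]_(n, p)) (m : int) (k : 'rV[Z]_p) (a : 'rV_n) :
  m != 0 ->
  (forall r : nat, prime r -> (r %| m)%Z -> forall v : 'rV[{poly 'F_r}]_n,
     v *m map_mx (map_poly intr) V = 0 -> v = 0) ->
  m%:~R *: k = a *m V -> exists a', k = a' *m V.
Proof.
have [N] := ubnP `|m|%N; elim: N => // N IH in m a * => le_mN m0 indep e.
have [m1|m1] := eqVneq `|m|%N 1%N.
  exists (m%:~R *: a); rewrite -scalemxAl -e scalerA -intrM.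
  suff -> : m * m = 1 by rewrite scale1r.
  by have [->|->] : m = 1 \/ m = -1 by lia.
have gt1 : (1 < `|m|)%N by rewrite ltn_neqAle eq_sym m1 absz_gt0.
pose r := pdiv `|m|; have r_pr : prime r by apply: pdiv_prime.
have rm : (r %| m)%Z by apply: pdiv_dvd.
have aV : map_mx (map_poly intr) a *m map_mx (map_poly intr) V = 0 :> 'rV[{poly 'F_r}]_p.
  rewrite -map_mxM -e map_mxZ rmorph_int.
  have -> : m%:~R = 0 :> {poly 'F_r}.
    have mr : m%:~R = 0 :> 'F_r by apply/eqP; rewrite -(dvdz_pcharf (pchar_Fp r_pr)).
    by rewrite -(rmorph_int (@polyC 'F_r)) mr rmorph0.
  exact: scale0r.
have /int_poly_mx_divP[//|a' aE] := indep r r_pr rm _ aV.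
have [m' mE] := dvdzP rm.
have r0 : r%:R != 0 :> Z by rewrite -polyC_natr polyC_eq0 pnatr_eq0 -lt0n prime_gt0.
have m'0 : m' != 0 by apply: contra_neq m0 => m'0; rewrite mE m'0 mul0r.
apply: (IH m' a') => //.
- move: le_mN; rewrite ltnS; apply: leq_trans; rewrite mE abszM /=.
  by rewrite ltn_Pmulr ?absz_gt0 ?prime_gt1.
- by move=> u u_pr um; apply: indep => //; rewrite mE dvdz_mulr.
- apply: (scalemx_cancel r0); rewrite scalemxAl -aE -e mE scalerA; congr (_ *: _).
  by rewrite intrM mulrC.
Qed.

(* Start from a basis of the kernel over Q[t], scaled to be integral: the kernel is then
   contained in 1/m times its span. As long as its rows are dependent modulo some prime
   r dividing m, a unimodular change of the rows makes one of them divisible by r, and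
   dividing it lowers the leading coefficient of det (V W1). *)
Lemma int_poly_ker_free p q (A : 'M[Z]_(p, q)) :
  exists n (V : 'M_(n, p)), [/\ V *m A = 0,
    forall k : 'rV_p, k *m A = 0 -> exists a, k = a *m V &
    forall a : 'rV_n, a *m V = 0 -> a = 0].
Proof.
pose toQ : {rmorphism Z -> {poly rat}} := map_poly intr.
have toQ_inj : injective toQ by apply: map_inj_poly => //; exact: intr_inj.
have toQmx_inj r c : injective (@map_mx _ _ toQ r c) by exact: map_mx_injective.
have [n [V0 [W0 [VA0 VW0 kV0]]]] := polyF_ker_split (map_mx toQ A).
have [d1 [V1 d10 V1E]] := rat_poly_mx_den V0.
have [d2 [W1 d20 W1E]] := rat_poly_mx_den W0.
pose m := d1 * d2; have m0 : m != 0 by rewrite mulf_neq0.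
have VW1 : V1 *m W1 = (m%:~R)%:M.
  apply/(toQmx_inj); rewrite map_mxM map_scalar_mx rmorph_int -V1E -W1E.
  by rewrite -scalemxAl -scalemxAr VW0 scalerA -intrM scalemx1.
have det1 : \det (V1 *m W1) != 0 
  by rewrite VW1 det_scalar expf_neq0 // -(rmorph_int (@polyC int)) polyC_eq0 intz.
have kV1 (k : 'rV_p) : k *m A = 0 -> exists a, m%:~R *: k = a *m V1.
  move=> kA; exists (k *m W1); apply/toQmx_inj.
  rewrite map_mxZ !map_mxM rmorph_int -V1E -W1E -!scalemxAr -scalemxAl scalerA -intrM mulrC.
  rewrite [d2 * d1]mulrC; congr (_ *: _); apply: kV0.
  by rewrite -map_mxM kA map_mx0.
have VA1 : V1 *m A = 0.
  by apply/toQmx_inj; rewrite map_mxM -V1E -scalemxAl VA0 scaler0 map_mx0.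
(* From here on V varies while W1 and m stay fixed. The invariants are: det (V W1) is nonzero, m
   times every kernel vector lies in the span of V, and V A = 0. *)
move: V1 VW1 V1E det1 kV1 VA1 => V _ _ detV kV VA.
have [N] := ubnP `|lead_coef (\det (V *m W1))|%N.
elim: N => // N IH in V detV kV VA *; rewrite ltnS => le_N.
have [[r [r_pr rm [v v0 vV]]]|indep] := pselect (exists r, [/\ prime r, (r %| m)%Z &
    exists2 v : 'rV[{poly 'F_r}]_n, v != 0 & v *m map_mx (map_poly intr) V = 0]); last first.
  exists n, V; split=> // [k /kV[a e]|a aV].
    apply: (int_poly_saturated m0 _ e) => r r_pr rm v vV.
    by apply/eqP/negP => /negP v0; apply: indep; exists r; split=> //; exists v.
  have : a *m (V *m W1) *m \adj (V *m W1) = 0 by rewrite mulmxA aV !mul0mx.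
  by rewrite -mulmxA mul_mx_adj mul_mx_scalar => /eqP; rewrite scalemx_eq0 (negbTE detV) => /eqP.
case: n => [|n] in V0 W0 VA0 VW0 kV0 W1 W1E V v vV v0 detV kV VA le_N IH *.
  by rewrite thinmx0 eqxx in v0.
have [U Uu UV] := euclid_dependent (@int_to_Fp_poly_surj r) v0 vV.
have [|B BE] := @int_poly_mx_divP r _ _ (usubmx (U *m V : 'M_(1 + n, _))) r_pr.
  by rewrite map_usubmx map_mxM.
pose V' : 'M_(1 + n, p) := col_mx B (dsubmx (U *m V : 'M_(1 + n, _))).
pose D : 'M[Z]_(1 + n) := block_mx (r%:R)%:M 0 0 1%:M.
have r0 : r%:R != 0 :> Z by rewrite -polyC_natr polyC_eq0 pnatr_eq0 -lt0n prime_gt0.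
have UVE : U *m V = D *m V'.
  rewrite /D /V' mul_block_col !mul0mx mul1mx addr0 add0r mul_scalar_mx -BE.
  by rewrite vsubmxK.
have detE : \det U * \det (V *m W1) = r%:R * \det (V' *m W1).
  rewrite -det_mulmx mulmxA UVE -mulmxA det_mulmx det_ublock det1 mulr1.
  by rewrite det_scalar1.
have detU : \det U \is a GRing.unit by rewrite -unitmxE.
have detV' : \det (V' *m W1) != 0.
  apply/negP => /eqP d0; move/eqP: detE; rewrite d0 mulr0 mulf_eq0 (negbTE detV) orbF.
  by apply/negP; apply: contraTneq detU => ->; rewrite unitr0.
have VV' : V = invmx U *m D *m V' by rewrite -mulmxA -UVE mulKmx.
apply: (IH V') => //.
- by move=> k /kV[a ->]; exists (a *m (invmx U *m D)); rewrite -mulmxA -VV'.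
- have : D *m (V' *m A) = 0 by rewrite mulmxA -UVE -mulmxA VA mulmx0.
  rewrite -[V' *m A]vsubmxK /D mul_block_col !mul0mx mul1mx addr0 add0r mul_scalar_mx.
  rewrite -[0 in X in X -> _]vsubmxK => /eq_col_mx[/eqP]; rewrite linear0 scalemx_eq0 (negbTE r0) /=.
  by move=> /eqP -> ->; rewrite linear0 col_mx0.
- apply: leq_trans le_N; have := congr1 (fun x => `|lead_coef x|%N) detE.
  rewrite !lead_coefM !abszM.
  have -> : `|lead_coef (\det U)|%N = 1%N.
    move: detU; rewrite poly_unitE => /andP[/eqP sz]; rewrite lead_coefE sz /=.
    by rewrite unfold_in => /orP[]/eqP ->.
  rewrite mul1n => ->; rewrite -polyC_natr lead_coefC natz /=.
  by rewrite ltn_Pmull ?prime_gt1 // absz_gt0 lead_coef_eq0.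
Qed.
End IntPolyKernel.

(** * Laurent polynomials *)

Fact laurent_poly_subproof (p : {poly int}) : tofrac p \in laurent_pred.
Proof. by apply/asboolP; exists p, 0%N; rewrite expr0 divr1. Qed.
Definition laurent_poly p : Laurent := MkLaurent (laurent_poly_subproof p).

Fact laurent_poly_is_zmod_morphism : zmod_morphism laurent_poly.
Proof. by move=> p q; apply: val_inj; rewrite /= rmorphB. Qed.
Fact laurent_poly_is_monoid_morphism : monoid_morphism laurent_poly.
Proof. by split=> [|p q]; apply: val_inj; rewrite /= ?rmorph1 ?rmorphM. Qed.
HB.instance Definition _ :=
  GRing.isZmodMorphism.Build {poly int} Laurent laurent_poly laurent_poly_is_zmod_morphism.
HB.instance Definition _ :=
  GRing.isMonoidMorphism.Build {poly int} Laurent laurent_poly laurent_poly_is_monoid_morphism.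

Lemma laurent_poly_inj : injective laurent_poly.
Proof. by move=> p q /(congr1 val)/eqP; rewrite /= tofrac_eq => /eqP. Qed.

Lemma laurent_polyX : laurent_poly 'X = laurent_t.
Proof. exact: val_inj. Qed.

Lemma laurent_t_neq0 : laurent_t != 0.
Proof. by apply: contraTneq laurent_t_unit => ->; rewrite unitr0. Qed.

Lemma laurent_tX_neq0 n : laurent_t ^+ n != 0.
Proof. by rewrite expf_neq0 // laurent_t_neq0. Qed.

Lemma laurent_numden a : laurent_t ^+ laurent_den a * a = laurent_poly (laurent_num a).
Proof.
apply: val_inj; rewrite rmorphM rmorphXn /= laurent_numdenE mulrC divfK //.
by rewrite expf_neq0 // fracX_neq0.
Qed.

Definition laurent_ev1 (a : Laurent) : int := (laurent_num a).[1].

(** [laurent_num] is obtained by choice; as 1^n = 1, every way of writing a as p / t^n gives the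
    same value at 1. *)
Lemma laurent_ev1E a n p : laurent_t ^+ n * a = laurent_poly p -> laurent_ev1 a = p.[1].
Proof.
move=> e; rewrite /laurent_ev1.
have /laurent_poly_inj/(congr1 (fun q => q.[1])) :
    laurent_poly ('X^n * laurent_num a) = laurent_poly ('X^(laurent_den a) * p).
  by rewrite !rmorphM /= -laurent_numden -e !rmorphXn /= laurent_polyX mulrCA.
by rewrite !hornerM !hornerXn !expr1n !mul1r.
Qed.

Lemma laurent_ev1_poly p : laurent_ev1 (laurent_poly p) = p.[1].
Proof. by apply: (@laurent_ev1E _ 0); rewrite expr0 mul1r. Qed.

Lemma laurent_ev1_t : laurent_ev1 laurent_t = 1.
Proof. by rewrite -laurent_polyX laurent_ev1_poly hornerX. Qed.

Fact laurent_ev1_is_zmod_morphism : zmod_morphism laurent_ev1.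
Proof.
move=> a b; rewrite (@laurent_ev1E _ (laurent_den a + laurent_den b)
  ('X^(laurent_den b) * laurent_num a - 'X^(laurent_den a) * laurent_num b)).
  by rewrite hornerD hornerN !hornerM !hornerXn !expr1n !mul1r.
rewrite rmorphB !rmorphM !rmorphXn /= laurent_polyX -!laurent_numden mulrBr exprD.
by congr (_ - _); rewrite -!mulrA // mulrCA.
Qed.
Fact laurent_ev1_is_monoid_morphism : monoid_morphism laurent_ev1.
Proof.
split=> [|a b]; first by rewrite -(rmorph1 laurent_poly) laurent_ev1_poly hornerC.
rewrite (@laurent_ev1E _ (laurent_den a + laurent_den b) (laurent_num a * laurent_num b)).
  by rewrite hornerM.
by rewrite rmorphM /= -!laurent_numden exprD mulrACA.
Qed.
HB.instance Definition _ :=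
  GRing.isZmodMorphism.Build Laurent int laurent_ev1 laurent_ev1_is_zmod_morphism.
HB.instance Definition _ :=
  GRing.isMonoidMorphism.Build Laurent int laurent_ev1 laurent_ev1_is_monoid_morphism.

Lemma laurent_ev1_int (z : int) : laurent_ev1 z%:~R = z.
Proof. by rewrite rmorph_int intz. Qed.

Lemma laurent_ev1_eq0 a : laurent_ev1 a = 0 -> exists b, a = (laurent_t - 1) * b.
Proof.
move=> /eqP/factor_theorem[q qE].
exists (laurent_t ^- laurent_den a * laurent_poly q).
apply: (mulfI (laurent_tX_neq0 (laurent_den a))).
rewrite mulrCA mulVKr ?unitrX ?laurent_t_unit // laurent_numden qE rmorphM rmorphB /=.
by rewrite laurent_polyX rmorph1 mulrC.
Qed.

(** Reduces linearity over L to compatibility with t, and the realisation of a coefficient by a word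
    to 1, differences and multiplication by t and 1/t. *)
Lemma laurent_ind (P : Laurent -> Prop) : P 1 ->
  (forall a b, P a -> P b -> P (a - b)) -> (forall a, P a -> P (laurent_t * a)) ->
  (forall a, P a -> P (laurent_t^-1 * a)) -> forall a, P a.
Proof.
move=> P1 PB Pt PV a.
have P0 : P 0 by rewrite -(subrr 1); apply: PB.
have PN b : P b -> P (- b) by rewrite -sub0r; apply: PB.
have PD b c : P b -> P c -> P (b + c) by move=> Pb /PN; rewrite -{2}[c]opprK; apply: PB.
have Pz (z : int) : P z%:~R.
  have Pn (n : nat) : P n%:R by elim: n => // n IH; rewrite -natr1; apply: PD.
  by case: z => n; rewrite ?NegzE ?rmorphN; [|apply: PN]; exact: Pn.
have Pp p : P (laurent_poly p).
  elim/poly_ind: p => [|p c IH]; first by rewrite rmorph0.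
  rewrite rmorphD rmorphM /= laurent_polyX mulrC; apply: PD; first exact: Pt.
  by rewrite -[c]intz (rmorph_int (@polyC int)) rmorph_int.
have -> : a = laurent_t^-1 ^+ laurent_den a * laurent_poly (laurent_num a).
  by rewrite -laurent_numden exprVn mulKr // unitrX // laurent_t_unit.
by elim: (laurent_den a) => [|n IH]; rewrite ?expr0 ?mul1r // exprS -mulrA; apply: PV.
Qed.

Lemma laurent_mx_num m n (A : 'M[Laurent]_(m, n)) :
  exists N, exists B : 'M[{poly int}]_(m, n), laurent_t ^+ N *: A = map_mx laurent_poly B.
Proof.
pose N := (\sum_i \sum_j laurent_den (A i j))%N.
have le_N i j : (laurent_den (A i j) <= N)%N.
  by rewrite /N (bigD1 i) //= (bigD1 j) //= -addnA leq_addr.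
exists N, (\matrix_(i, j) ('X^(N - laurent_den (A i j)) * laurent_num (A i j))).
apply/matrixP => i j; rewrite !mxE rmorphM rmorphXn /= laurent_polyX -laurent_numden mulrA.
by rewrite -exprD subnK.
Qed.

Lemma map_laurent_poly_inj m n : injective (@map_mx _ _ laurent_poly m n).
Proof. exact: map_mx_injective laurent_poly_inj. Qed.

(** Powers of t are units of L, so clearing them from A and from a kernel vector changes neither the
    kernel nor the span of V. *)
Lemma laurent_ker_free p q (A : 'M[Laurent]_(p, q)) :
  exists n (V : 'M_(n, p)), [/\ V *m A = 0,
    forall k : 'rV_p, k *m A = 0 -> exists a, k = a *m V &
    forall a : 'rV_n, a *m V = 0 -> a = 0].
Proof.
have tN N : laurent_t ^+ N != 0 := laurent_tX_neq0 N.
have [N [B AB]] := laurent_mx_num A.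
have [n [V [VB kV indep]]] := int_poly_ker_free B.
exists n, (map_mx laurent_poly V); split.
- by apply: (scalemx_cancel (tN N)); rewrite scalemxAr AB -map_mxM VB map_mx0 scaler0.
- move=> k kA; have [M [k' kk']] := laurent_mx_num k.
  have [|a ka] := kV k'.
    by apply: map_laurent_poly_inj; rewrite map_mxM -kk' -AB -scalemxAl -scalemxAr kA !scaler0 map_mx0.
  exists (laurent_t ^- M *: map_mx laurent_poly a).
  by rewrite -scalemxAl -map_mxM -ka -kk' scalerA mulVr ?scale1r // unitrX ?laurent_t_unit.
- move=> a aV; have [M [a' aa']] := laurent_mx_num a.
  have /indep a'0 : a' *m V = 0.
    by apply: map_laurent_poly_inj; rewrite map_mxM -aa' -scalemxAl aV scaler0 map_mx0.
  by apply: (scalemx_cancel (tN M)); rewrite aa' a'0 map_mx0 scaler0.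
Qed.

(** * Noetherian modules *)

Section Span.
Variables (R : nzRingType) (V : lmodType R).

Fixpoint lspan (s : seq V) (x : V) : Prop :=
  if s is g :: s' then exists a, lspan s' (x - a *: g) else x = 0.

Definition submodule (P : V -> Prop) : Prop :=
  P 0 /\ forall a x y, P x -> P y -> P (a *: x + y).

Lemma submoduleB P x y : submodule P -> P x -> P y -> P (x - y).
Proof. by move=> [_ PD] Px Py; rewrite addrC -scaleN1r; apply: PD. Qed.

Lemma lspan_submodule s : submodule (lspan s).
Proof.
elim: s => [|g s [IH0 IH]] /=; first by split=> // a x y -> ->; rewrite scaler0 addr0.
split=> [|a x y [b Hb] [c Hc]]; first by exists 0; rewrite scale0r subr0.
exists (a * b + c); rewrite scalerDl -scalerA opprD addrACA -scalerBr.
exact: IH.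
Qed.

Lemma lspan_cons g s x : lspan s x -> lspan (g :: s) x.
Proof. by move=> sx; exists 0; rewrite scale0r subr0. Qed.

Lemma lspan_mem s g : g \in s -> lspan s g.
Proof.
elim: s => // h s IH; rewrite inE => /predU1P[->|/IH]; last exact: lspan_cons.
by exists 1; rewrite scale1r subrr; have [] := lspan_submodule s.
Qed.

Lemma lspan_least (P : V -> Prop) s x :
  submodule P -> (forall g, g \in s -> P g) -> lspan s x -> P x.
Proof.
move=> [P0 PD]; elim: s x => [|g s IH] x Ps /=; first by move->.
move=> [a /IH Px]; rewrite -[x](subrK (a *: g)) addrC; apply: PD.
  by apply: Ps; rewrite inE eqxx.
by apply: Px => h hs; apply: Ps; rewrite inE hs orbT.
Qed.

Lemma lspan_subset s s' x : {subset s <= s'} -> lspan s x -> lspan s' x.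
Proof. by move=> ss'; apply: lspan_least (lspan_submodule _) _ => g /ss' /lspan_mem. Qed.

Lemma lspanD s x y : lspan s x -> lspan s y -> lspan s (x + y).
Proof. by rewrite -[X in X + y]scale1r; apply: (lspan_submodule s).2. Qed.

Lemma lspanZ s a x : lspan s x -> lspan s (a *: x).
Proof.
have [s0 sD] := lspan_submodule s.
by move=> sx; rewrite -[a *: x]addr0; apply: sD.
Qed.

Definition noetherian : Prop := forall P : V -> Prop, submodule P ->
  exists2 s, (forall g, g \in s -> P g) & forall x, P x -> lspan s x.
End Span.

Section Extension.
Variables (R : nzRingType) (U V W : lmodType R) (g : {linear U -> V}) (f : {linear V -> W}).

Lemma lspan_map s u : lspan s u -> lspan [seq g x | x <- s] (g u).
Proof.
apply: (@lspan_least _ _ (fun u => lspan _ (g u))) => [|x xs].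
  have [S0 SD] := lspan_submodule [seq g x | x <- s].
  by split=> [|a x y]; rewrite ?linear0 // linearP; apply: SD.
by apply: lspan_mem; apply: map_f.
Qed.

Lemma lspan_map_lift s w : lspan [seq f x | x <- s] w -> exists2 v, lspan s v & f v = w.
Proof.
apply: (@lspan_least _ _ (fun w => exists2 v, lspan s v & f v = w)) => [|_ /mapP[x xs ->]].
  have [S0 SD] := lspan_submodule s.
  split=> [|a _ _ [x sx <-] [y sy <-]]; first by exists 0; rewrite ?linear0.
  by exists (a *: x + y); rewrite ?linearP //; apply: SD.
by exists x => //; apply: lspan_mem.
Qed.

Lemma noetherian_extension : (forall v, f v = 0 -> exists u, g u = v) ->
  noetherian U -> noetherian W -> noetherian V.
Proof.
move=> ker_f nU nW P subP; have [P0 PD] := subP.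
have [|sW sWP Wspan] := nW (fun w => exists2 v, P v & f v = w).
  split=> [|a _ _ [x Px <-] [y Py <-]]; first by exists 0; rewrite ?linear0.
  by exists (a *: x + y); rewrite ?linearP //; apply: PD.
have [|sU sUP Uspan] := nU (fun u => P (g u)).
  by split=> [|a x y]; rewrite ?linear0 // linearP; apply: PD.
have [t tP tW] : exists2 t, (forall v, v \in t -> P v) & [seq f x | x <- t] = sW.
  elim: sW sWP {Wspan} => [|w s IH] sP; first by exists [::].
  have [|t tP ts] := IH; first by move=> h hs; apply: sP; rewrite inE hs orbT.
  have [|v Pv fv] := sP w; first by rewrite inE eqxx.
  exists (v :: t); last by rewrite /= fv ts.
  by move=> h; rewrite inE => /predU1P[->|/tP].
exists (t ++ [seq g x | x <- sU]) => [h|x Px].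
  by rewrite mem_cat => /orP[/tP|/mapP[u /sUP Pu ->]].
have /Wspan : exists2 v, P v & f v = f x by exists x.
rewrite -tW => /lspan_map_lift[y ty fy].
have Py : P y by apply: lspan_least ty.
have [|u gu] := ker_f (x - y); first by rewrite linearB fy subrr.
have /Uspan/lspan_map : P (g u) by rewrite gu; apply: submoduleB.
rewrite gu => /(@lspan_subset _ _ _ (t ++ [seq g x | x <- sU])) xy.
have {}ty : lspan (t ++ [seq g x | x <- sU]) y.
  by apply: lspan_subset ty => h; rewrite mem_cat => ->.
rewrite -[x](subrK y); apply: lspanD => //.
by apply: xy => h; rewrite mem_cat orbC => ->.
Qed.
End Extension.

Lemma noetherian_row (R : comNzRingType) q : noetherian R^o -> noetherian 'rV[R]_q.
Proof.
move=> nR; elim: q => [|q IH].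
  by move=> P _; exists [::] => // x _; rewrite /= thinmx0.
pose h (x : 'rV[R]_(1 + q)) : R^o := x 0 0.
have h_lin : linear h by move=> a x y; rewrite /h !mxE.
pose H := GRing.isLinear.Build _ _ _ _ h h_lin.
pose hL : {linear 'rV[R]_(1 + q) -> R^o} := HB.pack h H.
apply: (@noetherian_extension _ _ _ _ (mulmxr (row_mx 0 1%:M)) hL _ IH nR) => x x0.
exists (rsubmx x); rewrite /= mul_mx_row mulmx0 mulmx1 -[RHS]hsubmxK; congr row_mx.
apply/rowP => j; rewrite !mxE -[LHS]x0 /= /h; congr (x _ _).
by apply/val_inj; rewrite /= ord1.
Qed.

Lemma noetherian_int : noetherian int^o.
Proof.
move=> P subP; have [P0 PD] := subP.
have [[g0 Pg0 g00]|all0] := pselect (exists2 g, P g & g != 0); last first.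
  exists [::] => //= x Px; apply/eqP/negP => /negP x0; apply: all0; by exists x.
have ex : exists n, `[< exists2 g : int, P g & (g != 0) /\ `|g|%N = n >].
  by exists `|g0|%N; apply/asboolP; exists g0.
case: (ex_minnP ex) => n /asboolP[g Pg [gn0 gn]] min.
exists [:: g] => [h|x Px]; first by rewrite inE => /eqP ->.
have xE := divz_eq x g; have := ltz_mod x gn0.
have Pm : P (x %% g)%Z.
  have -> : (x %% g)%Z = x - (x %/ g)%Z * g by rewrite {2}xE addrAC subrr add0r.
  by apply: submoduleB => //; rewrite -[_ * g]addr0; apply: PD.
exists (x %/ g)%Z; rewrite /= -[_ *: _]/((x %/ g)%Z * g).
apply/eqP; rewrite {1}xE addrAC subrr add0r; apply/negP => /negP m0.
have : (n <= `|x %% g|%Z)%N by apply: min; apply/asboolP; exists (x %% g)%Z.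
have := modz_ge0 x gn0; rewrite -gn; lia.
Qed.

Section Hilbert.
Variables (R : comNzRingType) (I : {poly R}^o -> Prop).
Hypothesis subI : submodule I.
Implicit Types p q : {poly R}.

Let I0 : I 0 := subI.1.
Let IM p q : I q -> I (p * q).
Proof. by move=> Iq; rewrite -[_ * q]addr0; apply: subI.2. Qed.
Let ID p q : I p -> I q -> I (p + q).
Proof. by move=> Ip Iq; rewrite -[p]mul1r; apply: subI.2. Qed.

(** The coefficient of X^d may be 0 here; allowing it makes this an ideal without case
    distinctions. *)
Definition lead_ideal d : R^o -> Prop :=
  fun c => exists p, [/\ I p, (size p <= d.+1)%N & p`_d = c].

Lemma lead_ideal_submodule d : submodule (lead_ideal d).
Proof.
split=> [|a _ _ [p [Ip sp <-]] [q [Iq sq <-]]].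
  by exists 0; rewrite size_poly0 coef0.
exists (a%:P * p + q); split.
- by apply: ID => //; apply: IM.
- rewrite (leq_trans (size_polyD _ _)) // geq_max sq andbT.
  by apply: leq_trans sp; rewrite mul_polyC size_scale_leq.
- by rewrite coefD coefCM.
Qed.

Lemma lead_ideal_le d e c : (d <= e)%N -> lead_ideal d c -> lead_ideal e c.
Proof.
move=> /subnKC <- [p [Ip sp <-]]; exists ('X^(e - d) * p); split; first exact: IM.
  apply/leq_sizeP => j dj; rewrite coefXnM; case: ltnP => // ed.
  by apply: nth_default; apply: leq_trans sp _; lia.
by rewrite coefXnM ltnNge leq_addl /= addnK.
Qed.
End Hilbert.

Lemma lead_ideal_gens (R : comNzRingType) (I : {poly R}^o -> Prop) d : noetherian R^o ->
  submodule I -> exists2 s : seq {poly R}^o, (forall g, g \in s -> I g) &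
    forall p : {poly R}, I p -> (size p <= d.+1)%N ->
      exists2 q, lspan s q & (size (p - q)%R <= d)%N.
Proof.
move=> nR subI; have [s sP span] := nR _ (lead_ideal_submodule subI d).
have [t tI ts] : exists2 t : seq {poly R}^o, (forall p, p \in t -> I p /\ (size p <= d.+1)%N) &
    [seq (p : {poly R})`_d | p <- t] = s.
  elim: s sP {span} => [|c s IH] sP; first by exists [::].
  have [|t tP ts] := IH; first by move=> h hs; apply: sP; rewrite inE hs orbT.
  have [|p [Ip sp pc]] := sP c; first by rewrite inE eqxx.
  exists (p :: t); last by rewrite /= pc ts.
  by move=> h; rewrite inE => /predU1P[->|/tP].
exists t => [g /tI[]//|p Ip sp].
have : lspan s p`_d by apply: span; exists p.
rewrite -ts; elim: t p sp {Ip span ts sP subI} tI => [|g t IH] p sp tI /=.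
  move=> pd; exists 0 => //; rewrite subr0; apply/leq_sizeP => j.
  by rewrite leq_eqVlt => /predU1P[<- //|dj]; apply: nth_default; apply: leq_trans dj.
have [_ sg] := tI g (mem_head _ _).
move=> [a e]; have [|h ht||q tq sq] := IH (p - a%:P * g).
- rewrite (leq_trans (size_polyD _ _)) // geq_max sp size_polyN mul_polyC /=.
  by apply: leq_trans sg; exact: size_scale_leq.
- by apply: tI; rewrite inE ht orbT.
- by rewrite coefB coefCM.
exists (q + a%:P * g); last by rewrite opprD addrA addrAC.
by exists a%:P; rewrite addrK.
Qed.

(** Hilbert's basis theorem. D is a degree in which generators of the union of all leading ideals
    already occur. Above D a leading term is cancelled by X^(d-D) times an element of degree at most
    D; up to D finitely many generators per degree suffice. *)
Lemma noetherian_poly (R : comNzRingType) : noetherian R^o -> noetherian {poly R}^o.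
Proof.
move=> nR I subI.
pose J (c : R^o) := exists d, lead_ideal I d c.
have subJ : submodule J.
  split=> [|a x y [d dx] [e ey]]; first by exists 0%N; apply: (lead_ideal_submodule subI 0).1.
  exists (maxn d e); apply: (lead_ideal_submodule subI _).2.
    by apply: (lead_ideal_le subI) dx; rewrite leq_maxl.
  by apply: (lead_ideal_le subI) ey; rewrite leq_maxr.
have [sJ sJP Jspan] := nR _ subJ.
have [D JD] : exists D, forall c, c \in sJ -> lead_ideal I D c.
  elim: sJ sJP {Jspan} => [|c s IH] sP; first by exists 0%N.
  have [|D HD] := IH; first by move=> h hs; apply: sP; rewrite inE hs orbT.
  have [|d cd] := sP c; first by rewrite inE eqxx.
  exists (maxn d D) => h; rewrite inE => /predU1P[->|/HD].
    by apply: (lead_ideal_le subI) cd; exact: leq_maxl.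
  by apply: (lead_ideal_le subI); exact: leq_maxr.
have [G GI Gspan] : exists2 G : seq {poly R}^o, (forall g, g \in G -> I g) &
    forall p : {poly R}, I p -> (size p <= D.+1)%N -> lspan G p.
  elim: (D.+1) => [|d [G GI Gspan]].
    exists [::] => // p _; rewrite leqn0 size_poly_eq0 => /eqP ->; exact: (lspan_submodule _).1.
  have [t tI tspan] := lead_ideal_gens d nR subI.
  exists (t ++ G) => [g|p Ip /(tspan p Ip)[q tq sq]].
    by rewrite mem_cat => /orP[/tI|/GI].
  have Iq : I q by apply: lspan_least tq.
  have /Gspan/(_ sq) Gpq : I (p - q) by exact: (submoduleB subI Ip Iq).
  have -> : p = (p - q) + q by rewrite subrK.
  apply: (@lspanD _ {poly R}^o).
    by apply: lspan_subset Gpq => h; rewrite mem_cat orbC => ->.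
  by apply: lspan_subset tq => h; rewrite mem_cat => ->.
exists G => // p; have [N] := ubnP (size (p : {poly R})); elim: N p => // N IH p.
rewrite ltnS => spN Ip; have [le|lt] := leqP (size (p : {poly R})) D.+1; first exact: Gspan.
pose d := (size (p : {poly R})).-1; have sd : size (p : {poly R}) = d.+1 by rewrite prednK // (leq_trans _ lt).
have Dd : (D <= d)%N by rewrite -ltnS -sd ltnW.
have /(lspan_least (lead_ideal_submodule subI D) JD)[q [Iq sq qd]] : lspan sJ (p : {poly R})`_d.
  by apply: Jspan; exists d, p; rewrite sd.
have Gq : lspan G ('X^(d - D) * q).
  by apply: (@lspanZ _ {poly R}^o); apply: Gspan.
have -> : p = (p - 'X^(d - D) * q) + 'X^(d - D) * q by rewrite subrK.
apply: (@lspanD _ {poly R}^o) => //.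
apply: IH; last first.
  suff Iq' : I ('X^(d - D) * q) by exact: (submoduleB subI Ip Iq').
  by rewrite -[_ * q]addr0; apply: subI.2 => //; exact: subI.1.
apply: leq_trans spN; rewrite sd ltnS; apply/leq_sizeP => j dj.
rewrite coefB coefXnM ltnNge (leq_trans (leq_subr _ _) dj) /=.
move: dj; rewrite leq_eqVlt => /predU1P[<-|dj]; first by rewrite subKn // qd subrr.
rewrite [p`_j]nth_default ?sd // [q`__]nth_default ?subrr //.
by apply: leq_trans sq _; lia.
Qed.

Lemma noetherian_laurent : noetherian Laurent^o.
Proof.
move=> I subI; have [I0 ID] := subI.
have [|s sI span] := @noetherian_poly _ noetherian_int (fun p => I (laurent_poly p)).
  split=> [|a x y Ix Iy]; first by rewrite rmorph0.
  by rewrite -[a *: x]/(a * x) rmorphD rmorphM; apply: ID.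
exists (map laurent_poly s) => [_ /mapP[p /sI Ip ->] //|a Ia].
have : lspan s (laurent_num a).
  apply: span; rewrite -laurent_numden -[_ * a]addr0; exact: ID.
move=> sa; have {sa} : lspan (map laurent_poly s : seq Laurent^o) (laurent_poly (laurent_num a)).
  move: sa; apply: (@lspan_least _ {poly int}^o (fun p => lspan (map laurent_poly s : seq Laurent^o) (laurent_poly p))).
    have [S0 SD] := lspan_submodule (map laurent_poly s : seq Laurent^o).
    split=> [|b x y sx sy]; first by rewrite rmorph0.
    by rewrite -[b *: x]/(b * x) rmorphD rmorphM; apply: SD.
  by move=> g gs; apply: lspan_mem; apply: map_f.
rewrite -laurent_numden => sa.
have -> : a = (laurent_t ^- laurent_den a : Laurent) *: (laurent_t ^+ laurent_den a * a : Laurent^o).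
  by rewrite -[_ *: _]/(laurent_t ^- laurent_den a * _) mulKr // unitrX // laurent_t_unit.
exact: lspanZ.
Qed.

Lemma noetherian_row_mx (R : nzRingType) q (P : 'rV[R]_q -> Prop) :
  noetherian 'rV[R]_q -> submodule P ->
  exists p (A : 'M[R]_(p, q)), forall x, P x <-> exists a, x = a *m A.
Proof.
move=> nR subP; have [s sP span] := nR _ subP; have [P0 PD] := subP.
exists (size s), (\matrix_(i < size s) s`_i) => x; split=> [/span|[a ->]]; last first.
  rewrite mulmx_sum_row; apply: (big_ind P) => // [y z Py Pz|i _].
    by rewrite -[y]scale1r; apply: PD.
  by rewrite rowK -[_ *: _]addr0; apply: PD => //; apply: sP; apply: mem_nth.
elim: s {sP span P subP P0 PD} x => [|g s IH] x /=; first by exists 0; rewrite mul0mx.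
move=> [a /IH[b e]]; exists (row_mx a%:M b).
rewrite -[x](subrK (a *: g)) e !mulmx_sum_row addrC.
rewrite [RHS](@big_split_ord _ _ _ 1 (size s)) /= big_ord1 rowK.
congr (_ *: _ + _); first by have := row_mxEl (a%:M : 'M_1) b 0 0; rewrite [RHS]mxE eqxx mulr1n => ->.
by apply: eq_bigr => i _; have := row_mxEr (a%:M : 'M_1) b 0 i; rewrite !rowK => ->.
Qed.

(** * Fox calculus on link groups *)

(** The additive form of a b = c a, that is n a + t n b = n c + t n a, where a is the over-edge and
    b, c are the under-edges to its left and right. It is imposed at the under-edge that arrives at
    the crossing. *)
Definition link_family r (D : vdiagram r) (N : lmodType Laurent) (n : edge D -> N) : Prop :=
  forall e, across e != e ->
  match role e with
  | Under => if from_left e then laurent_t *: n (next_edge e) = n e + (laurent_t - 1) *: n (across e)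
             else laurent_t *: n e = n (next_edge e) + (laurent_t - 1) *: n (across e)
  | _ => n (next_edge e) = n e
  end.

Section FoxCocycle.
Variables (r : nat) (D : vdiagram r) (N : lmodType Laurent) (n : edge D -> N).
Hypothesis nP : link_family n.
Local Notation t := laurent_t.

(** The crossed homomorphism with value n e on the generator e; the rule for products makes an
    inverse letter contribute -t^-1 n e. *)
Fixpoint fox (u : word (edge D)) : N :=
  if u is (e, b) :: u' then
    if b then n e + t *: fox u' else t^-1 *: (fox u' - n e)
  else 0.

Lemma t_scaleK (M : lmodType Laurent) (x : M) : t *: (t^-1 *: x) = x.
Proof. by rewrite scalerA mulrV ?scale1r // laurent_t_unit. Qed.
Lemma t_scaleVK (M : lmodType Laurent) (x : M) : t^-1 *: (t *: x) = x.
Proof. by rewrite scalerA mulVr ?scale1r // laurent_t_unit. Qed.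

Lemma t_scale_inj (M : lmodType Laurent) (x y : M) : t *: x = t *: y -> x = y.
Proof. by move=> /(congr1 ( *:%R t^-1)); rewrite !t_scaleVK. Qed.

Lemma exponent_sum_cons (e : edge D) b u :
  exponent_sum ((e, b) :: u) = (if b then 1 else -1) + exponent_sum u.
Proof. by rewrite /exponent_sum big_cons. Qed.

Lemma fox_cat u v : fox (u ++ v) = fox u + t ^ (exponent_sum u) *: fox v.
Proof.
elim: u => [|[e b] u IH] /=; first by rewrite /exponent_sum big_nil expr0z scale1r add0r.
rewrite IH exponent_sum_cons exprzDr ?laurent_t_unit // -scalerA.
case: b; first by rewrite expr1z scalerDr addrA.
by rewrite exprN1 -addrA [_ - n e]addrC addrA scalerDr.
Qed.

Lemma fox_presented u v : presented_eq (@wirtinger r D) u v -> fox u = fox v.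
Proof.
elim=> {u v} //.
- move=> u v [e ne re|a na ra|a na ra] /=; rewrite !scaler0 ?addr0.
  + by have := nP ne; rewrite re => ->.
  + by have := nP na; rewrite ra => ->.
  + set c := right_under a; set b := left_under a.
    suff e : t *: n b = n c + (t - 1) *: n a.
      by rewrite -[n b]t_scaleVK e scalerBl scale1r addrA.
    have nq : across (across a) != across a by rewrite acrossK eq_sym.
    have := nP nq; rewrite role_across // ra /= acrossK from_left_across //.
    by rewrite /b /c /left_under /right_under; case: (from_left a).
- by move=> e [] /=; rewrite ?scaler0 ?sub0r ?addr0 ?scalerN ?t_scaleK ?addrN ?subrr ?scaler0.
- by move=> u v w _ -> _ ->.
- move=> u u' v v' uu IH vv IH'; rewrite !fox_cat IH IH'.
  by rewrite (exponent_sum_presented uu).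
Qed.
End FoxCocycle.

Lemma laurent_scalable (M N : lmodType Laurent) (f : {additive M -> N}) :
  (forall x, f (laurent_t *: x) = laurent_t *: f x) -> forall a x, f (a *: x) = a *: f x.
Proof.
move=> ft; elim/laurent_ind => [x|a b IHa IHb x|a IH x|a IH x].
- by rewrite !scale1r.
- by rewrite !scalerBl raddfB /= IHa IHb.
- by rewrite -!scalerA ft IH.
- by rewrite -[in LHS]scalerA -[LHS]t_scaleVK -ft t_scaleK IH scalerA.
Qed.

Section LinkModuleUniversal.
Variables (r : nat) (D : vdiagram r) (e0 : edge D).
Local Notation t := laurent_t.
Local Notation G := (link_group D).
Local Notation M := (link_module D).
Local Notation s := (wirtinger_gen e0).

Definition base_pow (z : int) : G :=
  match z with Posz k => (s ^+ k)%g | Negz k => ((s ^+ k.+1)^-1)%g end.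

Lemma base_powS z : base_pow (z + 1) = (base_pow z * s)%g.
Proof.
case: z => [k|[|k]].
- have -> : Posz k + 1 = Posz k.+1 by lia.
  exact: expgSr.
- by rewrite -[Negz 0 + 1]/(0 : int) /= expg1 mulVg.
- have -> : Negz k.+1 + 1 = Negz k by lia.
  by rewrite /= [in RHS]expgS invgM mulgVK.
Qed.

Lemma gamma_base_pow z : gamma (base_pow z) = z.
Proof.
have gX k : gamma (s ^+ k)%g = k :> int.
  elim: k => [|k IH]; first by rewrite expg0 gamma1.
  by rewrite expgSr gammaM IH gamma_generator -addn1 PoszD.
by case: z => k; rewrite /= ?gammaV gX // NegzE.
Qed.

Lemma link_gen_subproof e : (wirtinger_gen e * s^-1)%g \in @ker_gamma_pred r D.
Proof. by rewrite unfold_in gammaM gammaV !gamma_generator subrr. Qed.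
Definition link_gen e : M := ab_cls (KerGamma (link_gen_subproof e)).

Lemma link_gen_base : link_gen e0 = 0.
Proof. by congr ab_cls; apply: val_inj; rewrite /= mulgV. Qed.

Lemma link_family_gen : link_family link_gen.
Proof.
move=> e ne; have eq_gen e1 e2 : wirtinger [:: (e1, true)] [:: (e2, true)] -> link_gen e2 = link_gen e1.
  by move=> /PresRel/clsP e12; congr ab_cls; apply: val_inj; rewrite /= /wirtinger_gen e12.
have under (a b c : edge D) : wirtinger [:: (b, true)] [:: (a, false); (c, true); (a, true)] ->
    t *: link_gen b = link_gen c + (t - 1) *: link_gen a.
  move=> /PresRel/clsP bE.
  have ab : (wirtinger_gen a * wirtinger_gen b = wirtinger_gen c * wirtinger_gen a)%g.
    rewrite -[wirtinger_gen b]/(cls (@wirtinger r D) [:: (b, true)]) bE.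
    have -> : cls (@wirtinger r D) [:: (a, false); (c, true); (a, true)] =
        ((wirtinger_gen a)^-1 * wirtinger_gen c * wirtinger_gen a)%g.
      by rewrite /wirtinger_gen [X in (X * _ * _)%g]cls_inv [X in (X * _)%g]cls_mul [RHS]cls_mul.
    by rewrite !mulgA mulgV mul1g.
  apply/eqP; rewrite scalerBl scale1r addrA eq_sym subr_eq; apply/eqP.
  rewrite /link_gen (scale_t_link _ (gamma_generator a)) (scale_t_link _ (gamma_generator e0)).
  rewrite -[LHS]ab_clsM -[RHS]ab_clsM; congr ab_cls; apply: val_inj => /=.
  by rewrite !mulgA mulgVK ab mulgVK.
have nq : across (across e) != across e by rewrite acrossK eq_sym.
case re: (role e); [exact: eq_gen (WirtOver _ _)| |exact: eq_gen (WirtVirtual _ _)].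
have ra : role (across e) = Over by rewrite role_across // re.
have := under _ _ _ (WirtUnder nq ra).
rewrite /left_under /right_under from_left_across // acrossK.
by case: (from_left e).
Qed.

(** For a word u of any exponent, [fox link_gen u] is the class of u s^(-exponent u). The correction
    by a power of the base generator s is what makes the induction possible, since suffixes of a
    kernel word leave the kernel. *)
Lemma link_gen_generates (x : M) : exists u, x = fox link_gen u.
Proof.
elim/ab_ind: x => k.
have key u : forall h (hP : h \in @ker_gamma_pred r D),
    h = (cls (@wirtinger r D) u * base_pow (- exponent_sum u))%g ->
    fox link_gen u = ab_cls (KerGamma hP).
  elim: u => [|[e b] u IH] h hP hE.
    congr ab_cls; apply: val_inj; rewrite /= hE /exponent_sum big_nil oppr0 mulg1.
    by [].
  have kP : (cls (@wirtinger r D) u * base_pow (- exponent_sum u))%g \in @ker_gamma_pred r D.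
    by rewrite unfold_in gammaM gamma_base_pow gamma_cls addrN.
  have cE : cls (@wirtinger r D) ((e, b) :: u) =
     ((if b then wirtinger_gen e else (wirtinger_gen e)^-1) * cls (@wirtinger r D) u)%g.
    by case: b {hE} => /=; rewrite /wirtinger_gen ?[X in (X * _)%g]cls_inv [RHS]cls_mul.
  have pw z : base_pow (z - 1) = (base_pow z * s^-1)%g.
    by rewrite -{2}[z](subrK 1) base_powS mulgK.
  rewrite /= (IH _ kP erefl) /link_gen; case: b hE cE => hE cE.
    rewrite (scale_t_link _ (gamma_generator e)) addrC -[LHS]ab_clsM; congr ab_cls.
    apply: val_inj; rewrite /= hE cE exponent_sum_cons opprD addrC pw.
    by rewrite !mulgA mulgVK.
  apply: (@t_scale_inj M); rewrite t_scaleK.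
  rewrite (scale_t_link _ (gamma_generator e)) -[X in _ - X]/(ab_cls _).
  apply/eqP; rewrite subr_eq; apply/eqP; rewrite -[RHS]ab_clsM; congr ab_cls.
  apply: val_inj; rewrite /= hE cE exponent_sum_cons opprD opprK addrC base_powS.
  by rewrite !mulgA mulgV mul1g mulgVK mulgK.
pose u := repr (val k); exists u; symmetry; case: k @u => h hP u; apply: key.
have -> : exponent_sum u = 0 by apply/eqP; exact: hP.
by rewrite oppr0 mulg1 /cls reprK.
Qed.

(** The crossed homomorphism F extending n is an honest homomorphism on the kernel of gamma, where
    t^gamma = 1, so it kills commutators. On e e0^-1 it takes the value n e - n e0 = n e. *)
Lemma link_module_universal (N : lmodType Laurent) (n : edge D -> N) :
  link_family n -> n e0 = 0 -> exists f : {linear M -> N}, forall e, f (link_gen e) = n e.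
Proof.
move=> nP n0; pose F (g : G) := fox n (repr g).
have Fcls u : F (cls _ u) = fox n u by apply: fox_presented => //; apply: repr_cls.
have FM g h : F (g * h)%g = F g + t ^ gamma g *: F h.
  by rewrite /F (fox_presented nP (repr_cls _ _)) fox_cat.
have F1 : F 1%g = 0 by rewrite [LHS]Fcls.
have FV g : F g^-1%g = - (t ^ (- gamma g) *: F g).
  by apply/eqP; rewrite -addr_eq0 -gammaV -FM mulVg F1.
pose f (v : M) : N := F (val (repr (v : ker_ab D))).
have g0 (k : ker_gamma D) : gamma (val k) = 0 by apply/eqP; exact: valP k.
have FkM (k l : ker_gamma D) : F (val (k * l)%g) = F (val k) + F (val l).
  by rewrite [LHS]FM g0 expr0z scale1r.
have FkV (k : ker_gamma D) : F (val k^-1%g) = - F (val k).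
  by rewrite [LHS]FV g0 oppr0 expr0z scale1r.
have Fder (k : ker_gamma D) : in_derived k -> F (val k) = 0.
  move=> [q ->]; elim: q => [|[a b] q IH]; first by rewrite big_nil.
  rewrite big_cons FkM IH addr0 commgEl conjgE !FkM !FkV /=.
  by rewrite addrCA addKr addNr.
have fcls (k : ker_gamma D) : f (ab_cls k) = F (val k).
  have /ab_clsP/Fder : ab_cls (repr (ab_cls k)) = ab_cls k by rewrite ab_reprK.
  by rewrite FkM FkV addrC => /eqP; rewrite subr_eq0 => /eqP.
have fB : zmod_morphism f.
  elim/ab_ind=> k; elim/ab_ind=> l.
  have -> : ab_cls k - ab_cls l = ab_cls (k * l^-1)%g :> M.
    apply/eqP; rewrite subr_eq; apply/eqP; rewrite -[RHS]ab_clsM; congr ab_cls.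
    by rewrite mulgVK.
  by rewrite !fcls FkM FkV.
pose fA : {additive M -> N} := HB.pack f (GRing.isZmodMorphism.Build _ _ f fB).
have ft x : fA (t *: x) = t *: fA x.
  elim/ab_ind: x => k; rewrite (scale_t_link _ (gamma_generator e0)) /= !fcls /=.
  rewrite !FM gammaM g0 addr0 gamma_generator expr1z FV gamma_generator.
  rewrite scalerN exprN1 t_scaleK.
  by rewrite addrAC subrr add0r.
pose fL : {linear M -> N} := HB.pack f (GRing.isZmodMorphism.Build _ _ f fB)
  (GRing.isScalable.Build _ _ _ _ f (laurent_scalable ft)).
exists fL => e; rewrite /= fcls /= FM FV gamma_generator expr1z scalerN scalerA.
rewrite /wirtinger_gen !Fcls /= !scaler0 !addr0 n0 scaler0.
by rewrite subr0.
Qed.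
End LinkModuleUniversal.

(** * The torus shadow *)

(** Crossings, faces, components and loops of the torus shadow are all counted in this way, by
    labels that are constant on classes and separate them. *)
Lemma n_comp_label (T L : finType) (e : rel T) (l : T -> L) (s : L -> T) :
  cancel s l -> (forall x y, e x y -> l x = l y) ->
  (forall x y, l x = l y -> connect e x y) -> n_comp e predT = #|L|.
Proof.
move=> sK le lc.
have lC x y : connect e x y -> l x = l y.
  move=> /connectP[p + ->]; elim: p x => //= z p IH x /andP[/le -> /IH]; exact.
have esym : connect_sym e by move=> x y; apply/idP/idP => /lC/esym/lc.
have rl : {in roots e &, injective l}.
  by move=> x y /eqP rx /eqP ry /lc; rewrite -(root_connect esym) rx ry => /eqP.
rewrite /n_comp_mem -(card_in_image (f := l)) => [|x y].
  apply: eq_card => c; rewrite inE; apply/fintype.imageP.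
  exists (fingraph.root e (s c)); first by rewrite !inE roots_root.
  by rewrite -{1}(sK c); apply/lC/connect_root.
by rewrite !inE !andbT; apply: rl.
Qed.

Lemma fconnect1_eq (T : finType) (f : T -> T) x y : f x = y -> fconnect f x y.
Proof. by move=> <-; apply: fconnect1. Qed.

Lemma fconnect_iter_shift (T : finType) (m : nat) (f : T -> T) (g : 'I_m.+2 -> T) :
  (forall b, f (g b) = g (b + 1)) -> forall b c, fconnect f (g b) (g c).
Proof.
move=> fg b c; have -> : c = b + (val (c - b))%:R by rewrite natr_Zp addrC subrK.
suff -> : forall k, g (b + k%:R) = iter k f (g b) by apply: fconnect_iter.
by elim=> [|k IH] /=; rewrite ?addr0 // -IH fg -addrA natr1.
Qed.

Lemma left_turn_inj (E : finType) (nx ac : E -> E) (fl : pred E) :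
  injective nx -> involutive ac -> (forall e, ac e != e) -> injective (left_turn nx ac fl).
Proof.
move=> nx_inj acK ac0.
pose back (d : E * bool) : E * bool :=
  let p := if d.2 then ac (finv nx d.1) else ac d.1 in
  let fwd := if d.2 then ~~ fl p else fl p in (if fwd then p else nx p, fwd).
apply: (@can_inj _ _ _ back) => -[e fwd]; rewrite /left_turn (negbTE (ac0 _)) /back.
case: fwd => /=.
  by case fe: (fl e); rewrite /= ?finv_f // acK fe.
by case fe: (fl (finv nx e)); rewrite /= ?finv_f // acK fe /= f_finv.
Qed.

(* The closed braid with w'.+3 strands on the word (s_0 s_1 ... s_(w'.+1))^(m'.+2): the
   crossing (b, i) lies in block b and exchanges the positions i and i+1; the edge
   (b, i, true) arrives there from position i and (b, i, false) from position i+1. *)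
Section TorusShadow.
Variables (m' w' : nat).
Local Notation B := 'I_m'.+2.
Local Notation W := 'I_w'.+2.
Definition tedge : finType := (B * W * bool)%type.

Definition tnext (e : tedge) : tedge :=
  let: (b, i, s) := e in
  if s then if i == ord_max then (b + 1, i, false) else (b, inord i.+1, true)
  else if i == ord0 then (b + 1, ord0, true) else (b + 1, inord i.-1, false).
Definition tprev (e : tedge) : tedge :=
  let: (b, i, s) := e in
  if s then if i == ord0 then (b - 1, ord0, false) else (b, inord i.-1, true)
  else if i == ord_max then (b - 1, i, true) else (b - 1, inord i.+1, false).
Definition tacross (e : tedge) : tedge := let: (b, i, s) := e in (b, i, ~~ s).
Definition tleft (e : tedge) : bool := let: (b, i, s) := e in ~~ s.

Lemma ord_succ_neq (i : W) : i != ord_max ->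
  [/\ val (inord i.+1 : W) = i.+1, (inord i.+1 : W) != ord0 & inord (inord i.+1 : W).-1 = i :> W].
Proof.
move=> ni; have lt : (i.+1 < w'.+2)%N.
  by rewrite ltn_neqAle ltn_ord andbT; apply: contra_neq ni => e; apply/val_inj; case: e.
by split; rewrite ?inordK // -?val_eqE /= ?inordK // inord_val.
Qed.
Lemma ord_pred_neq (i : W) : i != ord0 ->
  [/\ val (inord i.-1 : W) = i.-1, (inord i.-1 : W) != ord_max & inord (inord i.-1 : W).+1 = i :> W].
Proof.
case: i => -[|i] // lt ni; have lt' := ltnW lt.
split; rewrite -?val_eqE /= ?inordK //; first by rewrite neq_ltn; lia.
by apply/val_inj; rewrite /= inordK.
Qed.

Lemma tnextK : cancel tnext tprev.
Proof.
move=> [[b i] []] /=.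
  case: (eqVneq i ord_max) => [->|ni] /=; first by rewrite eqxx addrK.
  by have [_ /negbTE -> ->] := ord_succ_neq ni.
case: (eqVneq i ord0) => [->|ni] /=; first by rewrite addrK.
by have [_ /negbTE -> ->] := ord_pred_neq ni; rewrite addrK.
Qed.

Lemma tnext_inj : injective tnext. Proof. exact: can_inj tnextK. Qed.
Lemma tacrossK : involutive tacross. Proof. by move=> [[b i] s] /=; rewrite negbK. Qed.
Lemma tacross_neq e : tacross e != e.
Proof. by case: e => [[b i] []]; rewrite /= -pair_eqE /= andbF. Qed.

Lemma tleft_turnE b i s fwd : left_turn tnext tacross tleft ((b, i, s), fwd) =
  if fwd then if s then (tnext (b, i, false), true) else ((b, i, true), false)
  else if s then if i == ord0 then (tnext (b - 1, ord0, true), true) else ((b, inord i.-1, false), false)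
  else if i == ord_max then ((b - 1, i, false), false) else (tnext (b - 1, inord i.+1, true), true).
Proof.
rewrite /left_turn; case: fwd; first by rewrite (negbTE (tacross_neq _)); case: s.
rewrite (negbTE (tacross_neq _)) (finv_eq_can tnextK) [tprev _]/=.
by case: s; case: eqP.
Qed.

Lemma fconnect_long b i j : (i <= j)%N -> (j < w'.+2)%N ->
  fconnect tnext (b, inord i, true) (b, inord j, true).
Proof.
move=> /subnKC <-; elim: (j - i)%N => [|k IH]; first by rewrite addn0.
rewrite addnS => lt; apply: connect_trans (IH (ltnW lt)) _; apply: fconnect1_eq => /=.
have ik : val (inord (i + k) : W) = (i + k)%N by rewrite /= inordK // ltnW.
by rewrite ik -val_eqE ik /= -eqSS (ltn_eqF lt).
Qed.

Lemma fconnect_short b i : fconnect tnext (b, i, false) (b + (val i)%:R + 1, ord0, true).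
Proof.
case: i => i; elim: i b => [|i IH] b lt /=.
  by apply: fconnect1_eq; rewrite /= addr0.
have lt' := ltnW lt.
apply: connect_trans (_ : fconnect tnext _ (b + 1, Ordinal lt', false)) _.
  apply: fconnect1_eq => /=; congr (_, _, _).
  by apply/val_inj; rewrite /= inordK.
have := IH (b + 1) lt'; rewrite /=.
by rewrite -(addrA b 1) -natr1 [1 + _]addrC.
Qed.

(** The face to the left of a dart: [None] is the region beyond position 0, [Some None] the one
    beyond the last position, and [Some (Some (b, i))] lies between positions i and i+1, from the
    crossing (b, i) to (b+1, i). *)
Definition face_label (d : tedge * bool) : option (option (B * W)) :=
  let: (b, i, s, fwd) := d in
  if fwd then if s then if i == ord0 then None else Some (Some (b, inord i.-1))
              else Some (Some (b - 1, i))
  else if s then Some (Some (b - 1, i))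
       else if i == ord_max then Some None else Some (Some (b - 1, inord i.+1)).
Definition face_dart (c : option (option (B * W))) : tedge * bool :=
  match c with
  | None => ((0, ord0, true), true)
  | Some None => ((0, ord_max, false), false)
  | Some (Some (b, i)) => ((b + 1, i, false), true)
  end.

Lemma face_dartK : cancel face_dart face_label.
Proof. by move=> [[[b i]|]|] //=; rewrite ?eqxx // addrK. Qed.

Local Notation lt := (left_turn tnext tacross tleft).

Lemma face_label_left_turn d : face_label (lt d) = face_label d.
Proof.
case: d => [[[b i] s] fwd]; rewrite tleft_turnE; case: fwd; case: s => //=.
- case: (eqVneq i ord0) => [_|ni] /=; first by [].
  by rewrite addrK.
- case: (eqVneq i ord0) => [->|ni] /=.
    by have [] := @ord_succ_neq ord0 isT; rewrite /= => _ /negbTE -> ->.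
  by have [v /negbTE -> ->] := ord_pred_neq ni.
case: (eqVneq i ord_max) => [->|ni] /=; first by rewrite eqxx.
have [v n0 e] := ord_succ_neq ni.
case: (eqVneq _ ord_max) => [e'|n1] /=; first by rewrite addrK.
by have [v' /negbTE -> ->] := ord_succ_neq n1.
Qed.

Lemma face_label_connect d : fconnect lt d (face_dart (face_label d)).
Proof.
have linj : injective lt := left_turn_inj tnext_inj tacrossK tacross_neq.
case: d => [[[b i] s] fwd]; case: fwd; case: s => /=.
- case: (eqVneq i ord0) => [->|ni] /=.
    apply: (@fconnect_iter_shift _ _ lt (fun b => ((b, ord0, true), true))) => c.
    by rewrite tleft_turnE.
  by apply: fconnect1_eq; rewrite tleft_turnE /= (negbTE ni).
- by rewrite subrK.
- by rewrite subrK fconnect_sym //; apply: fconnect1_eq; rewrite tleft_turnE.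
case: (eqVneq i ord_max) => [->|ni] /=.
  rewrite fconnect_sym //.
  have := @fconnect_iter_shift _ m' lt (fun b => ((- b, ord_max, false), false)) _ 0 (- b).
  by rewrite oppr0 opprK; apply=> c; rewrite tleft_turnE eqxx opprD.
have [v /negbTE n0 e] := ord_succ_neq ni.
rewrite subrK fconnect_sym //.
apply: (@connect_trans _ _ ((b, inord i.+1, true), false)); apply: fconnect1_eq.
  by rewrite tleft_turnE.
by rewrite tleft_turnE n0 e.
Qed.

(** With N crossings there are 2N edges, N + 2 faces and one component, so both sides of Euler's
    formula are 2N + 2. *)
Lemma torus_planar : planar_diagram tnext tacross tleft.
Proof.
have linj : injective lt := left_turn_inj tnext_inj tacrossK tacross_neq.
rewrite /planar_diagram.
have -> : fcard tacross predT = #|{: B * W}|.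
  apply: (@n_comp_label _ _ _ (fun e : tedge => e.1) (fun c => (c, true))) => //.
    by move=> [[b i] s] y /eqP <-.
  move=> [c s] [c' s'] /= <-; case: (eqVneq s s') => [->|]; first exact: connect0.
  by case: c => b i ss'; apply: fconnect1_eq; rewrite /=; case: s s' ss' => -[].
have -> : fcard lt predT = #|{: option (option (B * W))}|.
  apply: (n_comp_label face_dartK) => [d d' /eqP <-|d d' e]; first by rewrite face_label_left_turn.
  apply: connect_trans (face_label_connect d) _; rewrite e fconnect_sym //.
  exact: face_label_connect.
have -> : n_comp (adjacent_edges tnext tacross) predT = #|{: unit}|.
  apply: (@n_comp_label _ _ _ (fun=> tt) (fun=> (0, ord0, true))) => // [[]//|x y _].
  have step e : connect (adjacent_edges tnext tacross) e (tnext e).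
    by apply: connect1; apply/orP; left; exact: eqxx.
  have flip e : connect (adjacent_edges tnext tacross) e (tacross e).
    by apply: connect1; apply/orP; right; exact: eqxx.
  have fn e e' : fconnect tnext e e' -> connect (adjacent_edges tnext tacross) e e'.
    by apply: connect_sub => u v /eqP <-.
  have shift (b c : B) : connect (adjacent_edges tnext tacross) (b, ord0, true) (c, ord0, true).
    have -> : c = b + (val (c - b))%:R by rewrite natr_Zp addrC subrK.
    elim: (val _) => [|k IH]; first by rewrite addr0; exact: connect0.
    apply: connect_trans IH _; apply: connect_trans (flip _) _.
    by apply: connect_trans (step _) _; rewrite /= -addrA natr1; exact: connect0.
  have to0 e : exists b, connect (adjacent_edges tnext tacross) e (b, ord0, true).
    case: e => [[b i] []].
      exists (b + (val i)%:R + 1); apply: connect_trans (flip _) (fn _ _ _).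
      exact: fconnect_short.
    by exists (b + (val i)%:R + 1); apply: fn; exact: fconnect_short.
  have from0 e : exists b, connect (adjacent_edges tnext tacross) (b, ord0, true) e.
    case: e => [[b i] s]; exists b.
    have c : connect (adjacent_edges tnext tacross) (b, ord0, true) (b, i, true).
      apply: fn; have := @fconnect_long b 0 i (leq0n _) (ltn_ord i); rewrite inord_val.
      by have -> : inord 0 = ord0 :> W by apply/val_inj; rewrite /= inordK.
    by case: s => //; apply: connect_trans c (flip _).
  have [b xb] := to0 x; have [c cy] := from0 y.
  exact: connect_trans xb (connect_trans (shift b c) cy).
rewrite !card_option !card_prod card_bool card_unit; lia.
Qed.
End TorusShadow.

(** * Presentations and cokernels at t = 1 *)

Section QuotProj.
Variables (R : nzRingType) (V : lmodType R) (G : set V).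
Definition quot_proj (x : V) : quot_span G := \pi_(quot_span G) x.
Fact quot_proj_is_linear : linear quot_proj.
Proof. by move=> a x y; rewrite /quot_proj -quot_piD -pi_quot_scale. Qed.
HB.instance Definition _ := GRing.isLinear.Build R V (quot_span G) *:%R quot_proj quot_proj_is_linear.

Lemma quot_proj_surj u : exists x, quot_proj x = u.
Proof. by exists (repr u); apply: reprK. Qed.
Lemma quot_proj0 x : quot_proj x = 0 <-> x \in span_pred G.
Proof. by rewrite -[0](raddf0 quot_proj) quot_spanE subr0. Qed.
Lemma quot_proj_mem x : G x -> quot_proj x = 0.
Proof.
move=> Gx; apply/quot_proj0/asboolP; exists 1%N, (fun=> 1), (fun=> x); split=> //.
by rewrite big_ord1 scale1r.
Qed.
End QuotProj.

Section LinearCombination.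
Variables (R : nzRingType) (M : lmodType R) (q : nat) (v : 'I_q -> M).

Definition lincomb (x : 'rV[R]_q) : M := \sum_j x 0 j *: v j.
Fact lincomb_is_linear : linear lincomb.
Proof.
move=> a x y; rewrite /lincomb scaler_sumr -big_split; apply: eq_bigr => j _.
by rewrite !mxE scalerDl scalerA.
Qed.
HB.instance Definition _ := GRing.isLinear.Build R 'rV[R]_q M *:%R lincomb lincomb_is_linear.

Lemma lincomb_delta j : lincomb (delta_mx 0 j) = v j.
Proof.
rewrite /lincomb (bigD1 j) //= big1 => [|i ij]; rewrite mxE ?(negbTE ij) ?eqxx ?scale0r //.
by rewrite scale1r addr0.
Qed.
End LinearCombination.

Lemma linear_row_eq (R : nzRingType) (M : lmodType R) q (f g : {linear 'rV[R]_q -> M}) :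
  (forall j, f (delta_mx 0 j) = g (delta_mx 0 j)) -> forall x, f x = g x.
Proof.
move=> fg x; rewrite [x]row_sum_delta !linear_sum; apply: eq_bigr => j _.
by rewrite !linearZ fg.
Qed.

Definition coker_map p q (A : 'M[Laurent]_(p, q)) (M : lmodType Laurent) (pi : {linear 'rV_q -> M}) :=
  (forall m, exists x, pi x = m) /\ (forall x, pi x = 0 <-> exists a, x = a *m A).

Definition zcoker p q (n : nat) (B : 'M[int]_(p, q)) :=
  exists f : {additive 'rV[int]_q -> 'rV[int]_n},
    (forall y, exists x, f x = y) /\ (forall x, f x = 0 <-> exists a, x = a *m B).

Lemma span_rows (R : nzRingType) p q (A : 'M[R]_(p, q)) (x : 'rV_q) :
  x \in span_pred [set y | exists i, y = row i A] <-> exists a, x = a *m A.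
Proof.
split=> [/asboolP[n [a [g [Gg ->]]]]|[a ->]].
  apply: (big_ind (fun y => exists a, y = a *m A)).
  - by exists 0; rewrite mul0mx.
  - by move=> _ _ [b ->] [c ->]; exists (b + c); rewrite mulmxDl.
  - by move=> i _; have [k ->] := Gg i; exists (a i *: delta_mx 0 k); rewrite -scalemxAl rowE.
rewrite mulmx_sum_row; apply: rpred_sum => i _; apply: rpredZ.
apply/asboolP; exists 1%N, (fun=> 1), (fun=> row i A); split; first by move=> _; exists i.
by rewrite big_ord1 scale1r.
Qed.

Lemma span_scaled (R : comNzRingType) (M : lmodType R) (c : R) (x : M) :
  x \in span_pred [set y | exists m : M, y = c *: m] <-> exists m, x = c *: m.
Proof.
split=> [/asboolP[n [a [g [Gg ->]]]]|[m ->]].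
  apply: (big_ind (fun y => exists m, y = c *: m)).
  - by exists 0; rewrite scaler0.
  - by move=> _ _ [b ->] [d ->]; exists (b + d); rewrite scalerDr.
  - by move=> i _; have [k ->] := Gg i; exists (a i *: k); rewrite !scalerA mulrC.
apply/asboolP; exists 1%N, (fun=> 1), (fun=> c *: m); split; first by move=> _; exists m.
by rewrite big_ord1 scale1r.
Qed.

Lemma laurent_mx_ev1 m n (A : 'M[Laurent]_(m, n)) :
  exists C, A = map_mx intr (map_mx laurent_ev1 A) + (laurent_t - 1) *: C.
Proof.
have ex i j : exists b, A i j - (laurent_ev1 (A i j))%:~R == (laurent_t - 1) * b.
  have [b e] : exists b, A i j - (laurent_ev1 (A i j))%:~R = (laurent_t - 1) * b.
    by apply: laurent_ev1_eq0; rewrite rmorphB /= laurent_ev1_int subrr.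
  by exists b; apply/eqP.
exists (\matrix_(i, j) xchoose (ex i j)); apply/matrixP => i j; rewrite !mxE.
by rewrite -(eqP (xchooseP (ex i j))) addrC subrK.
Qed.

Lemma map_intr_ev1 m n (B : 'M[int]_(m, n)) : map_mx laurent_ev1 (map_mx intr B) = B.
Proof. by apply/matrixP => i j; rewrite !mxE laurent_ev1_int. Qed.

Section CokernelFree.
Variables (M : lmodType Laurent) (p q : nat) (A : 'M[Laurent]_(p, q)) (pi : {linear 'rV_q -> M}).
Hypothesis piP : coker_map A pi.
Local Notation t := laurent_t.
Local Notation "A ^1" := (map_mx laurent_ev1 A) (at level 2).
Local Notation "A ^z" := (map_mx (intr : int -> Laurent) A) (at level 2).

(** Modulo t - 1 the ring L becomes Z and A agrees with its value at 1, so a congruence modulo t - 1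
    in M can be tested on integer matrices. *)
Lemma coker_ev1 (x y : 'rV_q) : (exists m, pi x - pi y = (t - 1) *: m) <->
  exists a, x^1 - y^1 = a *m A^1.
Proof.
have [pi_surj pi_ker] := piP.
split=> [[m]|[a e]].
  have [z <-] := pi_surj m; rewrite -linearB -linearZ => /eqP.
  rewrite -subr_eq0 -linearB => /eqP/pi_ker[a e]; exists a^1.
  rewrite -map_mxM -e !map_mxB map_mxZ rmorphB rmorph1 /= laurent_ev1_t subrr scale0r.
  by rewrite subr0.
have [C AE] := laurent_mx_ev1 A; have [d dE] := laurent_mx_ev1 (x - y).
exists (pi (d - a^z *m C)); apply/eqP; rewrite -linearB -linearZ -subr_eq0 -linearB; apply/eqP/pi_ker.
exists a^z; rewrite [in RHS]AE mulmxDr dE map_mxB e map_mxM scalerBr opprB.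
by rewrite -scalemxAr addrA addrAC addrK.
Qed.

Lemma cokernel_freeP n : cokernel_free M n <-> zcoker n A^1.
Proof.
have [pi_surj pi_ker] := piP.
pose Q := quot_span [set x : M | exists m : M, x = (t - 1) *: m].
have QE (x y : 'rV_q) : (\pi_Q (pi x) = \pi_Q (pi y)) <-> exists a, x^1 - y^1 = a *m A^1.
  by rewrite -coker_ev1; split=> [/quot_spanE/span_scaled|?] //; apply/quot_spanE/span_scaled.
have piB (x y : M) : \pi_Q (x - y) = \pi_Q x - \pi_Q y :> Q.
  by apply/eqP; rewrite eq_sym subr_eq; apply/eqP; rewrite quot_piD subrK.
split=> [[_ [f f_bij]]|[f [f_surj f_ker]]].
  pose g (x : 'rV[int]_q) : 'rV[int]_n := f (\pi_Q (pi x^z)).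
  have gB : zmod_morphism g by move=> x y; rewrite /g map_mxB linearB piB raddfB.
  exists (HB.pack g (GRing.isZmodMorphism.Build _ _ g gB) : {additive _ -> _}).
  have [h fK hK] := f_bij; split=> [y|x] /=.
    have [x xE] := pi_surj (repr (h y)); exists x^1; rewrite -[RHS]hK /g; apply: (congr1 f).
    rewrite -[h y]reprK -xE; apply/QE; exists 0.
    by rewrite map_intr_ev1 subrr mul0mx.
  rewrite -[x in X in _ <-> X]map_intr_ev1.
  have -> : (g x = 0) <-> \pi_Q (pi x^z) = \pi_Q (pi 0) :> Q.
    rewrite [pi 0]raddf0 /g; split=> [|->]; last by rewrite -[0]subr0 piB subrr raddf0.
    rewrite -[X in _ = X -> _](raddf0 f) => /(can_inj fK) ->.
    by rewrite -[X in _ = \pi_Q X]subr0 piB subrr.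
  by rewrite QE map_mx0 subr0.
split.
  exists q, (fun j => pi (delta_mx 0 j)) => m; have [x <-] := pi_surj m.
  exists (fun j => x 0 j); rewrite {1}[x]row_sum_delta linear_sum; apply: eq_bigr => j _.
  by rewrite linearZ.
pose lift_ (c : Q) := sval (cid (pi_surj (repr c))).
have liftE c : \pi_Q (pi (lift_ c)) = c by rewrite /lift_; case: cid => x /= ->; rewrite reprK.
pose g (c : Q) : 'rV[int]_n := f (lift_ c)^1.
have gE x : g (\pi_Q (pi x)) = f x^1.
  apply/eqP; rewrite -subr_eq0 -raddfB; apply/eqP/f_ker/QE; exact: liftE.
have gB : zmod_morphism g.
  by move=> c d; rewrite -[c]liftE -[d]liftE -piB -linearB !gE map_mxB raddfB.
exists (HB.pack g (GRing.isZmodMorphism.Build _ _ g gB) : {additive _ -> _}).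
pose h (y : 'rV[int]_n) : Q := \pi_Q (pi (sval (cid (f_surj y)))^z).
exists h => [c|y] /=; last by rewrite /h gE map_intr_ev1; case: cid.
rewrite -[c]liftE gE /h; apply/QE/f_ker; case: cid => x /= xE.
by rewrite map_intr_ev1 raddfB /= xE subrr.
Qed.
End CokernelFree.

Section OrbitMatrix.
Variables (q : nat) (f : 'I_q.+1 -> 'I_q.+1).

(** The generators y_0, ..., y_q with y_0 = 0: index 0 belongs to the base edge. *)
Definition gen_vec (R : nzRingType) (i : 'I_q.+1) : 'rV[R]_q :=
  if unlift ord0 i is Some j then delta_mx 0 j else 0.
Definition orbit_mx : 'M[int]_(q.+1, q) := \matrix_i (gen_vec int (f i) - gen_vec int i).

Lemma gen_vec0 R : gen_vec R ord0 = 0.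
Proof. by rewrite /gen_vec unlift_none. Qed.
Lemma gen_vec_lift R j : gen_vec R (lift ord0 j) = delta_mx 0 j.
Proof. by rewrite /gen_vec liftK. Qed.

(** Identifying i with f i leaves a free group on the orbits, and killing generator 0 removes the
    orbit of 0; thus n + 1 orbits, labelled by F, give rank n. *)
Lemma zcoker_orbit_mx n (F : 'I_q.+1 -> 'I_n.+1) (s : 'I_n.+1 -> 'I_q.+1) :
  cancel s F -> F ord0 = ord0 -> (forall i, F (f i) = F i) ->
  (forall i j, F i = F j -> fconnect f i j) -> zcoker n orbit_mx.
Proof.
move=> sK F0 Ff Fc.
pose g (i : 'I_n.+1) : 'rV[int]_n := if unlift ord0 i is Some j then delta_mx 0 j else 0.
pose G : 'M[int]_(q, n) := \matrix_j g (F (lift ord0 j)).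
have genG i : gen_vec int i *m G = g (F i).
  case: (unliftP ord0 i) => [j|] ->; first by rewrite gen_vec_lift -rowE rowK.
  by rewrite gen_vec0 mul0mx F0 /g unlift_none.
have BG : orbit_mx *m G = 0.
  by apply/row_matrixP => i; rewrite row_mul rowK mulmxBl !genG Ff subrr row0.
pose S (i j : 'I_q.+1) := exists a, gen_vec int j - gen_vec int i = a *m orbit_mx.
have Sc i j : F i = F j -> S i j.
  move=> /Fc/connectP[c + ->]; elim: c i => [|k c IH] i /=.
    by move=> _; exists 0; rewrite subrr mul0mx.
  move=> /andP[/eqP <- /IH[a aE]]; exists (a + delta_mx 0 i).
  by rewrite mulmxDl -aE -rowE rowK addrA subrK.
exists (mulmxr G : {additive _ -> _}); split=> [y|x] /=.
  exists (\sum_k y 0 k *: gen_vec int (s (lift ord0 k))).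
  rewrite mulmx_suml [RHS]row_sum_delta; apply: eq_bigr => k _.
  by rewrite -scalemxAl genG sK /g liftK.
split=> [xG|[a ->]]; last by rewrite -mulmxA BG mulmx0.
have [c cE] : exists c, x - \sum_j x 0 j *: gen_vec int (s (F (lift ord0 j))) = c *m orbit_mx.
  rewrite {1}[x]row_sum_delta -sumrB.
  apply: (big_ind (fun y => exists c, y = c *m orbit_mx)).
  - by exists 0; rewrite mul0mx.
  - by move=> _ _ [b ->] [d ->]; exists (b + d); rewrite mulmxDl.
  - move=> j _; have [|a aE] := Sc (s (F (lift ord0 j))) (lift ord0 j); first by rewrite sK.
    by exists (x 0 j *: a); rewrite -scalemxAl -aE gen_vec_lift scalerBr.
have [a0 a0E] : S ord0 (s ord0) by apply: Sc; rewrite sK.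
have {}a0E : gen_vec int (s ord0) = a0 *m orbit_mx by rewrite -a0E gen_vec0 subr0.
(* The coefficients of x sum to 0 on every orbit except that of 0, whose representative is itself a
   combination of the rows, by [a0E]. *)
have xGk k : \sum_(j | F (lift ord0 j) == lift ord0 k) x 0 j = 0.
  have := congr1 (fun y : 'rV_n => y 0 k) xG; rewrite /= mxE [X in _ = X -> _]mxE => e.
  rewrite -[RHS]e [LHS]big_mkcond /=; apply: eq_bigr => j _; rewrite mxE /g.
  case: (unliftP ord0 (F (lift ord0 j))) => [l|] -> /=.
    by rewrite (inj_eq lift_inj) mxE eqxx /= eq_sym; case: eqP; rewrite ?mulr1 ?mulr0.
  by rewrite mxE mulr0.
exists (c + (\sum_(j | F (lift ord0 j) == ord0) x 0 j) *: a0).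
rewrite mulmxDl -cE -scalemxAl -a0E.
suff -> : \sum_j x 0 j *: gen_vec int (s (F (lift ord0 j))) =
   (\sum_(j | F (lift ord0 j) == ord0) x 0 j) *: gen_vec int (s ord0) by rewrite subrK.
rewrite (partition_big (fun j => F (lift ord0 j)) predT) //= big_ord_recl.
rewrite [X in _ + X]big1 ?addr0 => [|k _].
  by rewrite scaler_suml; apply: eq_bigr => j /eqP ->.
transitivity ((\sum_(j | F (lift ord0 j) == lift ord0 k) x 0 j) *: gen_vec int (s (lift ord0 k))).
  by rewrite scaler_suml; apply: eq_bigr => j /eqP ->.
by rewrite xGk scale0r.
Qed.
End OrbitMatrix.

Lemma fcard_label (T : finType) (f : T -> T) (x0 : T) n : injective f -> fcard f predT = n.+1 ->
  exists (F : T -> 'I_n.+1) (s : 'I_n.+1 -> T), [/\ cancel s F, F x0 = ord0,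
    forall x, F (f x) = F x & forall x y, F x = F y -> fconnect f x y].
Proof.
move=> f_inj card_f.
have symf : connect_sym (frel f) := fconnect_sym f_inj.
have rootP x : froot f x \in predI (roots (frel f)) predT by rewrite !inE roots_root.
pose F0 x : 'I_n.+1 := cast_ord card_f (enum_rank_in (rootP x0) (froot f x)).
have F0E x y : F0 x = F0 y -> froot f x = froot f y.
  by move/cast_ord_inj/(congr1 enum_val); rewrite !enum_rankK_in.
pose s0 (i : 'I_n.+1) := enum_val (cast_ord (esym card_f) i).
have s0P i : froot f (s0 i) = s0 i.
  by have /andP[/eqP] := enum_valP (cast_ord (esym card_f) i).
have s0K : cancel s0 F0.
  by move=> i; apply: (canLR (cast_ordKV card_f)); rewrite s0P enum_valK_in.
(* The transposition gives the orbit of [x0] the label 0. *)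
exists (fun x => tperm (F0 x0) ord0 (F0 x)), (fun i => s0 (tperm (F0 x0) ord0 i)); split.
- by move=> i; rewrite s0K tpermK.
- exact: tpermL.
- by move=> x; rewrite /F0 -(fingraph.rootP symf (fconnect1 f x)).
- by move=> x y /perm_inj/F0E/(fingraph.rootP symf).
Qed.

Section LinkPresentation.
Variables (r : nat) (D : vdiagram r) (q : nat).
Hypothesis cardE : #|edge D| = q.+1.
Local Notation t := laurent_t.

Let idx (e : edge D) : 'I_q.+1 := cast_ord cardE (enum_rank e).
Let unidx (i : 'I_q.+1) : edge D := enum_val (cast_ord (esym cardE) i).
Let idxK : cancel idx unidx.
Proof. by move=> e; rewrite /unidx cast_ordK enum_rankK. Qed.
Let unidxK : cancel unidx idx.
Proof. by move=> i; rewrite /idx enum_valK cast_ordKV. Qed.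

Let vec (e : edge D) : 'rV[Laurent]_q := gen_vec Laurent (idx e).

(** The signs are chosen so that at t = 1 every relation becomes [next_edge e] minus e. For a loop
    without crossings this difference is 0, as is the relation. *)
Definition link_rel (e : edge D) : 'rV[Laurent]_q :=
  if across e == e then 0 else
  match role e with
  | Under => if from_left e then t *: vec (next_edge e) - (vec e + (t - 1) *: vec (across e))
             else vec (next_edge e) + (t - 1) *: vec (across e) - t *: vec e
  | _ => vec (next_edge e) - vec e
  end.
Definition link_mx : 'M[Laurent]_(q.+1, q) := \matrix_i link_rel (unidx i).

Let e0 := unidx ord0.

(** That the kernel is no larger than the span of the relations comes from the universal property:
    applied to L^q modulo these relations, it gives a map back that sends pi x to the class of x. *)
Lemma link_presentation : exists pi : {linear 'rV_q -> link_module D}, coker_map link_mx pi.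
Proof.
pose pi : {linear 'rV[Laurent]_q -> link_module D} :=
  lincomb (fun j => link_gen e0 (unidx (lift ord0 j))).
have piV e : pi (vec e) = link_gen e0 e.
  rewrite /vec; case: (unliftP ord0 (idx e)) => [j|] ie; rewrite ie.
    by rewrite gen_vec_lift /= lincomb_delta -ie idxK.
  by rewrite gen_vec0 raddf0 -[e]idxK ie link_gen_base.
have genF := link_family_gen e0.
have pi_rel e : pi (link_rel e) = 0.
  rewrite /link_rel; case: eqP => [_|/eqP ne]; first by rewrite raddf0.
  have := genF e ne; case: (role e); [|case: (from_left e)|];
    by rewrite ?(linearB, linearD, linearZ) /= !piV ?scalerN -?opprD => ->; rewrite subrr.
exists pi; split=> [m|x].
  have [u ->] := link_gen_generates e0 m.
  elim: u => [|[e [] u [x IH]]] /=; first by exists 0; rewrite raddf0.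
    by exists (vec e + t *: x); rewrite linearD linearZ /= piV IH.
  by exists (t^-1 *: (x - vec e)); rewrite linearZ linearB /= piV IH.
split=> [x0|[a ->]]; last first.
  rewrite mulmx_sum_row linear_sum big1 // => i _.
  by rewrite linearZ /= rowK pi_rel scaler0.
pose pL : {linear _ -> _} := quot_proj [set y | exists i, y = row i link_mx].
have p_rel e : pL (link_rel e) = 0.
  by apply: quot_proj_mem; exists (idx e); rewrite rowK idxK.
have nF : link_family (fun e => pL (vec e)).
  move=> e ne; have := p_rel e; rewrite /link_rel (negbTE ne).
  case: (role e); [|case: (from_left e)|];
    by rewrite ?(linearB, linearD, linearZ_LR) ?scalerN -?opprD => /eqP; rewrite subr_eq0 => /eqP.
have [|f fE] := link_module_universal nF (_ : pL (vec e0) = 0).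
  by rewrite /vec /e0 unidxK gen_vec0 raddf0.
have fpi : f (pi x) = pL x.
  apply: (linear_row_eq (f := f \o pi : {linear _ -> _}) (g := pL)) => j /=.
  by rewrite -gen_vec_lift -[lift _ _]unidxK piV fE.
by apply/span_rows/quot_proj0; rewrite -[LHS]fpi x0 raddf0.
Qed.

Lemma link_mx_ev1 : map_mx laurent_ev1 link_mx = orbit_mx (fun i => idx (next_edge (unidx i))).
Proof.
have ev1_vec e : map_mx laurent_ev1 (vec e) = gen_vec int (idx e).
  rewrite /vec /gen_vec; case: (unlift _ _) => [j|]; last exact: map_mx0.
  by rewrite map_delta_mx.
apply/row_matrixP => i; rewrite -map_row !rowK /link_rel.
have ev1_t : laurent_ev1 (t - 1) = 0 by rewrite rmorphB rmorph1 /= laurent_ev1_t subrr.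
case: eqP => [/across_fixed ->|_]; first by rewrite map_mx0 unidxK subrr.
case: (role _); [|case: (from_left _)|];
  by rewrite ?(map_mxB, map_mxD, map_mxZ) /= ?ev1_t ?laurent_ev1_t ?scale1r ?scale0r ?addr0 !ev1_vec unidxK.
Qed.
End LinkPresentation.

Lemma link_module_coker r (D : vdiagram r.+1) :
  exists q (A : 'M[Laurent]_(q.+1, q)) (pi : {linear 'rV_q -> link_module D}),
    coker_map A pi /\ zcoker r (map_mx laurent_ev1 A).
Proof.
have cardD : #|edge D|.-1.+1 = #|edge D|.
  apply: prednK; have : (0 < fcard (@next_edge _ D) predT)%N by rewrite number_of_loops.
  by move=> /card_gt0P[e _]; apply/card_gt0P; exists e.
have [pi piP] := link_presentation (esym cardD).
exists _, (link_mx (esym cardD)), pi; split=> //; rewrite link_mx_ev1.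
set idx := cast_ord _; set e0 := enum_val (cast_ord (esym (esym cardD)) ord0).
have [F [s [sK F0 Ff Fc]]] := fcard_label e0 (@next_inj _ D) (number_of_loops D).
pose un i := enum_val (cast_ord (esym (esym cardD)) i) : edge D.
have unK e : un (idx (enum_rank e)) = e by rewrite /un cast_ordK enum_rankK.
have idK i : idx (enum_rank (un i)) = i by rewrite /un enum_valK; apply/val_inj.
apply: (@zcoker_orbit_mx _ _ _ (fun i => F (un i)) (fun k => idx (enum_rank (s k)))) => //.
- by move=> k; rewrite unK sK.
- by move=> i; rewrite unK Ff.
move=> i j /Fc /iter_findex; move: (findex _ _ _) => k kE.
rewrite -[j]idK -kE -{1}[i]idK; move: (un i) => e {kE}.
elim: k => [|k IH]; first exact: connect0.
apply: connect_trans IH _; apply: fconnect1_eq => /=.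
by rewrite -/(un _) unK.
Qed.

(** * Labelled torus diagrams *)

(* A pass is the part of a strand that starts at position 0, crosses all other strands on
   its way to position w'.+2 and is then crossed back to position 0; since w'.+3 = r in
   Z/m, the pass p is followed by the pass p + r. *)
Section LabelledTorus.
Variables (m' r0 : nat).
Hypothesis r_dvd_m : (r0.+1 %| m'.+2)%N.
Local Notation B := 'I_m'.+2.
Local Notation w' := (m' + r0)%N.
Local Notation W := 'I_w'.+2.
Local Notation w := w'.+2.
Local Notation rB := ((r0.+1)%:R : B).
Local Notation edge := (tedge m' w').

(** Write m for m'+2 and r for r0+1. The width w = m + r - 1 gives each half of a pass at least m
    crossings, enough for one with every pass, and makes the closed braid shift passes by r. *)
Lemma width_mod : (w%:R : B) + 1 = rB.
Proof.
rewrite natr1; have -> : w.+1 = (m'.+2 + r0.+1)%N by lia.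
rewrite natrD; have -> : (m'.+2)%:R = 0 :> B.
  by apply/val_inj; rewrite Zp_nat /= modnn.
by rewrite add0r.
Qed.

(** On the way back the block is counted from the end: the next pass starts in block p + r, and the
    crossing with index i is met i + 1 blocks earlier. *)
Definition pass_edge (p : B) (k : nat) : edge :=
  if (k < w)%N then (p, inord k, true)
  else (p + rB - 1 - (2 * w - k.+1)%:R, inord (2 * w - k.+1), false).
Definition edge_pass (e : edge) : B :=
  let: (b, i, s) := e in if s then b else b + (val i)%:R + 1 - rB.
Definition edge_pos (e : edge) : nat :=
  let: (b, i, s) := e in if s then val i else (2 * w - i.+1)%N.

Lemma edge_pos_lt e : (edge_pos e < 2 * w)%N.
Proof. by case: e => [[b [i lt]] []] /=; lia. Qed.

Lemma pass_edgeK e : pass_edge (edge_pass e) (edge_pos e) = e.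
Proof.
case: e => [[b [i lt]] []]; rewrite /pass_edge /=.
  by rewrite lt; congr (_, _, _); apply/val_inj; rewrite /= inordK.
case: ifP => [|_]; first by lia.
have -> : (2 * w - (2 * w - i.+1).+1)%N = i by lia.
congr (_, _, _); first by ring.
by apply/val_inj; rewrite /= inordK.
Qed.

Lemma edge_pass_edge p k : (k < 2 * w)%N ->
  edge_pass (pass_edge p k) = p /\ edge_pos (pass_edge p k) = k.
Proof.
move=> k2; rewrite /pass_edge; case: ltnP => kw; rewrite /= inordK //; last 1 first.
- lia.
split; last by lia.
ring.
Qed.

Lemma tnext_pass p k : (k < 2 * w)%N ->
  tnext (pass_edge p k) = if k.+1 == (2 * w)%N then pass_edge (p + rB) 0 else pass_edge p k.+1.
Proof.
move=> k2; rewrite /pass_edge; case: ltnP => kw /=.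
  rewrite -val_eqE /= inordK // ltnS.
  have -> : (k.+1 == 2 * w)%N = false by lia.
  case: (ltngtP k w.-1) => [lt|gt|->]; [|lia|].
  - by [].
  - have -> : (2 * w - w.-1.+2)%N = w'.+1 by lia.
    congr (_, _, _); rewrite -width_mod -(natr1 w'.+1); ring.
rewrite -val_eqE /= inordK; last by lia.
case: (eqVneq k.+1 (2 * w)%N) => [e|ne].
  have -> : (2 * w - k.+1)%N = 0%N by lia.
  rewrite eqxx subr0; congr (_, _, _); first by rewrite -addrA addNr addr0.
  by apply/val_inj; rewrite /= inordK.
have -> : ((2 * w - k.+1)%N == 0%N) = false by lia.
have -> : (k.+1 < w)%N = false by lia.
have -> : (2 * w - k.+2)%N = (2 * w - k.+1).-1 by lia.
congr (_, _, _).
have -> : (2 * w - k.+1)%N = ((2 * w - k.+1).-1).+1 by lia.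
rewrite -natr1 /=; ring.
Qed.

Definition residue (b : B) : 'I_r0.+1 := inord (b %% r0.+1).

Lemma residueD b k : residue (b + k%:R) = inord ((b + k) %% r0.+1) :> 'I_r0.+1.
Proof. by congr inord; rewrite Zp_nat /= modnDmr modn_dvdm. Qed.

Definition edge_loop (e : edge) : 'I_r0.+1 := residue (edge_pass e).

Lemma residue_shift b : residue (b + rB) = residue b.
Proof. by rewrite residueD modnDr. Qed.

Let pos0 : (0 < 2 * w)%N. Proof. by []. Qed.

Lemma torus_loops : fcard (@tnext m' w') predT = r0.+1.
Proof.
have nP e : exists k, [/\ (k < 2 * w)%N, e = pass_edge (edge_pass e) k & edge_pos e = k].
  by exists (edge_pos e); rewrite edge_pos_lt pass_edgeK.
rewrite -[RHS]card_ord.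
apply: (@n_comp_label _ _ _ edge_loop (fun c => pass_edge ((val c)%:R) 0)) => [c|e _ /eqP <-|].
- rewrite /edge_loop (edge_pass_edge _ pos0).1 -[_%:R]add0r residueD add0n modn_small ?inord_val //; exact: ltn_ord.
- have [k [k2 -> _]] := nP e; rewrite /edge_loop tnext_pass // (edge_pass_edge _ k2).1.
  case: eqP => [_|ne]; first by rewrite (edge_pass_edge _ pos0).1 residue_shift.
  by rewrite (edge_pass_edge _ _).1 //; lia.
have start p k : (k < 2 * w)%N -> fconnect (@tnext m' w') (pass_edge p 0) (pass_edge p k).
  elim: k => [|k IH] k2; first exact: connect0.
  apply: connect_trans (IH (ltnW k2)) _; apply: fconnect1_eq; rewrite tnext_pass ?(ltnW k2) //.
  by rewrite ltn_eqF.
have shift p : fconnect (@tnext m' w') (pass_edge p 0) (pass_edge (p + rB) 0).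
  apply: connect_trans (start p (2 * w).-1 _) _; first by lia.
  by apply: fconnect1_eq; rewrite tnext_pass ?prednK ?eqxx //; lia.
have shifts p k : fconnect (@tnext m' w') (pass_edge p 0) (pass_edge (p + (k * r0.+1)%:R) 0).
  elim: k => [|k IH]; first by rewrite mul0n addr0; exact: connect0.
  by apply: connect_trans IH _; rewrite mulSn [(r0.+1 + _)%N]addnC natrD addrA; exact: shift.
move=> e e' ee'; have [k [k2 -> _]] := nP e; have [k' [k2' -> _]] := nP e'.
have symf := fconnect_sym (@tnext_inj m' w').
apply: connect_trans (_ : connect _ _ (pass_edge (edge_pass e) 0)) _.
  by rewrite symf; apply: start.
apply: connect_trans (start _ _ k2').
move: ee'; rewrite /edge_loop; move: (edge_pass e) (edge_pass e') => p p' pp'.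
have : (val (p' - p)%R %% r0.+1 = 0)%N.
  have : residue p = residue (p + (val (p' - p))%:R) by rewrite natr_Zp addrC subrK.
  rewrite residueD; move: (val _) => a /(congr1 val).
  rewrite /residue /= !inordK ?ltn_mod // => /eqP; rewrite eq_sym -{2}[val p]addn0 eqn_modDl mod0n.
  by move/eqP.
move=> /eqP/dvdnP[a aE].
have -> : p' = p + (a * r0.+1)%:R by rewrite -aE natr_Zp addrC subrK.
exact: shifts.
Qed.

(* Each pass has at most one crossing where it is the under-strand: a label (c, s) of the
   pass p puts it under the pass c, on the first half of p if s and on the second otherwise. *)
Variable lab : B -> option (B * bool).
Hypothesis lab_target : forall p c s, lab p = Some (c, s) -> lab c = None.

(** At (b, i) the pass b on its way out meets the pass q on its way back. While i runs through m
    consecutive values, q takes every value once; further crossings are virtual, so every ordered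
    pair of passes has exactly one candidate crossing. *)
Definition long_role (b : B) (i : W) : strand_role :=
  let q := b + (val i)%:R + 1 - rB in
  if (i < m'.+2)%N then
    if lab q == Some (b, false) then Over else if lab b == Some (q, true) then Under else Virtual
  else Virtual.
Definition torus_role (e : edge) : strand_role :=
  let: (b, i, s) := e in if s then long_role b i else opposite_role (long_role b i).

(** The solution i of p + i + 1 - r = c: where p, going out, meets c coming back. *)
Definition cross_pos (p c : B) : nat := val (c - p + rB - 1).
Arguments cross_pos : simpl never.

Lemma cross_pos_lt p c : (cross_pos p c < m'.+2)%N.
Proof. exact: ltn_ord. Qed.
Lemma cross_pos_val p c : (cross_pos p c)%:R = c - p + rB - 1 :> B.
Proof. exact: natr_Zp. Qed.
Lemma cross_posP p c k : (k < m'.+2)%N -> k%:R = c - p + rB - 1 :> B -> k = cross_pos p c.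
Proof. by move=> km kE; rewrite /cross_pos -kE Zp_nat /= modn_small. Qed.

(** The index in the pass p of the edge that ends at its under-crossing; for an unlabelled pass it
    is 2w, one past the last index, so it is never reached. *)
Definition under_pos (p : B) : nat :=
  match lab p with
  | None => 2 * w
  | Some (c, true) => cross_pos p c
  | Some (c, false) => 2 * w - (cross_pos c p).+1
  end.

Lemma torus_role_across e : tacross e != e -> torus_role (tacross e) = opposite_role (torus_role e).
Proof. by case: e => [[b i] []] _ //=; case: long_role. Qed.

Definition torus_diagram : vdiagram r0.+1 :=
  @VDiagram r0.+1 edge (@tnext m' w') (@tacross m' w') (@tleft m' w') torus_role
    (@tnext_inj m' w') (@tacrossK m' w')
    (fun e ae => False_ind _ (negP (tacross_neq e) (introT eqP ae)))
    (fun e _ => let: (b, i, s) := e in erefl) torus_role_across torus_loops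
    (@torus_planar m' w').

Lemma long_roleP b i : (i < m'.+2)%N -> long_role b (inord i) =
  let q := b + i%:R + 1 - rB in
  if lab q == Some (b, false) then Over else if lab b == Some (q, true) then Under else Virtual.
Proof. by move=> im; rewrite /long_role /= inordK ?im //; lia. Qed.

Lemma long_role_out b i : (m'.+2 <= i < w)%N -> long_role b (inord i) = Virtual.
Proof. by move=> /andP[mi iw]; rewrite /long_role /= inordK // ltnNge mi. Qed.

Lemma under_posP p k : (k < 2 * w)%N -> torus_role (pass_edge p k) = Under <-> k = under_pos p.
Proof.
move=> k2; have lt := cross_pos_lt.
rewrite /pass_edge /under_pos; case: ltnP => kw.
  rewrite [torus_role _]/=; have [km|mk] := ltnP k m'.+2; last first.
    rewrite long_role_out ?mk //; split=> // e.
    by move: e; case: (lab p) => [[c []]|]; [have := lt p c|have := lt c p|]; lia.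
  rewrite long_roleP //=; move lE: (lab p) => o; case: o lE => [[c s]|] lE; last first.
    by split=> [|e]; [case: eqP|lia].
  have lc := lab_target lE; case: s lE => lE.
    split=> [|kE]; last first.
      have -> : p + k%:R + 1 - rB = c by rewrite kE cross_pos_val; ring.
      by rewrite lc eqxx.
    case: eqP => // _; case: eqP => // -[cE] _; apply: cross_posP => //.
    by rewrite cE; ring.
  split=> [|e]; last by have := lt c p; lia.
  by case: eqP => // _; case: eqP.
rewrite [torus_role _]/=; set i := (2 * w - k.+1)%N.
have iw : (i < w)%N by rewrite /i; lia.
have [im|mi] := ltnP i m'.+2; last first.
  rewrite long_role_out ?mi //; split=> // e.
  by move: e mi; rewrite /i; case: (lab p) => [[c []]|]; [have := lt p c|have := lt c p|]; lia.
rewrite long_roleP //=; have -> : p + rB - 1 - i%:R + i%:R + 1 - rB = p by ring.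
move lE: (lab p) => o; case: o lE => [[c s]|] lE; last first.
  by split=> [|e]; [case: eqP => // _; case: eqP|lia].
have lc := lab_target lE; case: s lE => lE.
  split=> [|e]; last by have := lt p c; lia.
  by case: eqP => // _; case: eqP.
split=> [|kE]; last first.
  have iE : i = cross_pos c p by have := lt c p; rewrite /i; lia.
  have -> : p + rB - 1 - i%:R = c by rewrite iE cross_pos_val; ring.
  by rewrite eqxx.
case: eqP => [[cE]|_]; last by case: eqP.
by move=> _; rewrite -(@cross_posP c p i) //; [rewrite /i; lia|rewrite cE; ring].
Qed.

Lemma under_pos_across p c s : lab p = Some (c, s) -> [/\ (under_pos p < 2 * w)%N,
  tleft (pass_edge p (under_pos p)) = ~~ s &
  edge_pass (tacross (pass_edge p (under_pos p))) = c].
Proof.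
rewrite /under_pos => ->; case: s.
  have := cross_pos_lt p c; move: (cross_pos_val p c); move: (cross_pos p c) => x xE xm.
  have xw : (x < w)%N by lia.
  split; [by lia|by rewrite /pass_edge xw|rewrite /pass_edge xw /= inordK //].
  by rewrite xE; ring.
have := cross_pos_lt c p; move: (cross_pos_val c p); move: (cross_pos c p) => x xE xm.
have xw : (x < w)%N by lia.
have e : (2 * w - x.+1 < w)%N = false by lia.
split; [by lia|by rewrite /pass_edge e|rewrite /pass_edge e /=].
have -> : (2 * w - (2 * w - x.+1).+1)%N = x by lia.
by rewrite xE; ring.
Qed.

Section Values.
Variable N : lmodType Laurent.
Local Notation t := laurent_t.

Definition pass_op (s : bool) (x c : N) : N :=
  if s then t *: x + (1 - t) *: c else t^-1 *: x + (1 - t^-1) *: c.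

Definition pass_family (x : B -> N) : Prop := forall p,
  x (p + rB) = if lab p is Some (c, s) then pass_op s (x p) (x c) else x p.

Definition pass_value (x : B -> N) (e : edge) : N :=
  if (under_pos (edge_pass e) < edge_pos e)%N then x (edge_pass e + rB) else x (edge_pass e).

Lemma pass_value_next x p k : pass_family x -> (k < 2 * w)%N ->
  (k = under_pos p -> pass_value x (pass_edge p k) = x p /\
     pass_value x (tnext (pass_edge p k)) = x (p + rB)) /\
  (k <> under_pos p -> pass_value x (tnext (pass_edge p k)) = pass_value x (pass_edge p k)).
Proof.
move=> xF k2.
have vE q j : (j < 2 * w)%N -> pass_value x (pass_edge q j) =
    if (under_pos q < j)%N then x (q + rB) else x q.
  by move=> j2; rewrite /pass_value (edge_pass_edge _ j2).1 (edge_pass_edge _ j2).2.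
have nE : pass_value x (tnext (pass_edge p k)) =
    if (under_pos p < k.+1)%N then x (p + rB) else x p.
  rewrite tnext_pass //; case: eqP => [ke|ne]; last by rewrite vE //; lia.
  rewrite vE // ltn0 ke; case: ltnP => // le; rewrite xF; move: le.
  case lE: (lab p) => [[c s]|] //; have [lt _ _] := under_pos_across lE; lia.
rewrite nE vE //; split=> [->|ne]; first by rewrite ltnn leqnn.
by case: (ltngtP k (under_pos p)) ne => // lt _; rewrite ltnS; case: ltnP => //; lia.
Qed.

Lemma pass_value_family x : pass_family x -> link_family (D := torus_diagram) (pass_value x).
Proof.
move=> xF e _ /=; have k2 := edge_pos_lt e.
have := pass_value_next (edge_pass e) xF k2.
have := under_posP (edge_pass e) k2; rewrite pass_edgeK => up [vU vN].
case re: (torus_role e); [by apply: vN => /up; rewrite re| |by apply: vN => /up; rewrite re].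
have {}up := up.1 re; have [-> ->] := vU up.
case lE: (lab (edge_pass e)) => [[c s]|]; last first.
  by have := edge_pos_lt e; rewrite up /under_pos lE ltnn.
have [_] := under_pos_across lE; rewrite -up pass_edgeK => -> ac.
(* The over-strand c is unlabelled, hence keeps one value along its whole pass. *)
have -> : pass_value x (tacross e) = x c.
  rewrite /pass_value ac {1}/under_pos (lab_target lE) ltnNge ltnW //.
  exact: edge_pos_lt.
rewrite xF lE; case: s {lE} => /=.
  by rewrite -addrA -scalerDl addrA subrK subrr scale0r addr0.
rewrite scalerDr t_scaleK scalerA; congr (_ + _ *: _).
by rewrite mulrBr mulr1 mulrV // laurent_t_unit.
Qed.

(** Conversely to [pass_value_family]: away from the under-crossing of a pass the value is carried
    along, so a family is determined by its values at the starts of the passes. *)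
Lemma link_family_values n : link_family (D := torus_diagram) n ->
  pass_family (fun p => n (pass_edge p 0) : N) /\
  forall e, n e = pass_value (fun p => n (pass_edge p 0)) e.
Proof.
move=> nF; pose y p : N := n (pass_edge p 0).
have step p k : (k < 2 * w)%N -> k <> under_pos p -> n (tnext (pass_edge p k)) = n (pass_edge p k).
  move=> k2 ku; have := nF (pass_edge p k) (tacross_neq _) => /=.
  by case re: (torus_role _) => // _; case: ku; apply/(under_posP p k2).
have before p k : (k < 2 * w)%N -> (k <= under_pos p)%N -> n (pass_edge p k) = y p.
  elim: k => [|k IH] k2 ku //; rewrite -IH ?(ltnW k2) ?(ltnW ku) //.
  have kn : k <> under_pos p by lia.
  rewrite -(step p k (ltnW k2) kn).
  by rewrite tnext_pass ?(ltnW k2) // ltn_eqF.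
have after p k : (k < 2 * w)%N -> (under_pos p <= k)%N -> n (tnext (pass_edge p k)) = y (p + rB).
  (* Induction on the number j of edges left: the last edge is followed by the start of pass p +
     r. *)
  move=> k2; move e: (2 * w - k.+1)%N => j; elim: j k k2 e => [|j IH] k k2 e ku.
    by rewrite tnext_pass // ifT //; apply/eqP; lia.
  rewrite -(IH k.+1); try lia.
  rewrite tnext_pass // ltn_eqF; last by lia.
  by rewrite step //; lia.
split=> [p|e].
  rewrite -/(y _) -/(y _); case lE: (lab p) => [[c s]|]; last first.
    have uE : under_pos p = (2 * w)%N by rewrite /under_pos lE.
    have k2 : ((2 * w).-1 < 2 * w)%N by lia.
    rewrite -(before p (2 * w).-1 k2) ?uE ?leq_pred //.
    have ku : (2 * w).-1 <> under_pos p by rewrite uE; lia.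
    by rewrite -(step p _ k2 ku) tnext_pass // ifT.
  have [u2 tl ac] := under_pos_across lE.
  have := nF (pass_edge p (under_pos p)) (tacross_neq _) => /=.
  have -> : torus_role (pass_edge p (under_pos p)) = Under by apply/(under_posP _ u2).
  rewrite tl after // before //.
  have -> : n (tacross (pass_edge p (under_pos p))) = y c.
    rewrite -[tacross _]pass_edgeK ac before //; first exact: edge_pos_lt.
    by rewrite /under_pos (lab_target lE) ltnW // edge_pos_lt.
  case: s {lE tl} => /=.
    by move=> ->; rewrite -addrA -scalerDl addrA subrK subrr scale0r addr0.
  move=> e; apply: (t_scale_inj (M := N)); rewrite e /y scalerDr t_scaleK scalerA; congr (_ + _ *: _).
  by rewrite mulrBr mulr1 mulrV // laurent_t_unit.
rewrite -[in LHS](pass_edgeK e) /pass_value -/(y _) -/(y _).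
move: (edge_pass e) (edge_pos e) (edge_pos_lt e) => p k k2.
case: ltnP => uk; last exact: before.
have k0 : (0 < k)%N by lia.
rewrite -(after p k.-1); [|lia|lia].
by rewrite tnext_pass; [rewrite prednK // ltn_eqF|lia].
Qed.
End Values.
End LabelledTorus.

(** * Realisation of presentations by diagrams *)

Lemma coker_factor p q (A : 'M[Laurent]_(p, q)) (M N : lmodType Laurent)
    (pi : {linear 'rV_q -> M}) (h : {linear 'rV_q -> N}) :
  coker_map A pi -> (forall i, h (row i A) = 0) ->
  exists g : {linear M -> N}, forall x, g (pi x) = h x.
Proof.
move=> [pi_surj pi_ker] hA.
have h0 x : pi x = 0 -> h x = 0.
  move=> /pi_ker[a ->]; rewrite mulmx_sum_row linear_sum big1 // => i _.
  by rewrite linearZ /= hA scaler0.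
pose g m := h (sval (cid (pi_surj m))).
have gE x : g (pi x) = h x.
  rewrite /g; case: cid => y /= yx; apply/eqP; rewrite -subr_eq0 -linearB; apply/eqP/h0.
  by rewrite linearB /= yx subrr.
have gL : linear g.
  move=> a m m'; have [x <-] := pi_surj m; have [y <-] := pi_surj m'.
  by rewrite -linearP !gE linearP.
pose gl : {linear M -> N} := HB.pack g (GRing.isLinear.Build _ _ _ _ g gL).
by exists gl.
Qed.

Section Words.
Variables (q : nat).
Local Notation t := laurent_t.
Local Notation letter := ('I_q.+1 * bool)%type.

Definition word_act (N : lmodType Laurent) (Y : 'I_q.+1 -> N) (W : seq letter) (x : N) : N :=
  foldl (fun x a => pass_op a.2 x (Y a.1)) x W.

Lemma word_act_cat (N : lmodType Laurent) (Y : 'I_q.+1 -> N) W W' x :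
  word_act Y (W ++ W') x = word_act Y W' (word_act Y W x).
Proof. exact: foldl_cat. Qed.

(** One word has to serve all modules: it is used in M and in the module of the diagram built from
    that same word. *)
Definition word_realizes (c : 'rV[Laurent]_q) := exists W, forall (N : lmodType Laurent) (Y : 'I_q.+1 -> N),
  Y ord0 = 0 -> forall x, word_act Y W x = x + (1 - t) *: lincomb (fun j => Y (lift ord0 j)) c.

Lemma word_realizesD c d : word_realizes c -> word_realizes d -> word_realizes (c + d).
Proof.
move=> [W WE] [W' WE']; exists (W ++ W') => N Y Y0 x.
by rewrite word_act_cat WE' // WE // linearD scalerDr addrA.
Qed.

Lemma word_realizes_all c : word_realizes c.
Proof.
rewrite [c]row_sum_delta.
apply: (big_ind word_realizes) => [|c1 c2|j _]; [|exact: word_realizesD|].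
  by exists [::] => N Y Y0 x; rewrite linear0 scaler0 addr0.
pose d : 'rV[Laurent]_q := delta_mx 0 j.
(* Both signs are treated together because [laurent_ind] builds coefficients by subtraction. *)
suff : word_realizes (c 0 j *: d) /\ word_realizes (- (c 0 j) *: d) by case.
elim/laurent_ind: (c 0 j) => {c} [|a b [Pa Na] [Pb Nb]|a [Pa Na]|a [Pa Na]].
- rewrite scaleN1r scale1r; split.
    exists [:: (ord0, false); (lift ord0 j, true)] => N Y Y0 x /=.
    by rewrite /pass_op Y0 scaler0 addr0 t_scaleK lincomb_delta.
  exists [:: (lift ord0 j, false); (ord0, true)] => N Y Y0 x /=.
  rewrite /pass_op Y0 scaler0 addr0 linearN /= lincomb_delta scalerDr t_scaleK scalerA.
  by rewrite scalerN -scaleNr opprB mulrBr mulr1 mulrV // laurent_t_unit.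
- rewrite opprB !scalerBl -!scaleNr; split; exact: word_realizesD.
(* Passing under the value 0 multiplies by t or 1/t; conjugating a word by two such letters
   multiplies its increment by a power of t and leaves x alone. *)
- have tw b : word_realizes (b *: d) -> word_realizes ((t * b) *: d).
    move=> [W WE]; exists ((ord0, false) :: W ++ [:: (ord0, true)]) => N Y Y0 x /=.
    rewrite word_act_cat WE //= /pass_op Y0 !scaler0 !addr0 scalerDr t_scaleK.
    by rewrite !linearZ /= !scalerA; congr (_ + _ *: _); ring.
  by rewrite -mulrN; split; apply: tw.
have tw b : word_realizes (b *: d) -> word_realizes ((t^-1 * b) *: d).
  move=> [W WE]; exists ((ord0, true) :: W ++ [:: (ord0, false)]) => N Y Y0 x /=.
  rewrite word_act_cat WE //= /pass_op Y0 !scaler0 !addr0 scalerDr t_scaleVK.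
  by rewrite !linearZ /= !scalerA; congr (_ + _ *: _); ring.
by rewrite -mulrN; split; apply: tw.
Qed.
End Words.

Lemma linear_pass_op (M N : lmodType Laurent) (f : {linear M -> N}) s x c :
  f (pass_op s x c) = pass_op s (f x) (f c).
Proof. by case: s; rewrite /pass_op linearD !linearZ. Qed.

Lemma linear_word_act q (M N : lmodType Laurent) (f : {linear M -> N}) (Y : 'I_q.+1 -> M) W x :
  f (word_act Y W x) = word_act (fun v => f (Y v)) W (f x).
Proof. by elim: W x => //= a W IH x; rewrite IH linear_pass_op. Qed.

(** * Words of crossings laid out along the passes *)

Section Layout.
Variables (r0 l0 q L0 : nat).
Hypothesis qE : q.+1 = (r0.+1 * l0.+1)%N.
Local Notation r := r0.+1.
Local Notation L := L0.+2.
Local Notation m' := (r * l0.+1 * L - 2)%N.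
Local Notation B := 'I_m'.+2.
Local Notation V := 'I_q.+1.
Variable W : V -> seq (V * bool).
Hypothesis W_size : forall v, (size (W v) <= L0)%N.

Definition shift_vertex (v : V) : V := inord ((v + r) %% q.+1).
(** The passes p, p + r, p + 2r, ... of a loop are cut into runs of length L, one per vertex; v = c
    + r k owns c + r (k L + l) for l < L. Adding r raises the level l and, after the last level,
    leads to level 0 of the vertex v + r. Taking L = L0 + 2 leaves room for every word after the
    free level 0 and ensures at least two passes, as the type of passes demands. *)
Definition block_nat (v l : nat) : nat := (v %% r + r * (v %/ r * L + l))%N.
Definition block_pass (v : V) (l : nat) : B := inord (block_nat v l).
Definition pass_vertex (b : B) : V := inord (b %% r + r * (b %/ r %/ L)).
Definition pass_level (b : B) : nat := ((b %/ r) %% L)%N.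

Lemma passes_card : (m'.+2 = r * l0.+1 * L)%N.
Proof. by rewrite -addn2 subnK //; have := leq_pmull 2 (isT : 0 < r * l0.+1)%N; nia. Qed.

Lemma block_nat_lt v l : (v < q.+1)%N -> (l < L)%N -> (block_nat v l < m'.+2)%N.
Proof.
rewrite passes_card qE /block_nat => vq lL.
have vr : (v %% r < r)%N by rewrite ltn_mod.
have vl : (v %/ r < l0.+1)%N by rewrite ltn_divLR // mulnC.
have : (v %/ r * L + l < l0.+1 * L)%N by nia.
move: (_ * L + l)%N => u ul; have : (r * u + r <= r * (l0.+1 * L))%N by rewrite -mulnSr leq_mul2l ul orbT.
by rewrite mulnA; lia.
Qed.

Lemma block_passK v l : (l < L)%N ->
  pass_vertex (block_pass v l) = v /\ pass_level (block_pass v l) = l.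
Proof.
move=> lL; rewrite /pass_vertex /pass_level /block_pass inordK ?block_nat_lt //.
have e : (block_nat v l %/ r = v %/ r * L + l)%N.
  by rewrite /block_nat addnC mulnC divnMDl // (divn_small (ltn_pmod _ _)) // addn0.
have e' : (block_nat v l %% r = v %% r)%N by rewrite /block_nat addnC mulnC modnMDl modn_mod.
rewrite e e'; split; last by rewrite modnMDl modn_small.
rewrite divnMDl // (divn_small lL) addn0 addnC mulnC -divn_eq.
exact: inord_val.
Qed.

Lemma pass_blockK b : block_pass (pass_vertex b) (pass_level b) = b.
Proof.
apply/val_inj; rewrite /= /block_pass /pass_vertex /pass_level.
have lb : (b %% r + r * (b %/ r %/ L) < q.+1)%N.
  have := ltn_ord b; rewrite {2}passes_card qE => bm.
  have br : (b %% r < r)%N by rewrite ltn_mod.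
  have : (b %/ r %/ L < l0.+1)%N by rewrite -divnMA ltn_divLR // mulnA [(l0.+1 * _)%N]mulnC.
  nia.
rewrite [in X in block_nat X _](@inordK q) //.
have e : block_nat (b %% r + r * (b %/ r %/ L)) (b %/ r %% L) = b.
  have a1 : ((b %% r + r * (b %/ r %/ L)) %% r = b %% r)%N.
    by rewrite addnC mulnC modnMDl modn_mod.
  have a2 : ((b %% r + r * (b %/ r %/ L)) %/ r = b %/ r %/ L)%N.
    by rewrite addnC mulnC divnMDl // (divn_small (ltn_pmod _ _)) // addn0.
  by rewrite /block_nat a1 a2 -divn_eq addnC mulnC -divn_eq.
by rewrite e inord_val.
Qed.

Lemma block_pass_next v l : (l < L)%N -> block_pass v l + (r%:R : B) =
  if l.+1 == L then block_pass (shift_vertex v) 0 else block_pass v l.+1.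
Proof.
move=> lL; apply/val_inj.
have -> : val (block_pass v l + r%:R) = ((block_nat v l + r) %% m'.+2)%N.
  by rewrite Zp_nat /= modnDmr inordK // block_nat_lt.
have bS : (block_nat v l + r = block_nat v l.+1)%N by rewrite /block_nat; nia.
case: (eqVneq l.+1 L) => [lE|ne]; last first.
  have lL' : (l.+1 < L)%N by rewrite ltn_neqAle ne.
  by rewrite bS modn_small ?block_nat_lt //= inordK // block_nat_lt.
have sv : shift_vertex v = ((v + r) %% q.+1)%N :> nat by rewrite /shift_vertex inordK ?ltn_mod.
rewrite /= /block_pass inordK ?block_nat_lt // sv.
have e : (block_nat v l + r = block_nat (v + r) 0)%N.
  by rewrite bS lE /block_nat modnDr divnDr // divnn /=; nia.
rewrite e; have vq := ltn_ord v.
have [lt|ge] := ltnP (v + r) q.+1; first by rewrite !modn_small // block_nat_lt.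
have -> : ((v + r) %% q.+1 = v + r - q.+1)%N.
  rewrite -{1}(subnK ge) modnDr modn_small //.
  have : (r <= q.+1)%N by rewrite qE leq_pmulr.
  lia.
set u := (v + r - q.+1)%N; have uE : (v + r = u + r * l0.+1)%N by rewrite -qE subnK.
rewrite uE; have -> : block_nat (u + r * l0.+1) 0 = (block_nat u 0 + m'.+2)%N.
  have a1 : ((u + r * l0.+1) %% r = u %% r)%N by rewrite addnC mulnC modnMDl.
  have a2 : ((u + r * l0.+1) %/ r = l0.+1 + u %/ r)%N by rewrite addnC mulnC divnMDl.
  by rewrite passes_card /block_nat a1 a2; nia.
rewrite modnDr modn_small // block_nat_lt //.
have : (r <= q.+1)%N by rewrite qE leq_pmulr.
by rewrite /u; lia.
Qed.

(** Level 0 of v stays unlabelled: it carries Y v and is the over-strand for every letter that names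
    v. Level l + 1 carries the letter of index l, so labels only ever point to unlabelled passes. *)
Definition word_label (b : B) : option (B * bool) :=
  if pass_level b is l.+1 then
    omap (fun a : V * bool => (block_pass a.1 0, a.2)) (onth (W (pass_vertex b)) l)
  else None.

Lemma word_label_target p c s : word_label p = Some (c, s) -> word_label c = None.
Proof.
rewrite {1}/word_label; case: (pass_level p) => // l; case: onth => // -[v b] [<- _].
by rewrite /word_label (block_passK v (isT : 0 < L)%N).2.
Qed.

Lemma rank_dvd_passes : (r %| m'.+2)%N.
Proof. by rewrite passes_card -mulnA dvdn_mulr. Qed.

Section Family.
Variable N : lmodType Laurent.
Implicit Types (Y : V -> N) (x : B -> N).

(** The pass of level l + 1 starts after l letters have acted. Level 0 also starts with Y v, which
    the truncated predecessor takes care of. *)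
Definition word_pass Y (b : B) : N :=
  word_act Y (take (pass_level b).-1 (W (pass_vertex b))) (Y (pass_vertex b)).

Lemma word_pass_start Y v : word_pass Y (block_pass v 0) = Y v.
Proof.
have [e1 e2] := block_passK v (isT : 0 < L)%N.
by rewrite /word_pass e1 e2 take0.
Qed.

Lemma word_act_take Y v l (z : N) : word_act Y (take l.+1 (W v)) z =
  if onth (W v) l is Some a then pass_op a.2 (word_act Y (take l (W v)) z) (Y a.1)
  else word_act Y (take l (W v)) z.
Proof.
case: (ltnP l (size (W v))) => lt; last first.
  rewrite !take_oversize ?(leqW lt) //.
  have -> : onth (W v) l = None by apply: onth_default.
  by [].
have a0 : V * bool := (ord0, true).
rewrite onthE (nth_map a0) // (take_nth a0) // -cats1 word_act_cat.
by [].
Qed.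

Lemma word_pass_family Y : (forall v, Y (shift_vertex v) = word_act Y (W v) (Y v)) ->
  pass_family r0 word_label (word_pass Y).
Proof.
move=> YW p; rewrite -[p]pass_blockK.
move: (pass_vertex p) (pass_level p) (ltn_pmod (p %/ r) (isT : 0 < L)%N : (pass_level p < L)%N) => v l lL.
have [e1 e2] := block_passK v lL.
rewrite block_pass_next // /word_label e1 e2.
case: l lL e1 e2 => [|l] lL e1 e2.
  rewrite /= word_pass_start /word_pass.
  by have [-> ->] := block_passK v (isT : 1 < L)%N; rewrite take0.
rewrite {2 4}/word_pass e1 e2 [l.+1.-1]/=; case: eqP => [lE|ne].
  rewrite word_pass_start YW.
  have sl : (size (W v) <= l)%N by apply: leq_trans (W_size v) _; lia.
  have -> : onth (W v) l = None by apply: onth_default.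
  by rewrite take_oversize.
have lL' : (l.+2 < L)%N by lia.
rewrite {1}/word_pass; have [-> ->] := block_passK v lL'.
rewrite [l.+2.-1]/= word_act_take; case: onth => //= a.
by rewrite word_pass_start.
Qed.

Lemma pass_family_words x : pass_family r0 word_label x ->
  let Y v := x (block_pass v 0) in
  (forall b, x b = word_pass Y b) /\ (forall v, Y (shift_vertex v) = word_act Y (W v) (Y v)).
Proof.
move=> xF Y.
have step v l : (l < L0.+1)%N -> x (block_pass v l.+1) = word_act Y (take l (W v)) (Y v).
  elim: l => [|l IH] lL.
    have := xF (block_pass v 0); rewrite block_pass_next // => ->.
    by rewrite /word_label (block_passK v (isT : 0 < L)%N).2 take0.
  have lL' : (l.+1 < L)%N by lia.
  have := xF (block_pass v l.+1); rewrite block_pass_next //.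
  have -> : (l.+2 == L) = false by lia.
  move=> ->; rewrite /word_label; have [-> ->] := block_passK v lL'.
  by rewrite word_act_take IH; [case: onth|lia].
split=> [b|v].
  rewrite -{1}[b]pass_blockK /word_pass.
  have := ltn_pmod (b %/ r) (isT : 0 < L)%N; rewrite -/(pass_level b).
  by case: (pass_level b) => [|l] lL; [rewrite take0|apply: step; lia].
have := xF (block_pass v L0.+1); rewrite block_pass_next // eqxx -/(Y (shift_vertex v)) => ->.
rewrite /word_label; have [-> ->] := block_passK v (ltnSn L0.+1).
have -> : onth (W v) L0 = None by apply: onth_default.
by rewrite step // take_oversize.
Qed.
End Family.
End Layout.

(** In M the words carry Y v to Y of the next vertex, so M receives a map from the link module by
    its universal property. In the link module the starts Z v of the runs obey the same words, hence
    the relations A, which gives a map back. Both composites are the identity on generators. *)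
Lemma torus_realization (r0 l0 q : nat) (A C : 'M[Laurent]_(q.+1, q)) (M : lmodType Laurent)
    (pi : {linear 'rV_q -> M}) :
  q.+1 = (r0.+1 * l0.+1)%N -> coker_map A pi ->
  (forall v, row v A = gen_vec Laurent (shift_vertex r0 v) - gen_vec Laurent v
                       - (1 - laurent_t) *: row v C) ->
  exists D : vdiagram r0.+1, lmod_iso M (link_module D).
Proof.
move=> qE piP AE.
have /choice[W WE] v := word_realizes_all (row v C).
pose L0 := (\sum_v size (W v))%N.
have W_size v : (size (W v) <= L0)%N by rewrite /L0 (bigD1 v) //= leq_addr.
pose lab := word_label (r0 := r0) (l0 := l0) (L0 := L0) W.
have lab_target : forall p c s, lab p = Some (c, s) -> lab c = None by exact: word_label_target.
have dvd := rank_dvd_passes r0 l0 L0.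
pose D := torus_diagram dvd lab.
pose first (v : 'I_q.+1) := pass_edge r0 (block_pass r0 l0 L0 v 0) 0.
pose e0 : edge D := first ord0.
have firstE v : (edge_pass (first v) = block_pass r0 l0 L0 v 0) * (edge_pos (first v) = 0%N).
  by have [-> ->] := edge_pass_edge dvd (block_pass r0 l0 L0 v 0) (isT : 0 < 2 * (r0.+1 * l0.+1 * L0.+2 - 2 + r0).+2)%N.
have value_first (N : lmodType Laurent) (x : _ -> N) v :
    pass_value lab x (first v) = x (block_pass r0 l0 L0 v 0).
  by rewrite /pass_value !firstE ltn0.
have pi_row v : pi (row v A) = 0 by apply/piP.2; exists (delta_mx 0 v); rewrite rowE.
pose Y v : M := pi (gen_vec Laurent v).
have Y0 : Y ord0 = 0 by rewrite /Y gen_vec0 raddf0.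
have lincombY (c : 'rV_q) : lincomb (fun j => Y (lift ord0 j)) c = pi c.
  apply: (linear_row_eq (f := lincomb (fun j => Y (lift ord0 j))) (g := pi)) => j.
  by rewrite /= lincomb_delta /Y gen_vec_lift.
have YE (j : 'I_q) : Y (lift ord0 j) = pi (delta_mx 0 j) by rewrite /Y gen_vec_lift.
have YW v : Y (shift_vertex r0 v) = word_act Y (W v) (Y v).
  rewrite WE // lincombY; have := pi_row v; rewrite AE !linearB /= linearZ /=.
  by move/eqP; rewrite subr_eq0 subr_eq addrC => /eqP.
pose x := word_pass (r0 := r0) (l0 := l0) (L0 := L0) W Y.
have xF : pass_family r0 lab x by exact: word_pass_family.
have [|f fE] := @link_module_universal _ D e0 M _ (pass_value_family (r_dvd_m := dvd) lab_target xF) _.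
  by rewrite /e0 value_first /x word_pass_start.
have [zF zE] := link_family_values (r_dvd_m := dvd) lab_target (link_family_gen e0).
have [zW zY] := pass_family_words qE W_size zF.
pose Z v : link_module D := link_gen e0 (first v).
have Z0 : Z ord0 = 0 by exact: link_gen_base.
have [|g gE] := coker_factor (h := lincomb (fun j => Z (lift ord0 j))) piP.
  have ZV v : lincomb (fun j => Z (lift ord0 j)) (gen_vec Laurent v) = Z v.
    case: (unliftP ord0 v) => [j|] ->; first by rewrite gen_vec_lift lincomb_delta.
    by rewrite gen_vec0 raddf0 Z0.
  move=> v; rewrite AE !linearB /= linearZ /= !ZV.
  have := zY v; rewrite -/(Z _) -/(Z _) WE // => ->.
  by rewrite [Z v + _]addrC addrK subrr.
have gY v : g (Y v) = Z v.
  rewrite /Y gE; case: (unliftP ord0 v) => [j|] ->; first by rewrite gen_vec_lift /= lincomb_delta.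
  by rewrite gen_vec0 raddf0 Z0.
have gx b : g (x b) = link_gen e0 (pass_edge r0 b 0).
  transitivity (word_pass (r0 := r0) (l0 := l0) (L0 := L0) W Z b); last by symmetry; exact: zW.
  by rewrite /x /word_pass linear_word_act (funext gY : (fun v => g (Y v)) = Z) gY.
exists D, g; exists f => m.
  have [c <-] := piP.1 m; apply: (linear_row_eq (f := f \o g \o pi : {linear _ -> _}) (g := pi)) => j /=.
  rewrite gE /= lincomb_delta fE value_first /x (word_pass_start L0 qE).
  exact: YE.
have gfe e : g (f (link_gen e0 e)) = link_gen e0 e.
  by rewrite fE [RHS]zE /pass_value; case: ifP => _; rewrite gx.
have [u mE] := link_gen_generates e0 m; rewrite mE {m mE}.
elim: u => [|[e []] u IH] /=; first by rewrite !raddf0.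
  by rewrite !linearD !linearZ /= gfe IH.
by rewrite !linearZ_LR !raddfB /= gfe IH.
Qed.

(** * Integer matrices with free cokernel *)

Lemma rat_row_den q (y : 'rV[rat]_q) : exists d : int, exists2 z : 'rV[int]_q, d != 0 &
  d%:~R *: y = map_mx intr z.
Proof.
exists (\prod_j denq (y 0 j)), (\row_j (numq (y 0 j) * \prod_(i | i != j) denq (y 0 i))).
  by apply/prodf_neq0 => j _; rewrite denq_neq0.
apply/rowP => j; rewrite !mxE (bigD1 j) //= !intrM numqE; ring.
Qed.

Section ZCoker.
Variables (p q n : nat) (A : 'M[int]_(p, q)).
Local Notation "A ^Q" := (map_mx (intr : int -> rat) A) (at level 2).
Hypothesis zA : zcoker n A.

Lemma zcoker_mx : exists G : 'M[int]_(q, n),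
  (exists S, S *m G = 1%:M) /\ (forall x : 'rV_q, x *m G = 0 <-> exists a, x = a *m A).
Proof.
have [f [f_surj f_ker]] := zA.
pose G : 'M[int]_(q, n) := \matrix_j f (delta_mx 0 j).
have fG x : f x = x *m G.
  rewrite {1}[x]row_sum_delta raddf_sum mulmx_sum_row; apply: eq_bigr => j _.
  by rewrite rowK -[x 0 j]intz !scaler_int raddfMz.
exists G; split; last by move=> x; rewrite -fG.
have /choice[s sE] k := f_surj (delta_mx 0 k).
exists (\matrix_k s k); apply/row_matrixP => k.
by rewrite row_mul rowK -fG sE row1.
Qed.

Lemma zcoker_rank : (\rank (A^Q) + n)%N = q.
Proof.
have [G [[S SG] Gker]] := zcoker_mx.
have AG : A *m G = 0.
  by apply/row_matrixP => i; rewrite row_mul row0; apply/Gker; exists (delta_mx 0 i); rewrite rowE.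
have rG : \rank (G^Q) = n.
  apply/eqP; rewrite eqn_leq rank_leq_col -{1}(mxrank1 rat n).
  have -> : 1%:M = S^Q *m G^Q by rewrite -map_mxM SG map_scalar_mx rmorph1.
  exact: mxrankM_maxr.
have kA : (kermx (G^Q) == A^Q)%MS.
  apply/andP; split; last by apply/sub_kermxP; rewrite -map_mxM AG map_mx0.
  apply/row_subP => i; set y := row i _.
  have yG : y *m G^Q = 0 by apply/sub_kermxP/row_sub.
  have [d [z d0 zE]] := rat_row_den y.
  have /Gker[a aE] : z *m G = 0.
    apply: (@map_mx_injective _ _ (intr : int -> rat)); first exact: intr_inj.
    by rewrite map_mxM -zE -scalemxAl yG scaler0 map_mx0.
  have dq : d%:~R != 0 :> rat by rewrite intr_eq0.
  rewrite -[y](scalerK dq) zE aE map_mxM scalemxAl; exact: submxMl.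
have := rank_leq_row (G^Q); rewrite -(eqmx_rank kA) mxrank_ker rG; exact: subnK.
Qed.

Lemma zcoker_saturated (k : int) (x : 'rV_q) : k != 0 ->
  (exists a, k *: x = a *m A) -> exists a, x = a *m A.
Proof.
have [f [f_surj f_ker]] := zA; move=> k0 /f_ker e; apply/f_ker.
have : k *: f x = 0 by rewrite -[k]intz scaler_int -raddfMz -scaler_int intz.
by move/eqP; rewrite scalemx_eq0 (negbTE k0) => /eqP.
Qed.

(** In the Smith normal form the nonzero invariant factors are 1 or -1, as the cokernel is
    torsion-free; their number is the rank, q - n. *)
Lemma zcoker_normal_form : exists2 L, L \in unitmx & exists2 R, R \in unitmx &
  A = L *m pid_mx (q - n) *m R.
Proof.
have [L Lu [R Ru [d d_sorted AE]]] := int_Smith_normal_form A.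
set D := (\matrix_(i, j) _) in AE.
have Dspan (x : 'rV_q) : (exists a, x = a *m D) <-> exists a, x *m R = a *m A.
  split=> [[a ->]|[a xE]].
    by exists (a *m invmx L); rewrite AE !mulmxA mulmxKV.
  by exists (a *m L); rewrite -[x](mulmxK Ru) xE AE !mulmxA mulmxK.
have Dsat k (x : 'rV_q) : k != 0 -> (exists a, k *: x = a *m D) -> exists a, x = a *m D.
  by move=> k0; rewrite !Dspan -scalemxAl; apply: zcoker_saturated.
have dunit (i : nat) : (i < p)%N -> (i < q)%N -> d`_i != 0 -> d`_i * d`_i = 1.
  move=> ip iq d0.
  have [|a aE] := Dsat d`_i (delta_mx 0 (Ordinal iq)) d0.
    exists (delta_mx 0 (Ordinal ip)); rewrite -rowE; apply/rowP => j; rewrite !mxE eqxx /=.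
    by rewrite [RHS]mulrb -val_eqE /= eq_sym; case: eqP; rewrite ?mulr1 ?mulr0.
  have : (d`_i %| 1)%Z.
    apply/dvdzP; exists (a 0 (Ordinal ip)); have := congr1 (fun x : 'rV_q => x 0 (Ordinal iq)) aE.
    rewrite [LHS]mxE !eqxx /= => e.
    rewrite -[LHS]/(1%:R : int) e mxE (bigD1 (Ordinal ip)) //= big1 ?addr0 => [|k ki].
      by rewrite mxE eqxx mulr1n.
    rewrite mxE; have -> : (k == Ordinal iq :> nat) = false by apply: contraNF ki => /eqP kp; apply/eqP/val_inj.
    by rewrite mulr0n mulr0.
  by rewrite dvdz1 => /eqP; case: (d`_i) => -[|[|m]].
pose z := find (pred1 (0 : int)) d.
(* z entries of d precede its first 0, and divisibility makes all later ones 0; d may be longer than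
   the diagonal of the matrix. *)
pose k := minn z (minn p q).
have d_after i : (z <= i)%N -> d`_i = 0.
  case: (ltnP z (size d)) => [lt|le] fi; last by apply: nth_default; apply: leq_trans fi.
  have hd : has (pred1 (0 : int)) d by rewrite has_find.
  have [id|] := ltnP i (size d); last by apply: nth_default.
  have := sorted_leq_nth dvdz_trans dvdzz (0 : int) d_sorted z i lt id fi.
  by have /eqP := nth_find (0 : int) hd; rewrite -/z => ->; rewrite dvd0z => /eqP.
have d_before i : (i < z)%N -> d`_i != 0 by move=> /(before_find 0) /= ->.
(* The diagonal matrix of the signs, which is its own inverse. *)
pose E : 'M[int]_p := \matrix_(i, j) ((if (i < k)%N then d`_i else 1) *+ (i == j)).
have EE : E *m E = 1%:M.
  apply/matrixP => i j; rewrite !mxE (bigD1 i) //= big1 ?addr0 => [|l li]; last first.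
    by rewrite !mxE eq_sym (negbTE li) mulr0n mul0r.
  rewrite !mxE eqxx mulr1n; case: (eqVneq i j) => _; rewrite ?mulr0n ?mulr0 // !mulr1n.
  case: ifP => [|_]; last by rewrite mulr1.
  by rewrite /k !leq_min => /and3P[ik ip iq]; apply: dunit => //; apply: d_before.
have [Eu _] := mulmx1_unit EE.
have DE : D = E *m pid_mx k.
  apply/matrixP => i j; rewrite !mxE (bigD1 i) //= big1 ?addr0 => [|l li]; last first.
    by rewrite !mxE eq_sym (negbTE li) mulr0n mul0r.
  rewrite !mxE eqxx mulr1n; case: (eqVneq (i : nat) j) => [ij|_]; last by rewrite mulr0.
  rewrite mulr1n /=; case: ifP => ik; first by rewrite mulr1.
  rewrite mulr0; apply: d_after; move: ik; have := ltn_ord i; have := ltn_ord j.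
  rewrite /k; lia.
have rk : k = (q - n)%N.
  rewrite -zcoker_rank addnK AE DE !map_mxM map_pid_mx.
  rewrite mxrankMfree ?row_free_unit ?rmorph_unitmx // mulmxA eqmxMfull ?rank_pid_mx //.
  - by rewrite /k; lia.
  - by rewrite /k; lia.
  - by rewrite row_full_unit unitmx_mul !rmorph_unitmx.
by exists (L *m E); [rewrite unitmx_mul Lu|exists R; rewrite // -rk AE DE mulmxA].
Qed.
End ZCoker.

Lemma zcoker_equiv p q n (A B : 'M[int]_(p, q)) : zcoker n A -> zcoker n B ->
  exists2 L, L \in unitmx & exists2 R, R \in unitmx & A = L *m B *m R.
Proof.
move=> /zcoker_normal_form[L Lu [R Ru AE]] /zcoker_normal_form[L' Lu' [R' Ru' BE]].
exists (L *m invmx L'); first by rewrite unitmx_mul Lu unitmx_inv.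
exists (invmx R' *m R); first by rewrite unitmx_mul Ru unitmx_inv Ru'.
by rewrite AE BE !mulmxA mulmxKV // mulmxK.
Qed.

(** Since r divides q + 1, the orbits of v -> v + r modulo q + 1 are the residue classes modulo r;
    so the normal form of the relations at t = 1 may be replaced by this shift. *)
Lemma zcoker_shift r0 l0 q : q.+1 = (r0.+1 * l0.+1)%N -> zcoker r0 (orbit_mx (@shift_vertex r0 q)).
Proof.
move=> qE; have rq : (r0.+1 <= q.+1)%N by rewrite qE leq_pmulr.
have rdq : (r0.+1 %| q.+1)%N by rewrite qE dvdn_mulr.
have shiftE (v : 'I_q.+1) : shift_vertex r0 v = ((v + r0.+1) %% q.+1)%N :> nat.
  by rewrite /shift_vertex inordK ?ltn_mod.
pose F (v : 'I_q.+1) : 'I_r0.+1 := inord (v %% r0.+1).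
pose s (k : 'I_r0.+1) : 'I_q.+1 := inord k.
have sE (k : 'I_r0.+1) : s k = k :> nat by rewrite /s inordK // (leq_trans (ltn_ord k)).
have FE v : F v = (v %% r0.+1)%N :> nat by rewrite /F inordK ?ltn_mod.
apply: (@zcoker_orbit_mx _ _ _ F s) => [k||v|v u].
- by apply/val_inj; rewrite /= FE sE modn_small.
- by apply/val_inj; rewrite /= FE mod0n.
- by apply/val_inj; rewrite /= !FE shiftE modn_dvdm // modnDr.
move=> /(congr1 val); rewrite /= !FE => e.
have iterE k : iter k (@shift_vertex r0 q) v = ((v + k * r0.+1) %% q.+1)%N :> nat.
  elim: k => [|k IH]; first by rewrite addn0 modn_small.
  by rewrite iterS shiftE IH modnDml -addnA mulSn [(_ * _ + _)%N]addnC.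
(* Adding q + 1 keeps the difference to v nonnegative and changes nothing modulo r. *)
have [k kE] : exists k, (v + k * r0.+1 = u + q.+1)%N.
  exists ((u + q.+1 - v) %/ r0.+1)%N.
  have le : (v <= u + q.+1)%N by apply: leq_trans (ltnW (ltn_ord v)) (leq_addl _ _).
  rewrite divnK ?subnKC // -(eqn_mod_dvd _ le) eq_sym.
  by rewrite -modnDm (eqP rdq) addn0 modn_mod e.
have -> : u = iter k (@shift_vertex r0 q) v.
  by apply/val_inj; rewrite /= iterE kE modnDr modn_small.
exact: fconnect_iter.
Qed.

Lemma coker_map_equiv p q (A : 'M[Laurent]_(p, q)) (M : lmodType Laurent) (pi : {linear 'rV_q -> M}) L R :
  coker_map A pi -> L \in unitmx -> R \in unitmx ->
  coker_map (L *m A *m R) (pi \o mulmxr (invmx R) : {linear _ -> _}).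
Proof.
move=> [pi_surj pi_ker] Lu Ru; split=> [m|x] /=.
  by have [x <-] := pi_surj m; exists (x *m R); rewrite mulmxK.
rewrite pi_ker; split=> [[a e]|[a ->]].
  by exists (a *m invmx L); rewrite !mulmxA mulmxKV // -e mulmxKV.
by exists (a *m L); rewrite !mulmxA mulmxK.
Qed.

(** L and R have integer entries, so after the base change the value at t = 1 is exactly the shift
    matrix. What remains is a multiple of t - 1 and supplies the increments that the words
    realise. *)
Lemma realize_coker r0 l0 q (A : 'M[Laurent]_(q.+1, q)) (M : lmodType Laurent) (pi : {linear 'rV_q -> M}) :
  q.+1 = (r0.+1 * l0.+1)%N -> coker_map A pi -> zcoker r0 (map_mx laurent_ev1 A) ->
  exists D : vdiagram r0.+1, lmod_iso M (link_module D).
Proof.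
move=> qE piP zA; have [L Lu [R Ru AE]] := zcoker_equiv (zcoker_shift qE) zA.
have Lzu : map_mx (intr : int -> Laurent) L \in unitmx by exact: rmorph_unitmx.
have Rzu : map_mx (intr : int -> Laurent) R \in unitmx by exact: rmorph_unitmx.
have piP' := coker_map_equiv piP Lzu Rzu.
set A' := _ *m _ in piP'; have [C A'E] := laurent_mx_ev1 A'.
have {}A'E : A' = map_mx intr (orbit_mx (@shift_vertex r0 q)) + (laurent_t - 1) *: C.
  by rewrite A'E AE /A' !map_mxM !map_intr_ev1.
apply: (torus_realization (C := C) qE piP') => v.
have gen_intr u : map_mx intr (gen_vec int u) = gen_vec Laurent u :> 'rV_q.
  rewrite /gen_vec; case: (unlift _ _) => [j|]; last exact: map_mx0.
  exact: map_delta_mx.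
rewrite {}A'E linearD /= -map_row rowK map_mxB !gen_intr linearZ /=.
by rewrite -scaleNr opprB.
Qed.

(** * The module E^2 M *)

Section FreeLift.
Variables (R : nzRingType) (V : choiceType) (N : lmodType R) (f : V -> N).

Definition free_lift (x : {freeg V / R}) : N := fglift f x.
Fact free_lift_is_zmod_morphism : zmod_morphism free_lift.
Proof. exact: lift_is_additive. Qed.
HB.instance Definition _ :=
  GRing.isZmodMorphism.Build {freeg V / R} N free_lift free_lift_is_zmod_morphism.
Fact free_lift_is_scalable : scalable free_lift.
Proof.
move=> a x.
have -> : a *: free_lift x = \sum_(k <- dom x) a *: (coeff k x *: f k).
  rewrite -[x in LHS]freeg_sumE raddf_sum scaler_sumr.
  by apply: eq_bigr => k _; rewrite /= /free_lift liftU.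
rewrite [X in free_lift X]/GRing.scale /= /fgscale raddf_sum.
by apply: eq_bigr => k _; rewrite /= /free_lift liftU scalerA.
Qed.
HB.instance Definition _ :=
  GRing.isScalable.Build R {freeg V / R} N *:%R free_lift free_lift_is_scalable.

Lemma free_liftU v : free_lift << v >> = f v.
Proof. by rewrite /free_lift liftU scale1r. Qed.
End FreeLift.

Lemma freegUZ (R : nzRingType) (V : choiceType) (c : R) (v : V) : << c *g v >> = c *: << v >>.
Proof.
by apply/eqP/freeg_eqP => k; rewrite coeffZ !coeffU mul1r.
Qed.

Lemma free_linear_eq (R : nzRingType) (V : choiceType) (N : lmodType R)
    (f g : {linear {freeg V / R} -> N}) : (forall v, f << v >> = g << v >>) -> forall x, f x = g x.
Proof.
move=> fg x; rewrite -[x]freeg_sumE !raddf_sum; apply: eq_bigr => k _ /=.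
by rewrite freegUZ !linearZ /= fg.
Qed.

Lemma linear_comb (R : nzRingType) (X N : lmodType R) (h : {linear X -> N}) e (a : 'I_e -> R) F :
  h (\sum_j a j *: F j) = \sum_j a j *: h (F j).
Proof. by rewrite linear_sum; apply: eq_bigr => j _; rewrite linearZ. Qed.
Lemma linear_combB (R : nzRingType) (X N : lmodType R) (h : {linear X -> N}) e (a : 'I_e -> R) c F :
  h (c - \sum_j a j *: F j) = h c - \sum_j a j *: h (F j).
Proof. by rewrite raddfB /= linear_comb. Qed.

Lemma quot_span_generated (R : nzRingType) (X : lmodType R) (G : set X) e :
  generated_by (quot_span G) e <->
  exists F : 'I_e -> X, forall c, exists a, c - \sum_j a j *: F j \in span_pred G.
Proof.
split=> [[v vE]|[F FE]].
  have /choice[F FE] j := quot_proj_surj (v j); exists F => c.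
  have [a aE] := vE (quot_proj G c); exists a; apply/quot_proj0.
  apply/eqP; rewrite linear_combB subr_eq0 [X in X == _]aE.
  by apply/eqP/eq_bigr => j _; rewrite -FE.
exists (fun j => quot_proj G (F j)) => x; have [c <-] := quot_proj_surj x.
have [a /quot_proj0/eqP] := FE c; rewrite linear_combB subr_eq0 => /eqP aE.
by exists a.
Qed.

Section Cocycle2.
Variables (R : comNzRingType) (M : lmodType R).
Local Notation syz2 := (syzygy M 2).
Local Notation C2 := (cocycle M R^o 2).

(** A 2-cocycle vanishes on the kernel of the cover of the second syzygy, so it is a functional on
    that syzygy; Ext^2 consists of these functionals modulo those that extend to [free_res M 1]. *)
Definition cocycle_syz (f : C2) (w : syz2) : R^o := val f << w >>.

Lemma cocycle_syzE f x : val f x = cocycle_syz f (free_cover x).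
Proof.
have /asboolP[f_lin f0] := valP f.
have [|y yE] := (ker_free_cover (x - << free_cover x >>)).1.
  by rewrite raddfB /= free_cover_surj subrr.
have {f0} := f0 y; rewrite -[free_res_d M 2 y]/(val (free_cover y)) yE => f0.
have {1}-> : x = 1 *: (x - << free_cover x >>) + << free_cover x >> by rewrite scale1r subrK.
by rewrite f_lin f0 scaler0 add0r.
Qed.

Fact cocycle_syz_is_linear f : linear (cocycle_syz f).
Proof.
move=> a w w'; have /asboolP[f_lin _] := valP f.
by rewrite -[RHS]f_lin cocycle_syzE linearP /= !free_cover_surj.
Qed.
HB.instance Definition _ f :=
  GRing.isLinear.Build R syz2 R^o *:%R (cocycle_syz f) (cocycle_syz_is_linear f).

Lemma cocycle_of_syz (g : {linear syz2 -> R^o}) : exists f : C2, forall w, cocycle_syz f w = g w.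
Proof.
have gP : (fun x => g (free_cover x)) \in @cocycle_pred R M R^o 2.
  apply/asboolP; split=> [a x y|x]; first by rewrite !linearP.
  have -> : free_cover (free_res_d M 2 x) = 0 by apply/ker_free_cover; exists x.
  exact: raddf0.
by exists (Cocycle gP) => w; rewrite /cocycle_syz /= free_cover_surj.
Qed.

Lemma coboundary2P (f : C2) : f \in span_pred (@coboundary R M R^o 2) <->
  exists g : {linear free_res M 1 -> R^o}, forall w, cocycle_syz f w = g (val w).
Proof.
have valE (g : {linear free_res M 1 -> R^o}) : (forall w, cocycle_syz f w = g (val w)) ->
    val f = g \o free_res_d M 1.
  by move=> fg; apply/funext => x; rewrite cocycle_syzE fg.
split=> [/asboolP[n [a [c [cP ->]]]]|[g /valE fg]].
  apply: (big_ind (fun f => exists g : {linear free_res M 1 -> R^o}, forall w, cocycle_syz f w = g (val w))).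
  - pose z : {linear free_res M 1 -> R^o} := \0; exists z.
    by move=> w.
  - move=> f1 f2 [g1 e1] [g2 e2]; exists (g1 \+ g2 : {linear _ -> _}) => w /=.
    by rewrite -e1 -e2.
  - move=> i _; have [g gE] := cP i; exists (a i \*: g : {linear _ -> _}) => w /=.
    by rewrite -[LHS]/(a i *: cocycle_syz (c i) w) /cocycle_syz gE /= free_cover_surj.
apply/asboolP; exists 1%N, (fun=> 1), (fun=> f); split; last by rewrite big_ord1 scale1r.
by move=> _; exists g.
Qed.

Lemma Ext2_generated_by e : generated_by (Ext M R^o 2) e <->
  exists F : 'I_e -> {linear syz2 -> R^o}, forall phi : {linear syz2 -> R^o},
    exists a (g : {linear free_res M 1 -> R^o}), forall w,
      phi w = \sum_j a j * F j w + g (val w).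
Proof.
have combE c (a : 'I_e -> R) (F : 'I_e -> C2) w :
    cocycle_syz (c - \sum_j a j *: F j) w = cocycle_syz c w - \sum_j a j * cocycle_syz (F j) w.
  pose ev (f : C2) : R^o := cocycle_syz f w.
  have ev_lin : linear ev by [].
  exact: (linear_combB (HB.pack_for {linear C2 -> R^o} ev (GRing.isLinear.Build _ _ _ _ ev ev_lin))).
rewrite quot_span_generated; split=> [[F FE]|[F FE]].
  exists (fun j => cocycle_syz (F j)) => phi.
  have [c cE] := cocycle_of_syz phi; have [a /coboundary2P[g gE]] := FE c.
  by exists a, g => w; rewrite -gE combE cE addrC subrK.
have /choice[c cE] j := cocycle_of_syz (F j); exists c => f.
have [a [g gE]] := FE (cocycle_syz f); exists a; apply/coboundary2P; exists g => w.
rewrite combE gE; under [X in _ - X]eq_bigr do rewrite cE.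
by rewrite addrAC subrr add0r.
Qed.
End Cocycle2.


Section Comparison.
Variables (R : comNzRingType) (p s : nat) (V : 'M[R]_(s, p)) (F1 S2 : lmodType R).
Variables (iota : {linear S2 -> F1}) (b1 : {linear 'rV[R]_p -> F1}).
Variables (kappa : {linear S2 -> 'rV[R]_s}) (b2 : {linear 'rV[R]_s -> S2}) (h : {linear F1 -> S2}).
Variable (T : 'M[R]_(p, s)).
Hypothesis h_iota : forall w, h (iota w) = w - b2 (kappa w).
Hypothesis iota_b2 : forall c, iota (b2 c) = b1 (c *m V).
Hypothesis kappa_b2 : forall d, kappa (b2 d) = d - d *m V *m T.

Definition row_fun n (gamma : 'cV[R]_n) (c : 'rV[R]_n) : R^o := (c *m gamma) 0 0.
Fact row_fun_is_linear n (gamma : 'cV[R]_n) : linear (row_fun gamma).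
Proof. by move=> a x y; rewrite /row_fun mulmxDl -scalemxAl !mxE. Qed.
HB.instance Definition _ n (gamma : 'cV[R]_n) :=
  GRing.isLinear.Build R 'rV[R]_n R^o *:%R (row_fun gamma) (row_fun_is_linear gamma).

Lemma row_fun_delta n (gamma : 'cV[R]_n) i : row_fun gamma (delta_mx 0 i) = gamma i 0.
Proof. by rewrite /row_fun -rowE mxE. Qed.

Lemma row_funE n (g : {linear 'rV[R]_n -> R^o}) c :
  g c = row_fun (\col_k g (delta_mx 0 k)) c.
Proof. by apply: linear_row_eq => k /=; rewrite row_fun_delta mxE. Qed.

(** From w = b2 (kappa w) + h (iota w), a functional on S2 is a combination of the s coordinates of
    kappa plus one that extends to F1. *)
Lemma comparison_generated : exists F : 'I_s -> {linear S2 -> R^o}, forall phi : {linear S2 -> R^o},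
  exists a (g : {linear F1 -> R^o}), forall w, phi w = \sum_j a j * F j w + g (iota w).
Proof.
exists (fun j => row_fun (delta_mx j 0) \o kappa : {linear _ -> _}) => phi.
exists (fun j => phi (b2 (delta_mx 0 j))), (phi \o h : {linear _ -> _}) => w /=.
rewrite h_iota raddfB /=.
have -> : phi (b2 (kappa w)) = \sum_j phi (b2 (delta_mx 0 j)) * row_fun (delta_mx j 0) (kappa w).
  rewrite [LHS](row_funE (phi \o b2 : {linear _ -> _})) /row_fun mxE; apply: eq_bigr => j _.
  by rewrite mulrC -colE !mxE.
by rewrite addrC subrK.
Qed.

(** A column gamma is a functional on R^s: pull it back along kappa, expand it in the generators,
    and return along b2. The functionals that extend to F1 and the homotopy T both contribute
    columns of the form V u. *)
Lemma comparison_generators e :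
  (exists F : 'I_e -> {linear S2 -> R^o}, forall phi : {linear S2 -> R^o},
     exists a (g : {linear F1 -> R^o}), forall w, phi w = \sum_j a j * F j w + g (iota w)) ->
  exists Y : 'M[R]_(s, e), forall gamma : 'cV_s, exists a u, gamma = Y *m a + V *m u.
Proof.
move=> [F FE]; exists (\matrix_(i, j) F j (b2 (delta_mx 0 i))) => gamma.
have [a [g gE]] := FE (row_fun gamma \o kappa : {linear _ -> _}).
pose G : 'cV_p := \col_k g (b1 (delta_mx 0 k)).
exists (\col_j a j), (G + T *m gamma); apply/colP => i.
have := gE (b2 (delta_mx 0 i)); rewrite /= iota_b2 kappa_b2.
rewrite [g _](row_funE (g \o b1 : {linear _ -> _})) /= -/G raddfB /= row_fun_delta.
move=> /eqP; rewrite subr_eq => /eqP ->; rewrite mulmxDr addrA [RHS]mxE; congr (_ + _).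
  rewrite mxE; congr (_ + _); last by rewrite /row_fun -mulmxA -rowE mxE.
  by rewrite mxE; apply: eq_bigr => j _; rewrite !mxE mulrC.
by rewrite /row_fun -!mulmxA -rowE mxE.
Qed.
End Comparison.

Section Ext2.
Variables (R : comNzRingType) (M : lmodType R) (p q s : nat).
Variables (A : 'M[R]_(p, q)) (V : 'M[R]_(s, p)) (pi : {linear 'rV[R]_q -> M}).
Hypothesis pi_surj : forall m, exists x, pi x = m.
Hypothesis pi_ker : forall x, pi x = 0 <-> exists a, x = a *m A.
Hypothesis VA : V *m A = 0.
Hypothesis V_ker : forall k : 'rV_p, k *m A = 0 -> exists a, k = a *m V.
Hypothesis V_inj : forall a : 'rV_s, a *m V = 0 -> a = 0.

Local Notation syz1 := (syzygy M 1).
Local Notation syz2 := (syzygy M 2).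
Local Notation cov0 := (@free_cover R M).
Local Notation cov1 := (@free_cover R syz1).
Local Notation cov2 := (@free_cover R syz2).

(* a0, a1, kappa and b0, b1, b2 are the comparison maps between the canonical resolution of
   M and 0 -> R^s -> R^p -> R^q -> M; h0 and homotopy1 form a homotopy from b a to id. *)
Let alpha0 (m : M) : 'rV[R]_q := sval (cid (pi_surj m)).
Let a0 : {linear {freeg M / R} -> 'rV[R]_q} := free_lift alpha0.
Let pi_a0 x : pi (a0 x) = cov0 x.
Proof.
apply: (@free_linear_eq R M M (pi \o a0 : {linear _ -> _}) cov0) => m /=.
by rewrite free_liftU free_cover_surj /alpha0; case: cid.
Qed.

Let cov0_val (z : syz1) : cov0 (val z) = 0.
Proof. exact/eqP/(valP z). Qed.
Let cov1_val (w : syz2) : cov1 (val w) = 0.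
Proof. exact/eqP/(valP w). Qed.

Let alpha1_subproof (z : syz1) : exists y : 'rV_p, y *m A = a0 (val z).
Proof. by have /pi_ker[y ->] : pi (a0 (val z)) = 0 by [rewrite pi_a0 cov0_val]; exists y. Qed.
Let alpha1 z := sval (cid (alpha1_subproof z)).
Let a1 : {linear {freeg syz1 / R} -> 'rV[R]_p} := free_lift alpha1.
Let a1A x : a1 x *m A = a0 (val (cov1 x)).
Proof.
apply: (@free_linear_eq R syz1 _ (mulmxr A \o a1 : {linear _ -> _})
  (a0 \o (val \o cov1 : {linear _ -> _}) : {linear _ -> _})) => z /=.
by rewrite free_liftU free_cover_surj /alpha1; case: cid.
Qed.

Let kappa_subproof (w : syz2) : exists c : 'rV_s, c *m V = a1 (val w).
Proof. by have /V_ker[c ->] : a1 (val w) *m A = 0; [rewrite a1A cov1_val raddf0|exists c]. Qed.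
Let kappa w := sval (cid (kappa_subproof w)).
Let kappaV w : kappa w *m V = a1 (val w).
Proof. by rewrite /kappa; case: cid. Qed.
Let V_cancel (c d : 'rV_s) : c *m V = d *m V -> c = d.
Proof. by move=> e; apply/eqP; rewrite -subr_eq0; apply/eqP/V_inj; rewrite mulmxBl e subrr. Qed.
Fact kappa_is_linear : linear kappa.
Proof. by move=> c w w'; apply: V_cancel; rewrite mulmxDl -scalemxAl !kappaV !linearP. Qed.

Let b0 : {linear 'rV[R]_q -> {freeg M / R}} := lincomb (fun j => << pi (delta_mx 0 j) >>).
Let cov0_b0 y : cov0 (b0 y) = pi y.
Proof.
apply: (linear_row_eq (f := cov0 \o b0 : {linear _ -> _}) (g := pi)) => j /=.
by rewrite lincomb_delta free_cover_surj.
Qed.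

Let beta1_subproof i : b0 (row i A) \in ker_pred cov0.
Proof. by apply/eqP; rewrite [LHS]cov0_b0; apply/pi_ker; exists (delta_mx 0 i); rewrite rowE. Qed.
Let b1 : {linear 'rV[R]_p -> {freeg syz1 / R}} := lincomb (fun i => << KerMod (beta1_subproof i) : syz1 >>).
Let val_cov1_b1 y : val (cov1 (b1 y)) = b0 (y *m A).
Proof.
apply: (linear_row_eq (f := val \o (cov1 \o b1 : {linear _ -> _}) : {linear _ -> _})
  (g := b0 \o mulmxr A : {linear _ -> _})) => i /=.
by rewrite lincomb_delta free_cover_surj /= -rowE.
Qed.

Let b2_subproof (c : 'rV_s) : b1 (c *m V) \in ker_pred cov1.
Proof. by apply/eqP/val_inj; rewrite val_cov1_b1 -mulmxA VA mulmx0 !raddf0. Qed.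
Let b2 c : syz2 := KerMod (b2_subproof c).
Fact b2_is_linear : linear b2.
Proof. by move=> a c d; apply: val_inj; rewrite [RHS]linearP /= mulmxDl -scalemxAl linearP. Qed.

Let h0_subproof m : << m >> - b0 (alpha0 m) \in ker_pred cov0.
Proof.
apply/eqP; rewrite [LHS](raddfB cov0) [X in _ - X]cov0_b0 [X in X - _]free_cover_surj.
by rewrite /alpha0; case: cid => x /= ->; rewrite subrr.
Qed.
Let h0 : {linear {freeg M / R} -> {freeg syz1 / R}} :=
  free_lift (fun m => << KerMod (h0_subproof m) : syz1 >>).
Let val_cov1_h0 x : val (cov1 (h0 x)) = x - b0 (a0 x).
Proof.
apply: (@free_linear_eq R M _ (val \o (cov1 \o h0 : {linear _ -> _}) : {linear _ -> _})
  (idfun \- (b0 \o a0 : {linear _ -> _}) : {linear _ -> _})) => m /=.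
by rewrite !free_liftU free_cover_surj.
Qed.
Let kappaL : {linear syz2 -> 'rV[R]_s} := HB.pack kappa (GRing.isLinear.Build _ _ _ _ kappa kappa_is_linear).
Let b2L : {linear 'rV[R]_s -> syz2} := HB.pack b2 (GRing.isLinear.Build _ _ _ _ b2 b2_is_linear).

Let h1 : {linear {freeg syz1 / R} -> {freeg syz1 / R}} :=
  (idfun \- (b1 \o a1 : {linear _ -> _})) \- (h0 \o (val \o cov1 : {linear _ -> _}) : {linear _ -> _}).
Let homotopy1_subproof x : h1 x \in ker_pred cov1.
Proof.
have vc : {morph (fun y => val (cov1 y)) : y z / y - z} by move=> y z; rewrite !raddfB.
by apply/eqP/val_inj; rewrite [LHS](vc _ (h0 _)) (vc x) val_cov1_h0 val_cov1_b1 a1A subrr.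
Qed.
Let homotopy1 x : syz2 := KerMod (homotopy1_subproof x).
Fact homotopy1_is_linear : linear homotopy1.
Proof. by move=> a x y; apply: val_inj; rewrite [RHS]linearP; exact: (linearP h1). Qed.
Let homotopy1L : {linear {freeg syz1 / R} -> syz2} :=
  HB.pack homotopy1 (GRing.isLinear.Build _ _ _ _ homotopy1 homotopy1_is_linear).

Let homotopy1_val w : homotopy1 (val w) = w - b2 (kappa w).
Proof.
apply: val_inj; have h00 : h0 (val (cov1 (val w))) = 0 by rewrite cov1_val; exact: raddf0.
transitivity (val w - b1 (a1 (val w)) - h0 (val (cov1 (val w)))); first by [].
by rewrite h00 -kappaV; exact: subr0.
Qed.


(** The homotopy on the finite side, from a b to the identity, lifted one degree at a time; T is
    what relates kappa b2 to the identity of R^s. *)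
Let HT : exists (H : 'M[R]_(q, p)) (T : 'M[R]_(p, s)),
  forall y, y - a1 (b1 y) - y *m A *m H = y *m T *m V.
Proof.
have /choice[H HE] j : exists h : 'rV_p, delta_mx 0 j - a0 (b0 (delta_mx 0 j)) = h *m A.
  by apply/pi_ker; rewrite raddfB /= pi_a0 cov0_b0 subrr.
have HA y : y - a0 (b0 y) = y *m (\matrix_j H j) *m A.
  apply: (linear_row_eq (f := idfun \- (a0 \o b0 : {linear _ -> _}) : {linear _ -> _})
    (g := mulmxr A \o mulmxr (\matrix_j H j) : {linear _ -> _})) => j /=.
  by rewrite HE -rowE rowK.
have /choice[T TE] i : exists d : 'rV_s,
    delta_mx 0 i - a1 (b1 (delta_mx 0 i)) - delta_mx 0 i *m A *m (\matrix_j H j) = d *m V.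
  by apply: V_ker; rewrite !mulmxBl -HA a1A val_cov1_b1 subrr.
exists (\matrix_j H j), (\matrix_i T i) => y.
apply: (linear_row_eq (f := (idfun \- (a1 \o b1 : {linear _ -> _})) \-
    (mulmxr (\matrix_j H j) \o mulmxr A : {linear _ -> _}) : {linear _ -> _})
  (g := mulmxr V \o mulmxr (\matrix_i T i) : {linear _ -> _})) => i /=.
by rewrite TE -rowE rowK.
Qed.

Lemma Ext2_generated : generated_by (Ext M R^o 2) s.
Proof.
by apply/Ext2_generated_by; apply: (comparison_generated (iota := val) (b2 := b2L) (h := homotopy1L)
  (kappa := kappaL)); exact: homotopy1_val.
Qed.

Lemma Ext2_generators e : generated_by (Ext M R^o 2) e ->
  exists Y : 'M[R]_(s, e), forall gamma : 'cV_s, exists a u, gamma = Y *m a + V *m u.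
Proof.
move=> /Ext2_generated_by; have [H [T TV]] := HT.
apply: (comparison_generators (b1 := b1) (b2 := b2L) (kappa := kappaL) (T := T)) => [//|d].
have dVA : d *m V *m A = 0 by rewrite -mulmxA VA mulmx0.
apply: V_cancel; rewrite kappaV mulmxBl -TV dVA mul0mx subr0.
by rewrite opprB addrC subrK.
Qed.
End Ext2.

(** * The rank of M *)

Section FractionMatrices.
Variable R : idomainType.
Local Notation K := {fraction R}.
Local Notation "A ^K" := (map_mx (@tofrac R) A) (at level 2).

Lemma fraction_den (u : K) : exists d : R, exists2 n : R, d != 0 & tofrac d * u = tofrac n.
Proof.
elim/quotW: u => x; exists \d_x, \n_x; first exact: denom_ratioP.
have d0 := denom_ratioP x.
apply/eqP; rewrite !piE FracField.equivfE /FracField.mulf.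
by rewrite !numden_Ratio ?oner_eq0 ?mul1r ?mulr1 ?d0.
Qed.

Lemma fraction_mx_den m n (A : 'M[K]_(m, n)) : exists d : R, exists2 B : 'M[R]_(m, n),
  d != 0 & tofrac d *: A = B^K.
Proof.
have /choice[d dE] (ij : 'I_m * 'I_n) := fraction_den (A ij.1 ij.2).
have /choice[b bE] (ij : 'I_m * 'I_n) : exists b, tofrac (d ij) * A ij.1 ij.2 = tofrac b.
  by have [b _ e] := dE ij; exists b.
exists (\prod_ij d ij), (\matrix_(i, j) ((\prod_(kl | kl != (i, j)) d kl) * b (i, j))).
  by apply/prodf_neq0 => ij _; have [] := dE ij.
apply/matrixP => i j; rewrite !mxE (bigD1 (i, j)) //= !rmorphM /= -bE /=.
by rewrite [_ * tofrac (\prod_(_ | _) _)]mulrC mulrA.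
Qed.

Lemma map_tofrac_inj m n : injective (@map_mx _ _ (@tofrac R) m n).
Proof. by apply: map_mx_injective => x y /eqP; rewrite tofrac_eq => /eqP. Qed.

(** Clearing denominators shows that V stays independent over the fraction field and still spans the
    kernel there. *)
Lemma left_kernel_rank p q s (A : 'M[R]_(p, q)) (V : 'M[R]_(s, p)) : V *m A = 0 ->
  (forall k : 'rV_p, k *m A = 0 -> exists a, k = a *m V) ->
  (forall a : 'rV_s, a *m V = 0 -> a = 0) -> (s + \rank (A^K))%N = p.
Proof.
move=> VA V_ker V_inj.
have dK (d : R) : d != 0 -> tofrac d != 0 by rewrite tofrac_eq0.
have rV : \rank (V^K) = s.
  apply/eqP/row_freeP; suff : kermx (V^K) == 0.
    by rewrite kermx_eq0 => /row_freeP.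
  apply/eqP/row_matrixP => i; rewrite row0; set y := row i _.
  have yV : y *m V^K = 0 by apply/sub_kermxP/row_sub.
  have [d [z d0 zE]] := fraction_mx_den y.
  have /V_inj z0 : z *m V = 0.
    by apply: map_tofrac_inj; rewrite map_mxM -zE -scalemxAl yV scaler0 map_mx0.
  by rewrite -[y](scalerK (dK d d0)) zE z0 map_mx0 scaler0.
have kV : (kermx (A^K) == V^K)%MS.
  apply/andP; split; last by apply/sub_kermxP; rewrite -map_mxM VA map_mx0.
  apply/row_subP => i; set y := row i _.
  have yA : y *m A^K = 0 by apply/sub_kermxP/row_sub.
  have [d [z d0 zE]] := fraction_mx_den y.
  have /V_ker[a aE] : z *m A = 0.
    by apply: map_tofrac_inj; rewrite map_mxM -zE -scalemxAl yA scaler0 map_mx0.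
  rewrite -[y](scalerK (dK d d0)) zE aE map_mxM scalemxAl; exact: submxMl.
have := rank_leq_row (A^K); rewrite -rV -(eqmx_rank kV) mxrank_ker; exact: subnK.
Qed.
End FractionMatrices.

Section DimensionOfCokernel.
Variables (F : fieldType) (N : lmodType F) (p q : nat) (B : 'M[F]_(p, q)) (rho : {linear 'rV[F]_q -> N}).
Hypothesis rho_surj : forall v, exists x, rho x = v.
Hypothesis rho_ker : forall x, rho x = 0 <-> (x <= B)%MS.

Lemma coker_has_dim : has_dim N (q - \rank B).
Proof.
pose C := row_base (B^C)%MS.
suff : has_dim N (\rank (B^C)%MS) by rewrite mxrank_compl.
have rC y : (y <= C)%MS = (y <= B^C)%MS by rewrite eq_row_base.
exists (fun i => rho (row i C)) => v; have [x <-] := rho_surj v.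
have sumE (a : {ffun _ -> F}) : \sum_i a i *: rho (row i C) = rho ((\row_i a i) *m C).
  by rewrite mulmx_sum_row linear_sum; apply: eq_bigr => i _; rewrite linearZ /= mxE.
have [[y z] /= xE] : exists yz : 'rV_p * 'rV_(\rank (B^C)%MS), x = yz.1 *m B + yz.2 *m C.
  have : (x <= B + B^C)%MS by apply: submx_full; exact: addsmx_compl_full.
  move=> /sub_addsmxP[[y z0] /= ->].
  have /submxP[z zE] : (z0 *m (B^C)%MS <= C)%MS by rewrite rC submxMl.
  by exists (y, z); rewrite zE.
have rhoB y' : rho (y' *m B) = 0 by apply/rho_ker; exact: submxMl.
exists [ffun i => z 0 i]; split.
  rewrite sumE xE raddfD /= rhoB add0r; congr (rho (_ *m C)).
  by apply/rowP => i; rewrite mxE ffunE.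
move=> a; rewrite xE raddfD /= rhoB add0r sumE => /eqP.
rewrite -subr_eq0 -raddfB /= -mulmxBl => /eqP/rho_ker sB.
have : (z - \row_i a i) *m C = 0.
  apply/eqP; rewrite -submx0 -(capmx_compl B) sub_capmx sB /= -rC; exact: submxMl.
move=> /eqP; rewrite mulmx_free_eq0 ?row_base_free // subr_eq0 => /eqP zE.
by apply/ffunP => i; rewrite ffunE zE mxE.
Qed.

(** S writes rho in the basis b and T lifts this basis, so T S = 1 and S has rank n, while the
    kernel of S is the row space of B. *)
Lemma coker_dim_unique n : has_dim N n -> n = (q - \rank B)%N.
Proof.
move=> [b bP]; have /choice[x xE] i := rho_surj (b i).
have /choice[c cE] j : exists a : {ffun 'I_n -> F}, rho (delta_mx 0 j) = \sum_i a i *: b i.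
  by have [a [aE _]] := bP (rho (delta_mx 0 j)); exists a.
pose T := \matrix_i x i; pose S := \matrix_(j, i) c j i.
have bE (a : 'rV_n) : rho (a *m T) = \sum_i a 0 i *: b i.
  rewrite mulmx_sum_row linear_sum; apply: eq_bigr => i _.
  by rewrite linearZ /= rowK xE.
have b_inj (a a' : 'rV_n) : \sum_i a 0 i *: b i = \sum_i a' 0 i *: b i -> a = a'.
  move=> e; have [a0 [_ uniq]] := bP (\sum_i a 0 i *: b i).
  have e1 : a0 = [ffun i => a 0 i] by apply: uniq; apply: eq_bigr => i _; rewrite ffunE.
  have e2 : a0 = [ffun i => a' 0 i] by apply: uniq; rewrite e; apply: eq_bigr => i _; rewrite ffunE.
  by apply/rowP => i; have := congr1 (fun f : {ffun _ -> _} => f i) e1; rewrite e2 !ffunE.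
have rhoS y : rho y = \sum_i (y *m S) 0 i *: b i.
  rewrite -bE; apply: (linear_row_eq (g := rho \o mulmxr T \o mulmxr S : {linear _ -> _})) => j /=.
  by rewrite bE cE; apply: eq_bigr => i _; rewrite -rowE !mxE.
have TS : T *m S = 1%:M.
  apply/row_matrixP => i; apply: b_inj; rewrite row_mul -rhoS rowK xE row1.
  rewrite (bigD1 i) //= big1 ?addr0 => [|j ji]; rewrite mxE ?eqxx ?scale1r // (negbTE ji).
  by rewrite scale0r.
have kS : (kermx S == B)%MS.
  apply/andP; split.
    apply/row_subP => i; set y := row i _; apply/rho_ker.
    have yS : y *m S = 0 by apply/sub_kermxP/row_sub.
    by rewrite rhoS yS big1 // => j _; rewrite mxE scale0r.
  apply/sub_kermxP/row_matrixP => i; apply: b_inj; rewrite row_mul -rhoS row0.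
  rewrite [RHS]big1 => [|j _]; last by rewrite mxE scale0r.
  by apply/rho_ker; exact: row_sub.
have rS : \rank S = n.
  apply/eqP; rewrite eqn_leq rank_leq_col -{1}(mxrank1 F n) -TS; exact: mxrankM_maxr.
by rewrite -(eqmx_rank kS) mxrank_ker subKn rS // -rS rank_leq_row.
Qed.
End DimensionOfCokernel.

Section GenericFiber.
Variables (M : lmodType Laurent) (p q : nat) (A : 'M[Laurent]_(p, q)) (pi : {linear 'rV_q -> M}).
Hypothesis piP : coker_map A pi.
Local Notation K := {fraction Laurent}.
Local Notation tf := (@tofrac Laurent).
Local Notation "A ^K" := (map_mx tf A) (at level 2).
Local Notation G := (@tensor_rel Laurent K tf M).

Let elem (m : M) : generic_fiber M := quot_proj G << m >>.
Let elemD m n : elem (m + n) = elem m + elem n.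
Proof.
apply/eqP; rewrite -subr_eq0 -!raddfD -raddfB opprD addrA; apply/eqP/quot_proj_mem.
by left; exists m, n.
Qed.
Let elemZ a m : elem (a *: m) = tf a *: elem m.
Proof.
apply/eqP; rewrite -subr_eq0 -linearZ -raddfB -freegUZ; apply/eqP/quot_proj_mem.
by right; exists a, m.
Qed.
Let rho : {linear 'rV[K]_q -> generic_fiber M} := lincomb (fun j => elem (pi (delta_mx 0 j))).

Let rho_frac y : rho (y^K) = elem (pi y).
Proof.
rewrite {2}[y]row_sum_delta linear_sum.
have -> : elem (\sum_i pi (y 0 i *: delta_mx 0 i)) = \sum_i elem (pi (y 0 i *: delta_mx 0 i)).
  apply: (big_morph elem elemD); apply: (addrI (elem 0)); by rewrite -elemD !addr0.
by apply: eq_bigr => j _; rewrite mxE linearZ /= elemZ.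
Qed.

Let rho_surj v : exists x, rho x = v.
Proof.
have [x <-] := quot_proj_surj v; rewrite -[x]freeg_sumE raddf_sum.
apply: (big_ind (fun v => exists x, rho x = v)).
- by exists 0; rewrite raddf0.
- by move=> _ _ [y <-] [z <-]; exists (y + z); rewrite raddfD.
move=> m _ /=; have [y <-] := piP.1 m; exists (coeff (pi y) x *: y^K).
transitivity (coeff (pi y) x *: elem (pi y)); first by rewrite linearZ; congr (_ *: _); exact: rho_frac.
by rewrite freegUZ; symmetry; exact: linearZ.
Qed.

(** To bound the kernel, send the symbol of m to the class of any preimage of m in the cokernel of A
    over the fraction field. Two preimages differ by a combination of rows of A, so this is well
    defined and respects the relations of the tensor product. *)
Let rho_ker x : rho x = 0 <-> (x <= A^K)%MS.
Proof.
split=> [x0|/submxP[a ->]]; last first.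
  rewrite mulmx_sum_row linear_sum big1 // => i _; rewrite linearZ /= -map_row -/(rho _) rho_frac.
  have -> : pi (row i A) = 0 by apply/piP.2; exists (delta_mx 0 i); rewrite rowE.
  by have := elemZ 0 0; rewrite scaler0 tofrac0 scale0r => ->; rewrite scaler0.
have /choice[sec secE] m := piP.1 m.
have wd y z : pi y = pi z -> y^K *m cokermx (A^K) = z^K *m cokermx (A^K).
  move=> e; have /piP.2[a aE] : pi (y - z) = 0 by rewrite raddfB /= e subrr.
  apply/eqP; rewrite -subr_eq0 -mulmxBl -map_mxB aE map_mxM -mulmxA mulmx_coker mulmx0.
  by [].
pose h : {linear {freeg M / K} -> 'rV[K]_q} := free_lift (fun m => (sec m)^K *m cokermx (A^K)).
have hE y : h << pi y >> = y^K *m cokermx (A^K).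
  by rewrite /= free_liftU; apply: wd; rewrite secE.
have h0 z : z \in span_pred G -> h z = 0.
  move=> /asboolP[n [a [g [Gg ->]]]]; rewrite linear_sum big1 // => i _; rewrite linearZ /=.
  suff -> : h (g i) = 0 by rewrite scaler0.
  case: (Gg i) => [[m1 [m2 ->]]|[b [m ->]]].
    have [y yE] := piP.1 m1; have [y' yE'] := piP.1 m2.
    have -> : m1 + m2 = pi (y + y') by rewrite linearD yE yE'.
    rewrite -yE -yE' linearB linearB !hE map_mxD mulmxDl.
    by rewrite -addrA -opprD subrr.
  have [y yE] := piP.1 m; have -> : b *: m = pi (b *: y) by rewrite linearZ yE.
  by rewrite -yE (freegUZ (tf b)) linearB hE map_mxZ linearZ_LR hE scalemxAl subrr.
rewrite submxE; apply/eqP.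
have : h (\sum_j x 0 j *: << pi (delta_mx 0 j) >>) = 0.
  by apply/h0/quot_proj0; rewrite linear_sum -[RHS]x0; apply: eq_bigr => j _; rewrite linearZ.
rewrite linear_sum => <-; rewrite {1}[x]row_sum_delta mulmx_suml; apply: eq_bigr => j _.
by rewrite [RHS]linearZ_LR hE map_delta_mx scalemxAl.
Qed.

Lemma generic_fiber_dim n : has_dim (generic_fiber M) n <-> n = (q - \rank (A^K))%N.
Proof.
by split=> [|->]; [apply: coker_dim_unique rho_surj rho_ker _|apply: coker_has_dim rho_surj rho_ker].
Qed.
End GenericFiber.

(** * The characterisation *)

Lemma coker_map_iso p q (A : 'M[Laurent]_(p, q)) (M N : lmodType Laurent) (pi : {linear 'rV_q -> N}) :
  lmod_iso M N -> coker_map A pi -> exists pi' : {linear 'rV_q -> M}, coker_map A pi'.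
Proof.
move=> [f [g fK gK]] [pi_surj pi_ker].
have g_lin : linear g by move=> a x y; apply: (can_inj fK); rewrite linearP !gK.
pose gL : {linear N -> M} := HB.pack g (GRing.isLinear.Build _ _ _ _ g g_lin).
exists (gL \o pi : {linear _ -> _}); split=> [m|x].
  by have [x xE] := pi_surj (f m); exists x; rewrite /= xE fK.
rewrite -pi_ker /=; split=> [e|->]; last exact: (raddf0 gL).
by rewrite -[pi x]gK e raddf0.
Qed.

Lemma coker_map_pad n p q (A : 'M[Laurent]_(n, q)) (M : lmodType Laurent) (pi : {linear 'rV_q -> M}) :
  coker_map A pi -> (n <= p)%N -> exists A' : 'M_(p, q), coker_map A' pi.
Proof.
move=> [pi_surj pi_ker] /subnKC <-; exists (col_mx A 0); split=> // x.
rewrite pi_ker; split=> [[a ->]|[a ->]].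
  by exists (row_mx a 0); rewrite mul_row_col mulmx0 addr0.
by exists (lsubmx a); rewrite -{1}[a]hsubmxK mul_row_col mulmx0 addr0.
Qed.

Lemma min_generators_exists (R : nzRingType) (N : lmodType R) s :
  generated_by N s -> exists2 e, min_generators N e & (e <= s)%N.
Proof.
move=> Ns; have ex : exists n, `[< generated_by N n >] by exists s; apply/asboolP.
case: (ex_minnP ex) => e /asboolP Ne min; exists e; last by apply: min; apply/asboolP.
by split=> // m Nm; apply: min; apply/asboolP.
Qed.

(* The relations are the image of R^p + R^e under the projection to the cokernel of
   (V Y)^T : R^s -> R^p + R^e, which is a split injection with free cokernel. *)
Lemma fewer_relations p q s e (A : 'M[Laurent]_(p, q)) (V : 'M_(s, p)) (Y : 'M_(s, e))
    (M : lmodType Laurent) (pi : {linear 'rV_q -> M}) :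
  coker_map A pi -> V *m A = 0 -> (forall gamma : 'cV_s, exists a u, gamma = Y *m a + V *m u) ->
  exists n (A' : 'M_(n, q)), (n + s = p + e)%N /\ coker_map A' pi.
Proof.
move=> [pi_surj pi_ker] VA VY; pose W := row_mx V Y.
have [Z WZ] : exists Z, W *m Z = 1%:M.
  have /choice[z zE] j : exists z : 'cV_(p + e), col j 1%:M = W *m z.
    by have [a [u ->]] := VY (col j 1%:M); exists (col_mx u a); rewrite mul_row_col addrC.
  exists (\matrix_(i, j) z j i 0); apply/matrixP => i j.
  have /colP/(_ i) := zE j; rewrite [X in X = _ -> _]mxE => ->; rewrite !mxE.
  by apply: eq_bigr => k _; rewrite mxE.
(* Columns annihilated by W are wanted, and [laurent_ker_free] is about rows; hence the
   transposes. *)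
have [n [Nt [NW N_ker N_inj]]] := laurent_ker_free W^T.
pose N := Nt^T; have WN : W *m N = 0 by rewrite -[W]trmxK -trmx_mul NW trmx0.
have N_injr k (u : 'M_(n, k)) : N *m u = 0 -> u = 0.
  move=> Nu; apply: trmx_inj; rewrite trmx0; apply/row_matrixP => i; rewrite row0.
  by apply: N_inj; rewrite -row_mul -[Nt]trmxK -trmx_mul Nu trmx0 row0.
have [X NX] : exists X, 1%:M - Z *m W = N *m X.
  have /choice[x xE] j : exists x : 'rV_n, row j (1%:M - Z *m W)^T = x *m Nt.
    apply: N_ker; rewrite -row_mul -trmx_mul mulmxBr mulmx1 mulmxA WZ mul1mx subrr.
    by rewrite trmx0 row0.
  exists (\matrix_j x j)^T; apply: trmx_inj; rewrite trmx_mul !trmxK.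
  by apply/row_matrixP => j; rewrite row_mul rowK -xE.
have XN : X *m N = 1%:M.
  apply/eqP; rewrite -subr_eq0; apply/eqP/N_injr.
  by rewrite mulmxBr mulmx1 mulmxA -NX mulmxBl mul1mx -mulmxA WN mulmx0 subr0 subrr.
exists n, (lsubmx X *m A); split.
  have <- := left_kernel_rank NW N_ker N_inj; congr (_ + _)%N.
  apply/esym/eqP; rewrite eqn_leq rank_leq_col /= -{1}(mxrank1 {fraction Laurent} s).
  have -> : 1%:M = map_mx (@tofrac Laurent) Z^T *m map_mx (@tofrac Laurent) W^T.
    by rewrite -map_mxM -trmx_mul WZ trmx1 map_mx1.
  exact: mxrankM_maxr.
split=> // x; rewrite pi_ker; split=> [[a ->]|[a ->]]; last first.
  by exists (a *m lsubmx X); rewrite mulmxA.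
(* (a, 0) minus its projection lies in the row span of W, so its first block is of the form z V,
   which A kills. *)
pose y := row_mx a 0 - row_mx a 0 *m N *m X.
have yW : y = y *m Z *m W.
  apply/eqP; rewrite -subr_eq0 -[X in X - _]mulmx1 -mulmxA -mulmxBr NX mulmxA.
  have -> : y *m N = 0 by rewrite /y mulmxBl -(mulmxA _ X) XN mulmx1 subrr.
  by rewrite mul0mx.
move: (y *m Z) yW => z /(congr1 lsubmx); rewrite /y linearB /= row_mxKl.
rewrite -[X in _ *m X]hsubmxK mul_mx_row row_mxKl => e1.
exists (row_mx a 0 *m N); rewrite mulmxA; apply/eqP; rewrite -subr_eq0 -mulmxBl e1.
by rewrite /W mul_mx_row row_mxKl -mulmxA VA mulmx0.
Qed.

Lemma finite_presentation q0 q (M : lmodType Laurent) : generated_by M q0 -> (q0 <= q)%N ->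
  exists p (A : 'M[Laurent]_(p, q)) (pi : {linear 'rV_q -> M}), coker_map A pi.
Proof.
move=> [v vE] q0q.
(* Generators beyond the first q0 are sent to 0, so q can be enlarged until r divides q + 1. *)
pose pi : {linear 'rV[Laurent]_q -> M} := lincomb (fun j : 'I_q => oapp v 0 (insub (val j))).
have [|p [A AE]] := noetherian_row_mx (noetherian_row (q := q) noetherian_laurent) (P := fun x => pi x = 0).
  by split=> [|a x y ex ey]; rewrite ?raddf0 // linearP /= ex ey scaler0 addr0.
exists p, A, pi; split=> // m; have [a ->] := vE m.
exists (\sum_i a i *: delta_mx 0 (widen_ord q0q i)); rewrite linear_sum; apply: eq_bigr => i _.
rewrite linearZ /= lincomb_delta; congr (_ *: _).
by rewrite insubT //= => lt; congr v; apply/val_inj.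
Qed.

Theorem theorem4p3 (r : nat) (M : lmodType Laurent)
    (r_gt0 : (1 <= r)%N) (M_fg : finitely_generated M) :
  (exists l : virtual_link r, is_link_module l M) <->
  (cokernel_free M (r - 1)%N /\
   exists e beta : nat, [/\ min_generators (E2 M) e,
     has_dim (generic_fiber M) beta & (e <= 1 + beta)%N]).
Proof.
case: r r_gt0 => // r0 _; rewrite subn1 /=; split.
  move=> [l [D _ isoD]]; have [q [A [pi0 [pi0P zA]]]] := link_module_coker D.
  have [pi piP] := coker_map_iso isoD pi0P.
  split; first exact/(cokernel_freeP piP).
  have [s [V [VA V_ker V_inj]]] := laurent_ker_free A.
  have [e minE le_es] := min_generators_exists (Ext2_generated piP.1 piP.2 VA V_ker V_inj).
  exists e, (q - \rank (map_mx (@tofrac Laurent) A))%N; split=> //.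
    exact/(generic_fiber_dim piP).
  (* With k the rank of A, s = q + 1 - k and beta = q - k, so s = 1 + beta. *)
  apply: leq_trans le_es _; have := rank_leq_col (map_mx (@tofrac Laurent) A).
  have : (s + \rank (map_mx (@tofrac Laurent) A) = q.+1)%N := left_kernel_rank VA V_ker V_inj.
  by move: (\rank _) => k; lia.
move=> [M_free [e [beta [[E2e _] /[dup] M_dim _ le_e]]]].
have [q0 Mq0] := M_fg; pose q := (r0.+1 * q0.+1).-1.
have qE : q.+1 = (r0.+1 * q0.+1)%N by rewrite prednK // muln_gt0.
have le_q0 : (q0 <= q)%N by rewrite -ltnS qE leq_pmull.
have [p [A0 [pi pi0P]]] := finite_presentation Mq0 le_q0.
have /(generic_fiber_dim pi0P) betaE := M_dim.
have [s [V [VA V_ker V_inj]]] := laurent_ker_free A0.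
have [Y YE] := Ext2_generators pi0P.1 pi0P.2 VA V_ker V_inj E2e.
have [n [A1 [nE pi1P]]] := fewer_relations pi0P VA YE.
(* With k the rank of A0, s = p - k and beta = q - k, so n = p + e - s = k + e is at most q + 1.
   Zero rows make up the difference. *)
have le_n : (n <= q.+1)%N.
  have := rank_leq_col (map_mx (@tofrac Laurent) A0); move: betaE.
  have : (s + \rank (map_mx (@tofrac Laurent) A0) = p)%N := left_kernel_rank VA V_ker V_inj.
  by move: (\rank _) => k; lia.
have [A piP] := coker_map_pad pi1P le_n.
have [D isoD] := realize_coker qE piP ((cokernel_freeP piP r0).1 M_free).
pose l : virtual_link r0.+1 := exist _ (vequiv D) (ex_intro _ D (fun D' => iff_refl _)).
by exists l, D => //; exact: Relation_Operators.rst_refl.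
Qed.
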